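(* There exists a constant $D$ which depends only on $\Phi$ such that for all sufficiently large $\omega$ the scaled traveling wave equation $$\tilde R_\omega=\tilde\chi_\omega\ast\tilde\chi_\omega\ast\Big(\delta_\omega^{m+2}\alpha_\omega^{m+2}\Phi'\big(\tilde R_\omega\big)\Big)$$ admits a unique even solution $\tilde R_\omega$ in the set $$\big\|\tilde R_\omega-\breve R_\omega\big\|_{*,\omega}\le\delta_\omega^{\min\{k,m\}+1}D.$$ Moreover, $\tilde R_\omega$ attains values in $(-1,0]$ and we have $$\big\|\tilde\chi_\omega(\tilde K_\omega-\bar K)\big\|_1\le C\delta_\omega^{\min\{k,m\}},\qquad \big\|(1-\tilde\chi_\omega)\tilde K_\omega\big\|_1\le C\delta_\omega^m$$ as well as $$\big\|\tilde\chi_\omega(\tilde P_\omega-\bar P)\bar Y\big\|_1\le C\delta_\omega^{\min\{k,m\}},\qquad \big\|(1-\tilde\chi_\omega)\tilde P_\omega\big\|_\infty\le C\delta_\omega^{m+2}$$ for some constant $C$ independent of $\omega$, where $\tilde P_\omega=\delta_\omega^{m+2}\alpha_\omega^{m+2}\Phi''(\tilde R_\omega)$ and $\tilde K_\omega=\delta_\omega^{m+1}\alpha_\omega^{m+1}\Phi'(\tilde R_\omega)$.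
   Context: Standing assumption on the potential: there are real $m>0$, $k>0$ with $m\ne k$, $\min\{k,m\}>1$, and a constant $C_\Phi$ such that $\Phi$ is a strictly convex $C^3$-function on $(-1,0]$ with a global minimum at $r=0$, $\Phi(0)=\Phi'(0)=0$, $\Phi''(0)>0$, and for all $r\in(-1,-1/4)$ $$|m+2+\Phi'''(r)(1+r)^{m+3}|\le C_\Phi(1+r)^k,\quad |1+(m+1)\Phi'(r)(1+r)^{m+1}|+|-1+\Phi''(r)(1+r)^{m+2}|\le C_\Phi(1+r)^k.$$ For $\omega>0$ let $\delta_\omega=\omega^{-2/m}$. Let $\bar Y:\mathbb R\to(0,\infty)$ be the unique solution of $\bar Y''=\frac{2}{m+1}\bar Y^{-(m+1)}$, $\bar Y(0)=1$, $\bar Y'(0)=0$. For large $\omega$, $\xi_\omega$ is the unique number $\ge1$ with $\delta_\omega^{m/(m+2)}\big(\xi_\omega\bar Y'(\xi_\omega)+\bar Y(\xi_\omega)\big)=(2\xi_\omega)^{2/(m+2)}$, and $\alpha_\omega=(2\delta_\omega\xi_\omega)^{-2/(m+2)}$. $\tilde\chi_\omega$ is the indicator function of $[-\xi_\omega,\xi_\omega]$; $\ast$ is convolution on $\mathbb R$; $\|\cdot\|_p$ is the $L^p(\mathbb R)$-norm. Put $$\bar P=\frac1{\bar Y^{m+2}},\qquad \bar K=-\frac1{(m+1)\bar Y^{m+1}},\qquad \breve R_\omega=\tilde\chi_\omega\ast\tilde\chi_\omega\ast(\tilde\chi_\omega\,\delta_\omega\alpha_\omega\bar K),$$ $$\|\tilde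 U\|_{*,\omega}=|\tilde U(0)|+\|\tilde U''\|_1+\delta_\omega^2\|\tilde U\|_1+\delta_\omega\|\tilde U\|_\infty.$$ *)

(* Defs.v *)
(* MathComp-Analysis *)
From HB Require Import structures.
From mathcomp Require Import all_boot all_order all_algebra.
From mathcomp Require Import all_classical all_reals all_analysis.

Set Implicit Arguments.
Unset Strict Implicit.
Unset Printing Implicit Defensive.

Import Order.TTheory GRing.Theory Num.Theory.
Import numFieldNormedType.Exports.
Local Open Scope classical_set_scope.
Local Open Scope ring_scope.

Section potential.
Variable R : realType.
Implicit Types (A : set R) (f Phi : R -> R) (m k : R).

(* Derivative relative to A: two-sided at interior points of A, one-sided at
   endpoints belonging to A. *)
Definition quotient_in A f (x : R) :=
  (fun y : R => (f y - f x) / (y - x)) @ within A x^'.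

Definition derivable_in A f := forall x, A x -> cvg (quotient_in A f x).

Definition derive_in A f : R -> R := fun x => lim (quotient_in A f x).

Definition C3_in A f :=
  [/\ derivable_in A f,
      derivable_in A (derive_in A f),
      derivable_in A (derive_in A (derive_in A f)) &
      {within A, continuous (derive_in A (derive_in A (derive_in A f)))}].

Definition strictly_convex_in A f := forall x y t : R,
  A x -> A y -> x != y -> 0 < t -> t < 1 ->
  f (t * x + (1 - t) * y) < t * f x + (1 - t) * f y.

Definition domPhi : set R := `]-1, 0].

(* A potential is a total function, but only its values on domPhi are ever
   used; dPhi n is its n-th derivative on domPhi. *)
Definition dPhi (n : nat) Phi : R -> R := iter n (derive_in domPhi) Phi.

Record admissible_potential m k Phi : Prop := AdmissiblePotential {
  m_gt0 : 0 < m ;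
  k_gt0 : 0 < k ;
  m_neq_k : m != k ;
  min_gt1 : 1 < Num.min k m ;
  Phi_C3 : C3_in domPhi Phi ;
  Phi_strictly_convex : strictly_convex_in domPhi Phi ;
  Phi_min0 : forall r, domPhi r -> Phi 0 <= Phi r ;
  Phi0 : Phi 0 = 0 ;
  dPhi0 : dPhi 1 Phi 0 = 0 ;
  d2Phi0 : 0 < dPhi 2 Phi 0 ;
  Phi_singular : exists CPhi : R, forall r : R, -1 < r -> r < - (1 / 4) ->
    `| m + 2 + dPhi 3 Phi r * (1 + r) `^ (m + 3) | <= CPhi * (1 + r) `^ k /\
    `| 1 + (m + 1) * dPhi 1 Phi r * (1 + r) `^ (m + 1) |
      + `| -1 + dPhi 2 Phi r * (1 + r) `^ (m + 2) | <= CPhi * (1 + r) `^ k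
}.

End potential.

Arguments domPhi {R}.

Section scaling.
Variable R : realType.
Implicit Types (m omega delta xi : R) (Y f g U V : R -> R).

Local Notation mu := (@lebesgue_measure R).

Definition is_Ybar m Y :=
  [/\ forall x, 0 < Y x,
      forall x, derivable Y x 1,
      forall x, derivable (derive1 Y) x 1,
      forall x, derive1 (derive1 Y) x = 2 / (m + 1) * Y x `^ (- (m + 1)) &
      Y 0 = 1 /\ derive1 Y 0 = 0].

Definition delta_of m omega : R := omega `^ (- (2 / m)).

(* For large omega exactly one xi has this property. *)
Definition is_xi m Y omega xi :=
  let delta := delta_of m omega in
  1 <= xi /\
  delta `^ (m / (m + 2)) * (xi * derive1 Y xi + Y xi)
    = (2 * xi) `^ (2 / (m + 2)).

Definition alpha_of m omega xi : R :=
  (2 * delta_of m omega * xi) `^ (- (2 / (m + 2))).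

Definition chi xi : R -> R := \1_(`[- xi, xi]).

Definition conv f g : R -> R := fun x => \int[mu]_y (f (x - y) * g y).

Definition Pbar m Y : R -> R := fun x => (Y x `^ (m + 2))^-1.

Definition Kbar m Y : R -> R := fun x => - ((m + 1) * Y x `^ (m + 1))^-1.

Definition Rbreve m Y omega xi : R -> R :=
  conv (chi xi) (conv (chi xi) (fun x =>
    chi xi x * (delta_of m omega * alpha_of m omega xi * Kbar m Y x))).

Definition Lp_norm (p : \bar R) f : \bar R := 'N[mu]_p [EFin \o f]%E.

(* V is the weak second derivative of U: U is differentiable and its derivative
   is locally absolutely continuous with density V.  Convolutions with chi are
   in general not twice differentiable at every point. *)
Definition weak_second_derivative U V :=
  (forall x, derivable U x 1) /\
  forall a b, a <= b ->
    mu.-integrable `[a, b] (EFin \o V) /\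
    derive1 U b - derive1 U a = \int[mu]_(x in `[a, b]) V x.

(* V is determined by U almost everywhere, so the set below has at most one
   element; it is empty, and the norm +oo, when U has no weak second
   derivative. *)
Definition star_norm delta U : \bar R :=
  ereal_inf [set N : \bar R | exists2 V, weak_second_derivative U V &
    N = ((`| U 0 |%R)%:E + Lp_norm 1 V
         + (delta ^+ 2)%R%:E * Lp_norm 1 U + delta%:E * Lp_norm +oo U)%E].

(* The right-hand side involves Phi', hence only makes sense for functions with
   values in domPhi; this is part of being a solution. *)
Definition solves_TW m (Phi : R -> R) omega xi (Rt : R -> R) :=
  let delta := delta_of m omega in
  let alpha := alpha_of m omega xi in
  (forall x, domPhi (Rt x)) /\
  forall x, Rt x = conv (chi xi) (conv (chi xi) (fun y =>
    delta `^ (m + 2) * alpha `^ (m + 2) * dPhi 1 Phi (Rt y))) x.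

Definition Ptilde m (Phi : R -> R) omega xi (Rt : R -> R) : R -> R := fun x =>
  delta_of m omega `^ (m + 2) * alpha_of m omega xi `^ (m + 2)
  * dPhi 2 Phi (Rt x).

Definition Ktilde m (Phi : R -> R) omega xi (Rt : R -> R) : R -> R := fun x =>
  delta_of m omega `^ (m + 1) * alpha_of m omega xi `^ (m + 1)
  * dPhi 1 Phi (Rt x).

End scaling.

(* Main.v *)
(* With R = Rbreve + U the equation becomes U = chi * chi * (f(U) + chi Pbar U),
   where the residual f(U) is what is left of the force after subtracting its
   value and its linearization at the profile -1 + delta alpha Ybar.

   Linear part.  Since chi * chi * g has second derivative g (x + 2 xi) - 2 g x
   + g (x - 2 xi), on [-xi, xi] the linear equation is the ODE Z'' = -2 Pbar
   (Z + e) with the boundary condition xi Z'(xi) + Z(xi) = 0.  The homogeneous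
   ODE is the linearized profile equation; its even solution
   T = Ybar - (m + 2)/2 x Ybar', generated by scaling, and its odd solution
   Ybar', generated by translation, are explicit, T violates the boundary
   condition by an amount of order xi, and the Wronskian of T and Ybar' is
   constant.  This gives existence by variation of constants, and a bound on U
   in the star norm by the L1 norm of f(U), uniformly in omega.

   Nonlinear part.  Inside [-xi, xi] the singular bounds on Phi' and Phi''
   compare the force with the profile up to relative errors of order
   U / (delta alpha Ybar) and (delta alpha Ybar)^k; weighted by Pbar Ybar the
   latter integrates to delta^min(k, m) because m and k differ.  Outside, R stays
   away from -1 and the prefactor delta^(m + 2) wins.  Hence f(0) is of order
   delta^(min(k, m) + 1) and f has a Lipschitz constant of order
   delta^min(k, m) from the star norm to L1, so Picard iteration applies. *)

Require Import Defs.
From mathcomp Require Import all_boot all_order all_algebra.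
From mathcomp Require Import all_classical all_reals all_analysis.
From mathcomp Require Import measurable_realfun ess_sup_inf.
From mathcomp Require Import ring lra.
Import Order.TTheory GRing.Theory Num.Theory.
Import numFieldNormedType.Exports.
Local Open Scope classical_set_scope.
Local Open Scope ring_scope.

Set Implicit Arguments.
Unset Strict Implicit.


(** * Derivatives and signed primitives *)

Section calculus.
Context {R : realType}.
Implicit Types (f g h F G : R -> R) (x y a b c : R).
Local Notation mu := (@lebesgue_measure R).

(** Uniformity rests on a balance of powers of [xi], which is of order [1 / delta]. The double
    convolution costs a factor [xi] in the supremum and [xi ^ 2] in L1; the weights [delta] and
    [delta ^ 2] of the star norm pay for these. The value at the origin carries no such weight:
    there the factor [xi] in the boundary data is cancelled by the equally large boundary defect of
    [T]. The iteration does not run in the star norm, an infimum over weak second derivatives that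
    is awkward under limits, but with the weaker predicate [tame]. The star bound of the limit comes
    back from the a priori estimate, since the limit is a fixed point. Conversely, a competitor in
    the star ball is tame for every larger radius, so contraction is proved on the ball of twice the
    radius. Nonpositivity of the wave is not known during the iteration; it follows at the end from
    the equation and the sign of Phi'. Sources jump at [xi] and [- xi], so the differential equation
    is used classically on the open interval between [0] and [xi], and evenness covers the other
    half. *)

Lemma is_derive_val x f a b : is_derive x 1 f a -> a = b -> is_derive x 1 f b.
Proof. by move=> h <-. Qed.

Lemma dvD f g x a b : is_derive x 1 f a -> is_derive x 1 g b ->
  is_derive x 1 (fun y => f y + g y) (a + b).
Proof. by move=> fa gb; exact: (is_deriveD fa gb). Qed.

Lemma dvN f x a : is_derive x 1 f a -> is_derive x 1 (fun y => - f y) (- a).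
Proof. by move=> fa; exact: (is_deriveN fa). Qed.

Lemma dvB f g x a b : is_derive x 1 f a -> is_derive x 1 g b ->
  is_derive x 1 (fun y => f y - g y) (a - b).
Proof. by move=> fa gb; exact: (is_deriveB fa gb). Qed.

Lemma dvM f g x a b : is_derive x 1 f a -> is_derive x 1 g b ->
  is_derive x 1 (fun y => f y * g y) (f x * b + g x * a).
Proof. by move=> fa gb; exact: (is_deriveM fa gb). Qed.

Lemma dvC x c : is_derive x 1 (fun _ : R => c) 0.
Proof. exact: is_derive_cst. Qed.

Lemma dvI x : is_derive x 1 (fun y : R => y) 1.
Proof. exact: is_derive_id. Qed.

Lemma dvZ f x a c : is_derive x 1 f a -> is_derive x 1 (fun y => c * f y) (c * a).
Proof.
move=> fa; apply: is_derive_val (dvM (dvC x c) fa) _.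
by rewrite mulr0 addr0.
Qed.

Lemma dv_comp f g x a b : is_derive (g x) 1 f a -> is_derive x 1 g b ->
  is_derive x 1 (fun y => f (g y)) (a * b).
Proof. by move=> fa gb; exact: (is_derive1_comp fa gb). Qed.

Lemma dv_shift f x c a : is_derive (x + c) 1 f a ->
  is_derive x 1 (fun y => f (y + c)) a.
Proof.
move=> fa; apply: is_derive_val (@dv_comp f (fun y => y + c) x a _ fa (dvD (dvI x) (dvC x c))) _.
by rewrite addr0 mulr1.
Qed.

Lemma dv_refl f x a : is_derive (- x) 1 f a -> is_derive x 1 (fun y => f (- y)) (- a).
Proof.
move=> fa; apply: is_derive_val (dv_comp fa (dvN (dvI x))) _.
by rewrite mulrN1.
Qed.

Lemma dv_continuous f f' : (forall x, is_derive x 1 f (f' x)) -> continuous f.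
Proof.
by move=> df x; apply: differentiable_continuous; apply/derivable1_diffP; case: (df x).
Qed.

Lemma mvt f f' a b : a <= b -> (forall x, a < x -> x < b -> is_derive x 1 f (f' x)) ->
  {within `[a, b], continuous f} ->
  exists c, [/\ a <= c, c <= b & f b - f a = f' c * (b - a)].
Proof.
move=> ab df cf; have [|c] := @MVT_segment R f f' a b ab _ cf.
  by move=> x; rewrite in_itv/= => /andP[]; exact: df.
by rewrite in_itv/= => /andP[ac cb] ->; exists c.
Qed.

Lemma ge0_dv_le f f' a b : a <= b -> continuous f ->
  (forall x, a < x -> x < b -> is_derive x 1 f (f' x)) ->
  (forall x, a < x -> x < b -> 0 <= f' x) -> f a <= f b.
Proof.
move=> ab cf df f0.
apply: (@ger0_derive1_ndecr R f a b) => //; last exact: continuous_subspaceT.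
- by move=> x; rewrite in_itv/= => /andP[ax xb]; case: (df x ax xb).
- by move=> x; rewrite in_itv/= => /andP[ax xb]; rewrite derive1E (@derive_val _ _ _ _ _ _ _ (df x ax xb)) f0.
Qed.

Lemma dv_norm_le f f' g g' a b : a <= b -> continuous f -> continuous g ->
  (forall x, a < x -> x < b -> is_derive x 1 f (f' x)) ->
  (forall x, a < x -> x < b -> is_derive x 1 g (g' x)) ->
  (forall x, a < x -> x < b -> `|f' x| <= g' x) -> `|f b - f a| <= g b - g a.
Proof.
move=> ab cf cg df dg fg; rewrite ler_norml; apply/andP; split.
- have : g a + f a <= g b + f b; last lra.
  apply: (@ge0_dv_le (fun x => g x + f x) (fun x => g' x + f' x)) => //.
  + by move=> x; apply: cvgD; [exact: cg|exact: cf].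
  + by move=> x ax xb; apply: dvD; [exact: dg|exact: df].
  + by move=> x ax xb; have := fg x ax xb; rewrite ler_norml => /andP[]; lra.
- have : g a - f a <= g b - f b; last lra.
  apply: (@ge0_dv_le (fun x => g x - f x) (fun x => g' x - f' x)) => //.
  + by move=> x; apply: cvgB; [exact: cg|exact: cf].
  + by move=> x ax xb; apply: dvB; [exact: dg|exact: df].
  + by move=> x ax xb; have := fg x ax xb; rewrite ler_norml => /andP[]; lra.
Qed.

Lemma dv0_const f a b : a <= b -> continuous f ->
  (forall x, a < x -> x < b -> is_derive x 1 f 0) -> f b = f a.
Proof.
move=> ab cf df; apply/eqP; rewrite -subr_eq0 -normr_le0.
have := @dv_norm_le f (fun=> 0) (fun=> 0) (fun=> 0) a b ab cf (@cst_continuous _ _ 0) df.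
by rewrite subrr; apply=> // x _ _; rewrite normr0.
Qed.

Lemma dv_eq f g h : (forall x, is_derive x 1 f (h x)) ->
  (forall x, is_derive x 1 g (h x)) -> f 0 = g 0 -> f = g.
Proof.
move=> df dg fg0; apply/funext => x.
have dfg (y : R) : is_derive y 1 (fun y => f y - g y) 0.
  by apply: is_derive_val (dvB (df y) (dg y)) _; rewrite subrr.
have cfg := dv_continuous dfg.
apply/eqP; rewrite -subr_eq0; apply/eqP.
have [x0|/ltW x0] := leP 0 x.
- by rewrite (dv0_const x0 cfg (fun y _ _ => dfg y)) fg0 subrr.
- by rewrite -(dv0_const x0 cfg (fun y _ _ => dfg y)) fg0 subrr.
Qed.

Lemma continuous_itv_integrable f a b : continuous f ->
  mu.-integrable `[a, b] (EFin \o f).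
Proof.
move=> cf; apply: continuous_compact_integrable; first exact: segment_compact.
exact: continuous_subspaceT.
Qed.

Lemma Rintegral_itv_split f a b c : mu.-integrable `[a, c] (EFin \o f) ->
  a <= b -> b <= c ->
  \int[mu]_(x in `[a, c]) f x =
  \int[mu]_(x in `[a, b]) f x + \int[mu]_(x in `[b, c]) f x.
Proof.
move=> fi ab bc.
have := @Rintegral_itvB R f (BLeft a) (BRight c) b fi.
rewrite !bnd_simp => /(_ ab bc).
rewrite Rintegral_itv_obnd_cbnd; last first.
  apply: integrableS fi => //=.
  by apply: subset_itv; rewrite bnd_simp.
by move=> <-; ring.
Qed.

Lemma Rintegral_itv11 f a : \int[mu]_(x in `[a, a]) f x = 0.
Proof. by rewrite set_itv1 Rintegral_set1. Qed.

(** An oriented integral, hence a primitive on the whole line; normalized at [0], so that closed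
    forms and parities follow by comparing derivatives in [prm_eq]. *)
Definition prm f x := if 0 <= x then \int[mu]_(t in `[0, x]) f t
  else - \int[mu]_(t in `[x, 0]) f t.

Lemma prmE f a b : continuous f -> a <= b ->
  \int[mu]_(x in `[a, b]) f x = prm f b - prm f a.
Proof.
move=> cf ab; rewrite /prm; have ci u v := @continuous_itv_integrable f u v cf.
have [b0|b0] := leP 0 b; have [a0|a0] := leP 0 a.
- by rewrite (@Rintegral_itv_split f 0 a b)//; ring.
- by rewrite (@Rintegral_itv_split f a 0 b) ?(ltW a0)//; ring.
- by have := le_lt_trans a0 (le_lt_trans ab b0); rewrite ltxx.
- by rewrite (@Rintegral_itv_split f a b 0) ?(ltW b0)//; ring.
Qed.

Lemma prm0 f : prm f 0 = 0.
Proof. by rewrite /prm lexx Rintegral_itv11. Qed.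

Lemma prm_dv f x : continuous f -> is_derive x 1 (prm f) (f x).
Proof.
move=> cf.
have xx : x < x + 1 by lra.
have xx' : x - 1 < x by lra.
have [d e] := @continuous_FTC1_closed R f (x - 1) x (x + 1) xx
  (@continuous_itv_integrable f _ _ cf) xx' (cf x).
have df : is_derive x 1 (fun y => \int[mu]_(t in `[x - 1, y]) f t) (f x).
  by apply: DeriveDef; [exact: d|rewrite -derive1E; exact: e].
have := dvD df (dvC x (prm f (x - 1))); rewrite addr0.
apply: near_eq_is_derive.
near=> y; rewrite prmE//; first by rewrite subrK.
near: y; exists 1 => //= z /=.
by rewrite ltr_norml => /andP[]; lra.
Unshelve. all: by end_near. Qed.

Lemma prm_continuous f : continuous f -> continuous (prm f).
Proof. by move=> cf; apply: (@dv_continuous _ f) => x; exact: prm_dv. Qed.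

Lemma prm_eq f F : continuous f -> (forall x, is_derive x 1 F (f x)) -> F 0 = 0 ->
  prm f = F.
Proof. by move=> cf dF F0; apply: (@dv_eq _ _ f) => // [x|]; [exact: prm_dv|rewrite prm0]. Qed.

Lemma prm_odd f x : continuous f -> (forall y, f (- y) = f y) -> prm f (- x) = - prm f x.
Proof.
move=> cf ef; rewrite -[LHS]opprK; congr (- _).
suff e : prm f = (fun y => - prm f (- y)) by rewrite [in RHS]e.
apply: prm_eq => // [y|]; last by rewrite oppr0 prm0 oppr0.
apply: is_derive_val (dvN (dv_refl (prm_dv (- y) cf))) _.
by rewrite opprK ef.
Qed.

Lemma prm_even f x : continuous f -> (forall y, f (- y) = - f y) -> prm f (- x) = prm f x.
Proof.
move=> cf of_; suff e : prm f = (fun y => prm f (- y)) by rewrite {1}e opprK.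
apply: prm_eq => // [y|]; last by rewrite oppr0 prm0.
apply: is_derive_val (dv_refl (prm_dv (- y) cf)) _.
by rewrite of_ opprK.
Qed.

End calculus.

Opaque prm.

(** * L1 bounds: translation, Fatou's lemma, and the supremum norm of continuous functions *)

Section L1.
Context {R : realType}.
Implicit Types (f g h F G : R -> R) (x y a b c : R).
Local Notation mu := (@lebesgue_measure R).

Definition L1_le f c :=
  measurable_fun setT f /\ (\int[mu]_x (`|f x|)%:E <= c%:E)%E.

Lemma continuous_measurable f : continuous f -> measurable_fun setT f.
Proof. by move=> cf; apply: continuous_measurable_fun. Qed.

Lemma measurable_norm f : measurable_fun setT f ->
  measurable_fun setT (fun x => (`|f x|)%:E).
Proof. by move=> mf; apply/measurable_EFinP; exact: measurableT_comp. Qed.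

Lemma integral_norm_ge0 f : (0 <= \int[mu]_x (`|f x|)%:E)%E.
Proof. by apply: integral_ge0 => x _; rewrite lee_fin. Qed.

Lemma L1_le_ge0 f c : L1_le f c -> 0 <= c.
Proof. by case=> _ fc; rewrite -lee_fin; apply: le_trans fc; exact: integral_norm_ge0. Qed.

Lemma L1_le_mono f g c : measurable_fun setT f -> L1_le g c ->
  (forall x, `|f x| <= `|g x|) -> L1_le f c.
Proof.
move=> mf [mg gc] fg; split => //; apply: le_trans gc.
by apply: ge0_le_integral => //; [exact: measurable_norm|exact: measurable_norm|
  move=> x _; rewrite lee_fin].
Qed.

Lemma L1_le_trans f a b : a <= b -> L1_le f a -> L1_le f b.
Proof. by move=> ab [mf fa]; split => //; apply: (le_trans fa); rewrite lee_fin. Qed.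

Lemma L1_leD f g a b : L1_le f a -> L1_le g b -> L1_le (fun x => f x + g x) (a + b).
Proof.
move=> [mf fa] [mg gb]; have mfg : measurable_fun setT (fun x => f x + g x).
  exact: measurable_funD.
split => //.
have := leeD fa gb; rewrite -EFinD => h; apply: le_trans h.
rewrite -ge0_integralD//; [|exact: measurable_norm..].
apply: ge0_le_integral => //; first exact: measurable_norm.
  by apply: emeasurable_funD; exact: measurable_norm.
by move=> x _; rewrite -EFinD lee_fin ler_normD.
Qed.

Lemma L1_leZ f c k : L1_le f c -> L1_le (fun x => k * f x) (`|k| * c).
Proof.
move=> [mf fc]; split; first exact: measurable_funM.
under eq_integral do rewrite normrM EFinM.
rewrite ge0_integralZl_EFin//; last exact: measurable_norm.
by rewrite EFinM; apply: lee_wpmul2l => //; rewrite lee_fin.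
Qed.

Lemma L1_leN f c : L1_le f c -> L1_le (fun x => - f x) c.
Proof.
move=> /[dup] fc0 fc; apply: L1_le_mono fc _ => [|x]; last by rewrite normrN.
by case: fc0 => mf _; exact: measurableT_comp.
Qed.

Lemma L1_leB f g a b : L1_le f a -> L1_le g b -> L1_le (fun x => f x - g x) (a + b).
Proof. by move=> fa gb; apply: L1_leD => //; exact: L1_leN. Qed.

Lemma L1_le_integrable f c (D : set R) : measurable D -> L1_le f c ->
  mu.-integrable D (EFin \o f).
Proof.
move=> mD [mf fc]; apply: (@integrableS _ _ _ _ setT) => //.
apply/integrableP; split; first exact/measurable_EFinP.
by apply: le_lt_trans fc _; rewrite ltry.
Qed.

Lemma L1_le_Rint f c a b : L1_le f c -> `|\int[mu]_(x in `[a, b]) f x| <= c.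
Proof.
move=> fc; have fi D mD := @L1_le_integrable f c D mD fc.
have mab : measurable (`[a, b] : set R) by [].
apply: le_trans (le_normr_Rintegral _ (fi _ mab)) _ => //.
rewrite -lee_fin /Rintegral fineK; last first.
  apply: integrable_fin_num => //.
  exact: (integrable_norm (fi _ mab)).
case: fc => mf; apply: le_trans.
by apply: ge0_subset_integral => //; exact: measurable_norm.
Qed.

Let trans (t : R) : measurableTypeR R -> measurableTypeR R := fun x : R => x + t.

Let measurable_trans (t : R) : measurable_fun setT (trans t).
Proof. by apply: measurable_funD. Qed.

(** Lebesgue measure is determined by its values on half-open intervals, and a translation pulls
    such an interval back to one of equal length. *)
Lemma translation_mu (t : R) (A : set R) : measurable A ->
  mu A = pushforward mu (trans t) A.
Proof.
have mt := measurable_trans t.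
pose nu : {measure set (measurableTypeR R) -> \bar R} :=
  measure_function_pushforward__canonical__measure_function_Measure mu mt.
move=> mA; apply: (@lebesgue_measure_unique R nu) => // X [[u v] _ <-]/=.
rewrite /nu /= /pushforward.
rewrite (_ : _ @^-1` _ = [set` `](u - t), (v - t)]]); last first.
  by apply/seteqP; split=> y /=; rewrite /trans !in_itv/= ltrBlDr lerBrDr.
rewrite !lebesgue_measure_itv/= !lte_fin.
have -> : (u - t < v - t) = (u < v) by rewrite ltrD2r.
by case: ifP => // _; rewrite -!EFinB; congr (_%:E); ring.
Qed.

Lemma L1_le_shift f c t : L1_le f c -> L1_le (fun x => f (x + t)) c.
Proof.
have mt := measurable_trans t.
move=> [mf fc]; split; first exact: (measurableT_comp mf mt).
have -> // : (\int[mu]_x (`|f (x + t)|)%:E = \int[mu]_x (`|f x|)%:E)%E.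
have := @ge0_integral_pushforward _ _ _ _ _ _ mt (@lebesgue_measure R) setT (fun x => (`|f x|)%:E).
rewrite preimage_setT /comp => <- //; last exact: measurable_norm.
by apply: eq_measure_integral => A mA _; exact/esym/translation_mu.
Qed.

Lemma Rintegral_shift f a b t : measurable_fun setT f ->
  mu.-integrable `[a, b] (EFin \o (fun x => f (x + t))) ->
  \int[mu]_(x in `[a, b]) f (x + t) = \int[mu]_(x in `[(a + t), (b + t)]) f x.
Proof.
have mt := measurable_trans t.
have e : trans t @^-1` [set` `[(a + t), (b + t)]] = [set` `[a, b]].
  by apply/seteqP; split=> y /=; rewrite /trans !in_itv/= !lerD2r.
move=> mf fi; congr fine; symmetry.
have := @integral_pushforward _ _ _ _ _ _ mt (@lebesgue_measure R) `[(a + t), (b + t)] (EFin \o f).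
rewrite e => <- //; last exact/measurable_EFinP.
by apply: eq_measure_integral => A mA _; exact: translation_mu.
Qed.

(** Needed because the fixed point is constructed as a pointwise limit, before any convergence in L1
    is available. *)
Lemma L1_le_fatou (f : nat -> R -> R) g c : (forall n, L1_le (f n) c) ->
  (forall x, (fun n => f n x) @ \oo --> g x) -> measurable_fun setT g -> L1_le g c.
Proof.
move=> fc fg mg; split => //.
have := @fatou _ _ _ mu setT measurableT (fun n x => (`|f n x|)%:E) _ _.
have h1 n : measurable_fun setT (fun x => (`|f n x|)%:E) by apply: measurable_norm; case: (fc n).
move=> /(_ h1) /(_ (fun n x _ => _)) => h.
have {h} := h (fun n x => normr_ge0 _).
have -> : (\int[mu]_(x in setT) limn_einf ((fun n x => (`|f n x|)%:E)^~ x) =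
  \int[mu]_x (`|g x|)%:E)%E.
  apply: eq_integral => x _.
  have : (fun n => (`|f n x|)%:E) @ \oo --> (`|g x|)%:E.
    by apply: cvg_EFin; [exact: nearW|apply: cvg_norm; exact: fg].
  by move=> /cvg_limn_einf_sup [].
move=> /le_trans; apply; rewrite limn_einf_lim.
apply: lime_le; first exact: is_cvg_einfs.
apply: nearW => n; case: (fc n) => _; apply: le_trans.
by apply: ereal_inf_lbound; exists n => /=.
Qed.

Lemma Lp_norm1 f : Lp_norm 1 f = (\int[mu]_x (`|f x|)%:E)%E.
Proof. by rewrite /Lp_norm Lnorm1. Qed.

Lemma Lp_norm1_le f c : L1_le f c -> (Lp_norm 1 f <= c%:E)%E.
Proof. by rewrite Lp_norm1 => -[]. Qed.

Lemma mu_setT_gt0 : (0 < mu setT)%E.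
Proof. by rewrite -(set_itvNyy R) lebesgue_measure_itv/= ltry. Qed.

Lemma Lp_normoo_le f c : (forall x, `|f x| <= c) -> (Lp_norm +oo f <= c%:E)%E.
Proof.
move=> fc; rewrite /Lp_norm unlock mu_setT_gt0.
by apply/ess_supP; apply: nearW => x /=; rewrite lee_fin.
Qed.

Lemma Lp_normoo_ge0 f : (0 <= Lp_norm +oo f)%E.
Proof. exact: Lnorm_ge0. Qed.

Lemma Lp_norm1_ge0 f : (0 <= Lp_norm 1 f)%E.
Proof. exact: Lnorm_ge0. Qed.

(** By continuity a violation at one point spreads to a ball, which has positive measure and so
    cannot lie in a null set. *)
Lemma Lp_normoo_continuous f c : continuous f -> (Lp_norm +oo f <= c%:E)%E ->
  forall x, `|f x| <= c.
Proof.
move=> cf + x; rewrite /Lp_norm unlock mu_setT_gt0 => /ess_supP.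
case=> A [mA A0 Ac]; rewrite leNgt; apply/negP => cx.
have : \forall y \near x, c < `|f y|.
  have : `|f y| @[y --> x] --> `|f x| by apply: cvg_norm; exact: cf.
  by move=> /(_ [set z | c < z]); apply; exact: lt_nbhsr.
move=> /nbhs_ballP[e /= e0 xe].
have : (mu (ball x e) <= mu A)%E.
  apply: le_measure; rewrite ?inE; [exact: measurable_ball|exact: mA|].
  by move=> y /xe cy; apply: Ac => /=; rewrite lee_fin leNgt cy.
by rewrite A0 lebesgue_measure_ball ?(ltW e0)// lee_fin leNgt mulrn_wgt0.
Qed.

End L1.

(** * Double convolution with an indicator *)

Section tent.
Context {R : realType}.
Implicit Types (f g h F G p q : R -> R) (s x y a b c : R).
Local Notation mu := (@lebesgue_measure R).

Definition primitive f F := forall a b, a <= b ->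
  mu.-integrable `[a, b] (EFin \o f) /\ \int[mu]_(x in `[a, b]) f x = F b - F a.

Definition clamp s x := Num.max (- s) (Num.min x s).
(* With q and p continuous: every discontinuous function that occurs has this
   form, and its primitive is then an explicit expression in prm and clamp. *)
Definition cutsum s q p x := q x + chi s x * p x.
Definition cutsum1 s q p x := prm q x + prm p (clamp s x).
Definition cutsum2 s q p := prm (cutsum1 s q p).
Definition diff2 s F x := F (x + 2 * s) - 2 * F x + F (x - 2 * s).

Lemma chi_in s x : - s <= x -> x <= s -> chi s x = 1.
Proof. by move=> h1 h2; rewrite /chi indicE mem_set//= in_itv/= h1 h2. Qed.

Lemma chi_out s x : s < `|x| -> chi s x = 0.
Proof.
move=> h; rewrite /chi indicE memNset//= in_itv/= => /andP[h1 h2].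
by move: h; rewrite ltNge ler_norml h1 h2.
Qed.

Lemma chi_measurable s : measurable_fun setT (chi s).
Proof. by apply: measurable_indic. Qed.

Lemma clamp_in s x : - s <= x -> x <= s -> clamp s x = x.
Proof. by move=> h1 h2; rewrite /clamp (min_idPl h2) (max_idPr h1). Qed.

Lemma clamp_ge s x : 0 <= s -> s <= x -> clamp s x = s.
Proof. by move=> s0 h; rewrite /clamp (min_idPr h) max_r//; lra. Qed.

Lemma clamp_le s x : 0 <= s -> x <= - s -> clamp s x = - s.
Proof. by move=> s0 h; rewrite /clamp (@min_l _ _ x s) ?max_l//; lra. Qed.

Lemma clampN s x : 0 <= s -> clamp s (- x) = - clamp s x.
Proof.
move=> s0; have [h|h] := leP x (- s).
  by rewrite (clamp_le s0 h) clamp_ge//; lra.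
have [h'|h'] := leP x s; last by rewrite (@clamp_ge s x) ?(ltW h')// clamp_le//; lra.
by rewrite !clamp_in//; lra.
Qed.

Lemma clamp_continuous s : continuous (clamp s).
Proof.
move=> x; apply: (@continuous_max R R (cst (- s)) (fun x => Num.min x s)).
  exact: cst_continuous.
by apply: (@continuous_min R R id (cst s)); [exact: cvg_id|exact: cst_continuous].
Qed.

Section pair.
Variables (s : R) (q p : R -> R).
Hypotheses (s0 : 0 <= s) (cq : continuous q) (cp : continuous p).

Lemma cutsum1_continuous : continuous (cutsum1 s q p).
Proof.
move=> x; apply: cvgD; first exact: prm_continuous.
by apply: continuous_comp; [exact: clamp_continuous|exact: prm_continuous].
Qed.

Lemma cutsum2_dv x : is_derive x 1 (cutsum2 s q p) (cutsum1 s q p x).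
Proof. exact/prm_dv/cutsum1_continuous. Qed.

Lemma cutsum_measurable : measurable_fun setT (cutsum s q p).
Proof.
apply: measurable_funD; first exact: continuous_measurable.
by apply: measurable_funM; [exact: chi_measurable|exact: continuous_measurable].
Qed.

Lemma chi_primitive : primitive (fun x => chi s x * p x) (fun x => prm p (clamp s x)).
Proof.
have e : (fun x => chi s x * p x) = p \_ `[- s, s].
  by apply/funext => x; rewrite patch_indic /= mulrC.
move=> a b ab; rewrite e; split.
  rewrite -restrict_EFin.
  have ms : measurable (`[- s, s] : set R) by [].
  have mab : measurable (`[a, b] : set R) by [].
  have := @integrable_restrict _ _ _ mu _ ms _ mab (EFin \o p) => -[+ _]; apply.
  apply: (integrableS _ _ _ (continuous_itv_integrable a b cp)) => //.
  exact: measurableI.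
rewrite -Rintegral_mkcondr.
have -> : [set` `[a, b]] `&` [set` `[- s, s]] = [set` `[Num.max a (- s), Num.min b s]].
  apply/seteqP; split => x /=; rewrite !in_itv/= ge_max le_min.
    by move=> [/andP[-> ->] /andP[-> ->]].
  by move=> /andP[/andP[-> ->] /andP[-> ->]].
(* If the intersection is empty, [a] and [b] lie on the same side of [[- s, s]], where [clamp] is
   constant. *)
have [h|h] := leP (Num.max a (- s)) (Num.min b s); last first.
  rewrite set_itv_ge ?bnd_simp -?ltNge// Rintegral_set0.
  move: h; rewrite lt_max !gt_min => /orP[|] /orP[|] h.
  - by move: (lt_le_trans h ab); rewrite ltxx.
  - by rewrite (clamp_ge s0 (ltW h)) (clamp_ge s0) ?subrr//; clear e; lra.
  - by rewrite (clamp_le s0 (ltW h)) (clamp_le s0) ?subrr//; clear e; lra.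
  - by move: h; rewrite ltNge (@le_trans _ _ 0) ?oppr_le0.
rewrite (prmE cp h).
have [ha|ha] := leP a (- s).
- by rewrite (clamp_le s0 ha) /clamp (max_idPr _) //; move: h; rewrite (max_idPr ha).
- rewrite (max_idPl (ltW ha)) in h *; rewrite /clamp (max_idPr (le_trans (ltW ha) h)).
  by rewrite -/(clamp s a) clamp_in ?(ltW ha)//; apply: (le_trans h); rewrite ge_min lexx orbT.
Qed.

Lemma cutsum_primitive : primitive (cutsum s q p) (cutsum1 s q p).
Proof.
move=> a b ab; have [i e] := chi_primitive ab.
have iq := continuous_itv_integrable a b cq.
split; first exact: (integrableD _ iq i).
by rewrite RintegralD// prmE// e /cutsum1; ring.
Qed.

Lemma cutsum1_dv_in x : - s < x -> x < s ->
  is_derive x 1 (cutsum1 s q p) (q x + p x).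
Proof.
move=> h1 h2; apply: dvD; first exact: prm_dv.
apply: near_eq_is_derive (prm_dv x cp).
near=> y; rewrite clamp_in//; apply/ltW; near: y.
  exact: lt_nbhsr.
exact: lt_nbhsl.
Unshelve. all: by end_near. Qed.

Lemma cutsum1_dv_gt x : s < x -> is_derive x 1 (cutsum1 s q p) (q x).
Proof.
move=> h; rewrite -[q x]addr0; apply: dvD; first exact: prm_dv.
apply: near_eq_is_derive (dvC x (prm p s)).
near=> y; rewrite clamp_ge//; apply/ltW; near: y.
exact: lt_nbhsr.
Unshelve. all: by end_near. Qed.

Lemma cutsum1_dv_lt x : x < - s -> is_derive x 1 (cutsum1 s q p) (q x).
Proof.
move=> h; rewrite -[q x]addr0; apply: dvD; first exact: prm_dv.
apply: near_eq_is_derive (dvC x (prm p (- s))).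
near=> y; rewrite clamp_le//; apply/ltW; near: y.
exact: lt_nbhsl.
Unshelve. all: by end_near. Qed.

End pair.

Lemma diff2_dv s F F' : (forall x, is_derive x 1 F (F' x)) ->
  forall x, is_derive x 1 (diff2 s F) (diff2 s F' x).
Proof.
move=> dF x.
exact: (dvD (dvB (dv_shift (dF _)) (dvZ 2 (dF x))) (dv_shift (dF (x - 2 * s)))).
Qed.

Lemma conv_chi s f F : 0 <= s -> primitive f F ->
  Defs.conv (chi s) f = fun x => F (x + s) - F (x - s).
Proof.
move=> s0 fF; apply/funext => x; rewrite /Defs.conv.
have le : x - s <= x + s by lra.
have [_ <-] := fF _ _ le.
rewrite [RHS]Rintegral_mkcond; congr (fine _); apply: eq_integral => y _.
congr (_%:E); rewrite patch_indic /= mulrC; congr (_ * _).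
rewrite /chi !indicE; congr (_%:R); congr nat_of_bool.
by apply/idP/idP => /set_mem/= h; apply/mem_set => /=; move: h;
  rewrite !in_itv/= => /andP[? ?]; apply/andP; split; lra.
Qed.

Lemma continuous_shift1 F t : continuous F -> continuous (fun x => F (x + t)).
Proof.
move=> cF x; apply: (@continuous_comp _ _ _ (fun x => x + t) F); last exact: cF.
by apply: cvgD; [exact: cvg_id|exact: cst_continuous].
Qed.

Lemma integrable_shift f a b t : measurable_fun setT f ->
  mu.-integrable `[a + t, b + t] (EFin \o f) ->
  mu.-integrable `[a, b] (EFin \o (fun x => f (x + t))).
Proof.
move=> mf fi; have mab : measurable ([set` `[a + t, b + t]] : set R) by [].
have [_ fc] := integrableP _ _ _ fi.
pose g := f \_ [set` `[a + t, b + t]].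
have mg : measurable_fun setT g by apply/(measurable_restrictT _ _).1 => //; exact: measurable_funTS.
have gc : L1_le g (fine (\int[mu]_(x in `[a + t, b + t]) (`|f x|)%:E)).
  split=> //; rewrite fineK; last first.
    by rewrite ge0_fin_numE//; apply: integral_ge0 => x _; rewrite lee_fin.
  rewrite [leRHS]integral_mkcond le_eqVlt; apply/orP; left; apply/eqP.
  by apply: eq_integral => x _; rewrite /g !patchE; case: ifP => //; rewrite normr0.
have mab' : measurable ([set` `[a, b]] : set R) by [].
have := L1_le_integrable mab' (L1_le_shift t gc).
apply: eq_integrable => // x; rewrite inE/= in_itv/= => /andP[ax xb].
by rewrite /= /g patchE mem_set//= in_itv/=; apply/andP; split; lra.
Qed.

Lemma primitive_shiftB F s : continuous F ->
  primitive (fun x => F (x + s) - F (x - s))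
    (fun x => prm F (x + s) - prm F (x - s)).
Proof.
move=> cF a b ab.
have cd : continuous (fun x => F (x + s) - F (x - s)).
  by move=> x; apply: cvgB; apply: continuous_shift1.
split; first exact: continuous_itv_integrable.
rewrite (prmE cd ab); pose G x := prm F (x + s) - prm F (x - s).
have -> : prm (fun x => F (x + s) - F (x - s)) = (fun x => G x - G 0).
  apply: prm_eq => //; last by rewrite subrr.
  move=> x; rewrite -[X in is_derive _ _ _ X]subr0.
  exact: (dvB (dvB (dv_shift (prm_dv _ cF)) (dv_shift (prm_dv _ cF))) (dvC x _)).
by rewrite opprB addrA subrK.
Qed.

Definition tent s f := Defs.conv (chi s) (Defs.conv (chi s) f).

Section pair2.
Variables (s : R) (q p : R -> R).
Hypotheses (s0 : 0 <= s) (cq : continuous q) (cp : continuous p).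

Let F := cutsum1 s q p.
Let H := cutsum2 s q p.
Let cF : continuous F.
Proof. exact: cutsum1_continuous. Qed.
Let dH x : is_derive x 1 H (F x).
Proof. exact: cutsum2_dv. Qed.

Lemma conv_cutsum : Defs.conv (chi s) (cutsum s q p) = fun x => F (x + s) - F (x - s).
Proof. by apply: conv_chi => //; exact: cutsum_primitive. Qed.

Lemma tent_cutsum : tent s (cutsum s q p) = diff2 s H.
Proof.
rewrite /tent conv_cutsum (conv_chi s0 (primitive_shiftB s cF)).
apply/funext => x; rewrite /diff2 -/H /H /cutsum2 -/F.
have -> : x + s + s = x + 2 * s by ring.
have -> : x - s - s = x - 2 * s by ring.
have -> : x + s - s = x by ring.
have -> : x - s + s = x by ring.
ring.
Qed.

Lemma tent_dv x : is_derive x 1 (tent s (cutsum s q p)) (diff2 s F x).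
Proof. by rewrite tent_cutsum; exact: diff2_dv. Qed.

Lemma tent_continuous : continuous (tent s (cutsum s q p)).
Proof. exact: dv_continuous tent_dv. Qed.

(** Identifies the weak second derivative of a double convolution. The classical one may fail at the
    points where one of the three arguments meets [s] or [- s]. *)
Lemma diff2_primitive : primitive (diff2 s (cutsum s q p)) (diff2 s F).
Proof.
have pr := cutsum_primitive s0 cq cp; have mf := cutsum_measurable s cq cp.
have sh t a b : a <= b -> mu.-integrable `[a, b] (EFin \o (fun x => cutsum s q p (x + t))) /\
    \int[mu]_(x in `[a, b]) cutsum s q p (x + t) = F (b + t) - F (a + t).
  move=> ab; have ab' : a + t <= b + t by lra.
  have [i e] := pr _ _ ab'.
  have i' : mu.-integrable `[a, b] (EFin \o (fun x => cutsum s q p (x + t))).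
    exact: integrable_shift.
  by split=> //; rewrite Rintegral_shift.
move=> a b ab.
have [i1 e1] := sh (2 * s) _ _ ab.
have [i2 e2] := pr _ _ ab.
have [i3 e3] := sh (- (2 * s)) _ _ ab.
have i2' : mu.-integrable `[a, b] (EFin \o (fun x => 2 * cutsum s q p x)).
  have -> : EFin \o (fun x => 2 * cutsum s q p x) = (fun x => 2%:E * (EFin \o cutsum s q p) x)%E.
    by apply/funext => x.
  exact: integrableZl.
have i12 : mu.-integrable `[a, b] (EFin \o (fun x => cutsum s q p (x + 2 * s) - 2 * cutsum s q p x)).
  exact: (integrableB _ i1 i2').
split; first exact: (integrableD _ i12 i3).
rewrite /diff2 RintegralD// RintegralB// RintegralZl// e1 e2 e3.
rewrite /F; move: (cutsum1 s q p) => G; ring.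
Qed.

Section bounds.
Variable c : R.
Hypothesis fc : L1_le (cutsum s q p) c.

Lemma cutsum1_osc x y : `|F y - F x| <= c.
Proof.
wlog xy : x y / x <= y.
  by move=> h; have [/h //|/ltW /h] := leP x y; rewrite distrC.
have [_ <-] := cutsum_primitive s0 cq cp xy.
exact: L1_le_Rint.
Qed.

Lemma L1_le_diff2 : L1_le (diff2 s (cutsum s q p)) (4 * c).
Proof.
have -> : 4 * c = c + `|2| * c + c by rewrite ger0_norm//; ring.
apply: L1_leD; last exact: L1_le_shift.
by apply: L1_leB; [exact: L1_le_shift|exact: L1_leZ].
Qed.

Lemma diff2_cutsum1_le x : `|diff2 s F x| <= 2 * c.
Proof.
have -> : diff2 s F x = (F (x + 2 * s) - F x) + (F (x - 2 * s) - F x).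
  by rewrite /diff2; ring.
apply: le_trans (ler_normD _ _) _.
by have h1 := cutsum1_osc x (x + 2 * s); have h2 := cutsum1_osc x (x - 2 * s); lra.
Qed.

(** The second difference of [H] is the increment of [H (x + s) - H (x - s)] over an interval of
    length [2 * s], and the derivative of that function is an increment of [F], hence at most
    [c]. *)
Lemma tent_le x : `|tent s (cutsum s q p) x| <= 2 * s * c.
Proof.
have cG : continuous (fun x => H (x + s) - H (x - s)).
  have cH : continuous H by exact: dv_continuous dH.
  by move=> y; apply: cvgB; apply: continuous_shift1.
have := @dv_norm_le _ (fun x => H (x + s) - H (x - s)) (fun x => F (x + s) - F (x - s))
  (fun x => c * x) (fun=> c * 1) (x - s) (x + s) _ cG _ _ _ _.
rewrite tent_cutsum /diff2.
have -> : x + s + s = x + 2 * s by ring.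
have -> : x - s - s = x - 2 * s by ring.
have -> : x + s - s = x by ring.
have -> : x - s + s = x by ring.
have -> : H (x + 2 * s) - H x - (H x - H (x - 2 * s)) = H (x + 2 * s) - 2 * H x + H (x - 2 * s) by ring.
have -> : c * (x + s) - c * (x - s) = 2 * s * c by ring.
apply.
- by rewrite lerD2l ge0_cp.
- by move=> y; apply: cvgM; [exact: cst_continuous|exact: cvg_id].
- by move=> y _ _; exact: (dvB (dv_shift (dH _)) (dv_shift (dH _))).
- by move=> y _ _; rewrite mulr1; exact: cutsum1_osc.
Qed.

End bounds.

Lemma tent_even : (forall x, q (- x) = q x) -> (forall x, p (- x) = p x) ->
  forall x, tent s (cutsum s q p) (- x) = tent s (cutsum s q p) x.
Proof.
move=> eq ep x.
have oF y : F (- y) = - F y.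
  by rewrite /F /cutsum1 clampN// !prm_odd//; ring.
have eH y : H (- y) = H y by exact: prm_even.
rewrite tent_cutsum /diff2 eH.
have -> : - x + 2 * s = - (x - 2 * s) by ring.
have -> : - x - 2 * s = - (x + 2 * s) by ring.
by rewrite !eH; ring.
Qed.

End pair2.

End tent.

(** * L1 bounds, linearity and sign of the double convolution *)

Section tent_bounds.
Context {R : realType}.
Implicit Types (f g h F G p q : R -> R) (s x y a b c : R).
Local Notation mu := (@lebesgue_measure R).

(** Young's inequality for the window: the difference is dominated by the integral of [|f|] against
    [chi s (x - y)], and Tonelli's theorem integrates the window first, which yields its length
    [2 * s]. *)
Lemma L1_le_diff s f F c : 0 <= s -> primitive f F -> continuous F -> L1_le f c ->
  L1_le (fun x => F (x + s) - F (x - s)) (2 * s * c).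
Proof.
move=> s0 fF cF fc.
have cd : continuous (fun x => F (x + s) - F (x - s)).
  by move=> x; apply: cvgB; apply: continuous_shift1.
split; first exact: continuous_measurable.
pose k (x y : R) := (chi s (x - y) * `|f y|)%:E.
have [mf fi] := fc.
have mk : measurable_fun setT (fun z : measurableTypeR R * measurableTypeR R => k z.1 z.2).
  apply/measurable_EFinP; apply: measurable_funM.
    apply: (measurableT_comp (chi_measurable s)).
    by apply: measurable_funB; [exact: measurable_fst|exact: measurable_snd].
  apply: measurableT_comp; first exact: normr_measurable.
  by apply: measurableT_comp; [exact: mf|exact: measurable_snd].
have k0 x y : (0 <= k x y)%E.
  by rewrite lee_fin mulr_ge0// /chi indicE.
have le1 x : ((`|F (x + s) - F (x - s)|)%:E <= \int[mu]_y k x y)%E.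
  have xs : x - s <= x + s by rewrite lerD2l ge0_cp.
  have [i <-] := fF _ _ xs.
  have mi : measurable ([set` `[x - s, x + s]] : set R) by [].
  apply: (@le_trans _ _ (\int[mu]_(y in [set` `[(x - s)%R, (x + s)%R]]) (`|f y|)%:E)%E).
    have -> : (`|\int[mu]_(t in [set` `[(x - s)%R, (x + s)%R]]) f t|%R%:E =
        `|\int[mu]_(t in [set` `[(x - s)%R, (x + s)%R]]) (f t)%:E|)%E.
      by rewrite -[in RHS](fineK (integrable_fin_num _ i)).
    by apply: le_abse_integral => //; case/integrableP: i.
  rewrite integral_mkcond le_eqVlt; apply/orP; left; apply/eqP.
  apply: eq_integral => y _; rewrite /k patchE.
  have [h|h] := boolP (y \in [set` `[x - s, x + s]]).
    move: h; rewrite inE/= in_itv/= => /andP[h1 h2].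
    by rewrite chi_in ?mul1r//; lra.
  rewrite chi_out ?mul0r// ltNge; apply/negP; rewrite ler_norml => /andP[h1 h2].
  by move/negP: h; apply; rewrite inE/= in_itv/=; apply/andP; split; lra.
apply: (@le_trans _ _ (\int[mu]_x \int[mu]_y k x y)%E).
  apply: ge0_le_integral => //.
  - by apply: measurable_norm; exact: continuous_measurable.
  - exact: (@measurable_fun_fubini_tonelli_F _ _ _ _ R (@lebesgue_measure R) (fun z => k z.1 z.2) mk (fun z => k0 z.1 z.2)).
have /= -> := @fubini_tonelli _ _ _ _ R (@lebesgue_measure R) (@lebesgue_measure R) _ mk (fun z => k0 z.1 z.2).
have e y : (\int[mu]_x k x y = (2 * s)%:E * (`|f y|)%:E)%E.
  have -> : (\int[mu]_x k x y = \int[mu]_x ((`|f y|)%:E * (\1_([set` `[(y - s), (y + s)]]) x)%:E))%E.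
    apply: eq_integral => x _; rewrite /k -EFinM mulrC; congr (_%:E); congr (_ * _).
    rewrite /chi !indicE; congr (_%:R); congr nat_of_bool.
    by apply/idP/idP => /set_mem/= h; apply/mem_set => /=; move: h;
      rewrite !in_itv/= => /andP[? ?]; apply/andP; split; lra.
  rewrite ge0_integralZl_EFin//; last by apply/measurable_EFinP; exact: measurable_indic.
  rewrite integral_indic// setIT muleC; congr (_ * _)%E.
  apply: (etrans (@lebesgue_measure_itv R `[(y - s), (y + s)])).
  rewrite /= lte_fin.
  case: ltP => [_|ys]; first by rewrite -EFinB; congr (_%:E); ring.
  have -> : s = 0 by apply/eqP; rewrite eq_le s0 andbT; lra.
  by rewrite mulr0.
under eq_integral do rewrite e.
rewrite ge0_integralZl_EFin//; [|exact: measurable_norm|by rewrite mulr_ge0].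
by rewrite [leRHS]EFinM; apply: lee_wpmul2l => //; rewrite lee_fin mulr_ge0.
Qed.

Section pair.
Variables (s : R) (q p : R -> R).
Hypotheses (s0 : 0 <= s) (cq : continuous q) (cp : continuous p).

Lemma L1_le_tent c : L1_le (cutsum s q p) c ->
  L1_le (tent s (cutsum s q p)) (4 * s ^+ 2 * c).
Proof.
move=> fc; have cF := @cutsum1_continuous R s q p cq cp.
have fF := cutsum_primitive s0 cq cp.
have h := L1_le_diff s0 fF cF fc.
have := L1_le_diff s0 (primitive_shiftB s cF) _ h.
rewrite /tent conv_cutsum// (conv_chi s0 (primitive_shiftB s cF)).
rewrite (_ : 2 * s * (2 * s * c) = 4 * s ^+ 2 * c); last by ring.
by apply; move=> x; apply: cvgB; apply: continuous_shift1; exact: prm_continuous.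
Qed.

End pair.

Lemma cutsum_eq s q1 p1 q2 p2 : (forall x, q1 x = q2 x) ->
  (forall x, - s <= x -> x <= s -> p1 x = p2 x) -> cutsum s q1 p1 = cutsum s q2 p2.
Proof.
move=> hq hp; apply/funext => x; rewrite /cutsum hq; congr (_ + _).
have [h|h] := leP `|x| s; last by rewrite chi_out// !mul0r.
by move: h; rewrite ler_norml => /andP[h1 h2]; rewrite hp.
Qed.

Lemma prmD f g : continuous f -> continuous g ->
  prm (fun x => f x + g x) = fun x => prm f x + prm g x.
Proof.
move=> cf cg; apply: prm_eq; first by move=> x; apply: cvgD; [exact: cf|exact: cg].
  by move=> x; apply: dvD; exact: prm_dv.
by rewrite !prm0 addr0.
Qed.

Lemma prmZ k f : continuous f -> prm (fun x => k * f x) = fun x => k * prm f x.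
Proof.
move=> cf; apply: prm_eq; first by move=> x; apply: cvgM; [exact: cst_continuous|exact: cf].
  by move=> x; apply: dvZ; exact: prm_dv.
by rewrite !prm0 mulr0.
Qed.

Lemma tentD s q1 p1 q2 p2 x : 0 <= s -> continuous q1 -> continuous p1 ->
  continuous q2 -> continuous p2 ->
  tent s (cutsum s q1 p1) x + tent s (cutsum s q2 p2) x =
  tent s (cutsum s (fun x => q1 x + q2 x) (fun x => p1 x + p2 x)) x.
Proof.
move=> s0 cq1 cp1 cq2 cp2.
have cqq : continuous (fun x => q1 x + q2 x) by move=> ?; apply: cvgD; [exact: cq1|exact: cq2].
have cpp : continuous (fun x => p1 x + p2 x) by move=> ?; apply: cvgD; [exact: cp1|exact: cp2].
rewrite !tent_cutsum// /diff2 /cutsum2.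
have -> : cutsum1 s (fun x => q1 x + q2 x) (fun x => p1 x + p2 x) =
  fun x => cutsum1 s q1 p1 x + cutsum1 s q2 p2 x.
  by apply/funext => y; rewrite /cutsum1 !prmD//; ring.
rewrite (prmD (@cutsum1_continuous R s _ _ cq1 cp1) (@cutsum1_continuous R s _ _ cq2 cp2)).
by move: (prm (cutsum1 s q1 p1)) (prm (cutsum1 s q2 p2)) => A B; ring.
Qed.

Lemma tentZ s k q p x : 0 <= s -> continuous q -> continuous p ->
  k * tent s (cutsum s q p) x = tent s (cutsum s (fun x => k * q x) (fun x => k * p x)) x.
Proof.
move=> s0 cq cp.
have ck f : continuous f -> continuous (fun x => k * f x).
  by move=> cf ?; apply: cvgM; [exact: cst_continuous|exact: cf].
rewrite !tent_cutsum//; [|exact: ck..]; rewrite /diff2 /cutsum2.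
have -> : cutsum1 s (fun x => k * q x) (fun x => k * p x) =
  fun x => k * cutsum1 s q p x.
  by apply/funext => y; rewrite /cutsum1 !prmZ//; ring.
rewrite (prmZ k (@cutsum1_continuous R s _ _ cq cp)).
by move: (prm (cutsum1 s q p)) => A; ring.
Qed.

Lemma tentB s q1 p1 q2 p2 x : 0 <= s -> continuous q1 -> continuous p1 ->
  continuous q2 -> continuous p2 ->
  tent s (cutsum s q1 p1) x - tent s (cutsum s q2 p2) x =
  tent s (cutsum s (fun x => q1 x - q2 x) (fun x => p1 x - p2 x)) x.
Proof.
move=> s0 cq1 cp1 cq2 cp2; rewrite -mulN1r (tentZ (-1) x s0 cq2 cp2).
have ck f : continuous f -> continuous (fun x => -1 * f x).
  by move=> cf ?; apply: cvgM; [exact: cst_continuous|exact: cf].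
rewrite (tentD x s0 cq1 cp1 (ck _ cq2) (ck _ cp2)).
by congr (tent s _ x); apply: cutsum_eq => y *; rewrite mulN1r.
Qed.

Lemma L1_le_cut s f w : 0 <= s -> continuous w -> (forall x, w (- x) = w x) ->
  measurable_fun setT f -> (forall x, - s <= x -> x <= s -> `|f x| <= w x) ->
  (forall x, s < `|x| -> f x = 0) -> L1_le f (2 * prm w s).
Proof.
move=> s0 cw ew mf fw f0; split => //.
have i := continuous_itv_integrable (- s) s cw.
have ms : measurable ([set` `[- s, s]] : set R) by [].
have ss : - s <= s by lra.
have -> : 2 * prm w s = \int[mu]_(x in `[- s, s]) w x.
  by rewrite (prmE cw ss) prm_odd//; ring.
rewrite /Rintegral fineK; last exact: integrable_fin_num.
rewrite [leLHS](_ : _ = \int[mu]_(x in [set` `[(- s)%R, s]]) (`|f x|)%:E)%E; last first.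
  rewrite [RHS]integral_mkcond; apply: eq_integral => x _; rewrite patchE.
  case: ifPn => // h; rewrite f0 ?normr0// ltNge; apply/negP.
  by rewrite ler_norml => h1; move/negP: h; apply; rewrite inE/= in_itv.
apply: ge0_le_integral => //.
- by apply: measurable_funTS; exact: measurable_norm.
- by apply: measurable_funTS; apply/measurable_EFinP; exact: continuous_measurable.
- by move=> x /=; rewrite in_itv/= => /andP[h1 h2]; rewrite lee_fin fw.
Qed.

Lemma dv_le0_diff F F' s t : 0 <= s -> (forall y, is_derive y 1 F (F' y)) ->
  (forall y, F' y <= 0) -> F (t + s) - F (t - s) <= 0.
Proof.
move=> s0 dF F0; have ts : t - s <= t + s by lra.
have := @ge0_dv_le R (fun x => - F x) (fun x => - F' x) _ _ ts.
rewrite lerN2 subr_le0; apply.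
- by move=> u; apply: cvgN; exact: (dv_continuous dF).
- by move=> u _ _; rewrite oppr_ge0.
Qed.

Lemma tent_le0 s q : 0 <= s -> continuous q -> (forall x, q x <= 0) ->
  forall x, tent s (cutsum s q (fun=> 0)) x <= 0.
Proof.
move=> s0 cq q0 x.
have cz : continuous (fun _ : R => 0 : R) by exact: cst_continuous.
have cF := @cutsum1_continuous R s q _ cq cz.
rewrite /tent conv_cutsum// (conv_chi s0 (primitive_shiftB s cF)).
have dG y := dvB (dv_shift (prm_dv (y + s) cF)) (dv_shift (prm_dv (y - s) cF)).
apply: (dv_le0_diff _ s0 dG) => y.
have e : cutsum1 s q (fun=> 0) = prm q.
  by apply/funext => u; rewrite /cutsum1 (@prm_eq _ (fun=> 0) (fun=> 0)) ?addr0.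
by rewrite e; apply: (dv_le0_diff _ s0 (fun u => prm_dv u cq)).
Qed.

(** * Even sources supported in the window *)

Section inner.
Variables (s : R) (p : R -> R).
Hypotheses (s0 : 0 <= s) (cp : continuous p) (ep : forall x, p (- x) = p x).

Definition zero_fun : R -> R := fun=> 0.
Local Notation z := zero_fun.
Local Notation H := (cutsum2 s z p).

Lemma zero_fun_continuous : continuous z.
Proof. exact: cst_continuous. Qed.
Local Notation cz := zero_fun_continuous.

Let F1 x : cutsum1 s z p x = prm p (clamp s x).
Proof. by rewrite /cutsum1 (@prm_eq _ z (fun=> 0)) ?add0r//; exact: cz. Qed.

Let dH x : is_derive x 1 H (prm p (clamp s x)).
Proof. by rewrite -F1; apply: cutsum2_dv => //; exact: cz. Qed.

Lemma cutsum2_ge x : s <= x -> H x = H s + prm p s * (x - s).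
Proof.
move=> sx.
pose g x := H x - prm p s * (x - s).
have cg : continuous g.
  move=> y; apply: cvgB; first exact: (dv_continuous dH).
  by apply: cvgM; [exact: cst_continuous|apply: cvgB; [exact: cvg_id|exact: cst_continuous]].
have h : g x = g s.
  apply: dv0_const => // y sy _.
  apply: is_derive_val (dvB (dH y) (dvZ _ (dvB (dvI y) (dvC y s)))) _.
  by rewrite clamp_ge ?(ltW sy)//; ring.
by move: h; rewrite /g => /eqP; rewrite subr_eq => /eqP ->; ring.
Qed.

Lemma cutsum2_even x : H (- x) = H x.
Proof.
apply: prm_even => [|y]; first by apply: cutsum1_continuous => //; exact: cz.
by rewrite !F1 clampN// prm_odd.
Qed.

Lemma cutsum2_in x : - s <= x -> x <= s -> H x = prm (prm p) x.
Proof.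
have pos y : 0 <= y -> y <= s -> H y = prm (prm p) y.
  move=> y0 ys; pose g x := H x - prm (prm p) x.
  have cg : continuous g.
    by move=> u; apply: cvgB; [exact: (dv_continuous dH)|exact/prm_continuous/prm_continuous].
  have h : g y = g 0.
    apply: dv0_const => // u u0 uy.
    apply: is_derive_val (dvB (dH u) (prm_dv u (prm_continuous cp))) _.
    by rewrite clamp_in ?subrr//; lra.
  by move: h; rewrite /g /cutsum2 !prm0 subrr => /eqP; rewrite subr_eq0 => /eqP.
move=> h1 h2; have [x0|x0] := leP 0 x; first exact: pos.
rewrite -cutsum2_even pos; [|lra|lra].
by apply: prm_even; [exact: prm_continuous|move=> y; exact: prm_odd].
Qed.

(** For [x] in the window, [x + 2 * s] and [2 * s - x] both lie beyond [s], where [H] is affine with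
    slope [prm p s]; by evenness of [H] their contributions add up to a constant. This constant is
    what turns the integral equation into a boundary condition of Robin type. *)
Lemma tent_inner x : - s <= x -> x <= s -> tent s (cutsum s z p) x =
  2 * (prm (prm p) s + s * prm p s) - 2 * prm (prm p) x.
Proof.
move=> h1 h2; rewrite (tent_cutsum s0 cz cp) /diff2.
have -> : H (x - 2 * s) = H (2 * s - x) by rewrite -cutsum2_even; congr (cutsum2 _ _ _ _); ring.
have s1 : s <= x + 2 * s by lra.
have s2 : s <= 2 * s - x by lra.
have s3 : - s <= s by lra.
rewrite (cutsum2_ge s1) (cutsum2_ge s2) (cutsum2_in h1 h2) (cutsum2_in s3 (lexx s)).
ring.
Qed.

Section sign.
Hypothesis p0 : forall x, p x <= 0.

Let tent_abs x : tent s (cutsum s z p) `|x| = tent s (cutsum s z p) x.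
Proof.
have [x0|x0] := leP 0 x; first by rewrite ger0_norm.
rewrite ltr0_norm//; apply: tent_even => //; exact: cz.
Qed.

Lemma tent_support x : 3 * s <= `|x| -> tent s (cutsum s z p) x = 0.
Proof.
rewrite -tent_abs; move: `|x| => y h; have s0' := s0.
rewrite (tent_cutsum s0 cz cp) /diff2.
have s1 : s <= y + 2 * s by lra.
have s2 : s <= y by lra.
have s3 : s <= y - 2 * s by lra.
by rewrite (cutsum2_ge s1) (cutsum2_ge s2) (cutsum2_ge s3); ring.
Qed.

(** Beyond [s], two of the three arguments of the differentiated second difference clamp to [s],
    which leaves [prm p (clamp s (t - 2 * s)) - prm p s]; this is nonnegative because [prm p] is
    nonincreasing. *)
Let tent_nondecreasing x y : s <= x -> x <= y ->
  tent s (cutsum s z p) x <= tent s (cutsum s z p) y.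
Proof.
move=> sx xy.
apply: (@ge0_dv_le R _ (diff2 s (cutsum1 s z p)) x y xy (tent_continuous s0 cz cp)).
  by move=> t _ _; exact: (tent_dv s0 cz cp).
move=> t xt ty; rewrite /diff2 !F1; have s0' := s0.
have s1 : s <= t + 2 * s by lra.
have s2 : s <= t by lra.
rewrite (clamp_ge s0 s1) (clamp_ge s0 s2).
suff : prm p s <= prm p (clamp s (t - 2 * s)) by lra.
have cs : clamp s (t - 2 * s) <= s by rewrite /clamp ge_max ge_min lexx orbT andbT; lra.
have := @ge0_dv_le R (fun x => - prm p x) (fun x => - p x) _ s cs.
rewrite lerN2; apply.
- by move=> u; apply: cvgN; exact: prm_continuous.
- by move=> u _ _; apply: dvN; exact: prm_dv.
- by move=> u _ _; rewrite oppr_ge0.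
Qed.

Lemma tent_outer x : s <= `|x| ->
  tent s (cutsum s z p) s <= tent s (cutsum s z p) x /\ tent s (cutsum s z p) x <= 0.
Proof.
rewrite -(tent_abs x) => h; split; first exact: tent_nondecreasing.
(* Compare with a point further out that is already outside the support. *)
rewrite -(@tent_support (Num.max `|x| (3 * s))).
  by apply: tent_nondecreasing => //; rewrite le_max lexx.
by apply: le_trans (ler_norm _); rewrite le_max lexx orbT.
Qed.

End sign.
End inner.

End tent_bounds.

(** * The profile and its linearization *)

Section profile.
Context {R : realType}.
Implicit Types (f g Y : R -> R) (m s x y a b c : R).

Definition profile m Y := 1 < m /\ is_Ybar m Y.

Definition Ysnd m Y x := 2 / (m + 1) * Y x `^ (- (m + 1)).

Lemma profile_m m Y : profile m Y -> 1 < m.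
Proof. by case. Qed.

Lemma Y_gt0 m Y x : profile m Y -> 0 < Y x.
Proof. by case=> _ [+ _ _ _ _]; apply. Qed.

Lemma Y_dv m Y x : profile m Y -> is_derive x 1 Y (derive1 Y x).
Proof.
by case=> _ [_ d _ _ _]; apply: DeriveDef; [exact: d|rewrite derive1E].
Qed.

Lemma Y1_dv m Y x : profile m Y -> is_derive x 1 (derive1 Y) (Ysnd m Y x).
Proof.
case=> _ [_ _ d e _]; apply: DeriveDef; first exact: d.
by rewrite -derive1E e.
Qed.

Lemma Y_0 m Y : profile m Y -> Y 0 = 1.
Proof. by case=> _ [_ _ _ _ []]. Qed.

Lemma Y1_0 m Y : profile m Y -> derive1 Y 0 = 0.
Proof. by case=> _ [_ _ _ _ []]. Qed.

Lemma Ypow_dv m Y a x : profile m Y ->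
  is_derive x 1 (fun x => Y x `^ a) (a * Y x `^ (a - 1) * derive1 Y x).
Proof.
by move=> hY; apply: (dv_comp (is_derive1_powR a (Y_gt0 x hY)) (Y_dv x hY)).
Qed.

Lemma Y_continuous m Y : profile m Y -> continuous Y.
Proof. by move=> hY; exact: (dv_continuous (fun x => Y_dv x hY)). Qed.

Lemma Y1_continuous m Y : profile m Y -> continuous (derive1 Y).
Proof. by move=> hY; exact: (dv_continuous (fun x => Y1_dv x hY)). Qed.

Lemma Ypow_continuous m Y a : profile m Y -> continuous (fun x => Y x `^ a).
Proof. by move=> hY; exact: (dv_continuous (fun x => Ypow_dv a x hY)). Qed.

Lemma Pbar_powR m Y x : Pbar m Y x = Y x `^ (- (m + 2)).
Proof. by rewrite /Pbar powRN. Qed.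

Lemma Pbar_gt0 m Y x : profile m Y -> 0 < Pbar m Y x.
Proof. by move=> hY; rewrite Pbar_powR powR_gt0// (Y_gt0 x hY). Qed.

Lemma Pbar_continuous m Y : profile m Y -> continuous (Pbar m Y).
Proof.
move=> hY; rewrite (_ : Pbar m Y = fun x => Y x `^ (- (m + 2))); last first.
  by apply/funext => x; exact: Pbar_powR.
exact: Ypow_continuous hY.
Qed.

Lemma Pbar_Y m Y x : profile m Y -> Pbar m Y x * Y x = Y x `^ (- (m + 1)).
Proof.
move=> hY; have Y0 := Y_gt0 x hY.
rewrite Pbar_powR -[X in _ * X]powRr1 ?ltW// -powRD; last by rewrite (gt_eqF Y0) implybT.
by congr (_ `^ _); ring.
Qed.

Lemma Ysnd_Pbar m Y x : profile m Y -> Ysnd m Y x = 2 / (m + 1) * (Pbar m Y x * Y x).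
Proof. by move=> hY; rewrite (Pbar_Y x hY). Qed.

Lemma Kbar_Pbar m Y x : profile m Y -> Kbar m Y x = - (m + 1)^-1 * (Pbar m Y x * Y x).
Proof.
move=> hY; rewrite (Pbar_Y x hY) /Kbar powRN invfM mulNr.
by [].
Qed.

Lemma Ysnd_gt0 m Y x : profile m Y -> 0 < Ysnd m Y x.
Proof.
move=> hY; have m1 := profile_m hY; have Y0 := Y_gt0 x hY.
by rewrite mulr_gt0 ?powR_gt0// divr_gt0//; lra.
Qed.

Lemma Ysnd_dv m Y x : profile m Y ->
  is_derive x 1 (Ysnd m Y) (- 2 * Pbar m Y x * derive1 Y x).
Proof.
move=> hY; have m1 := profile_m hY.
apply: is_derive_val (dvZ _ (Ypow_dv (- (m + 1)) x hY)) _.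
rewrite Pbar_powR (_ : - (m + 1) - 1 = - (m + 2)); last by ring.
by field; lra.
Qed.

(** Conservation of energy: the derivative of the left side plus [4 / (m * (m + 1)) * Y ^ (- m)]
    vanishes by the profile equation. It yields [Y >= 1] and the bound on the slope. *)
Lemma Y_energy m Y x : profile m Y ->
  derive1 Y x ^+ 2 = 4 / (m * (m + 1)) * (1 - Y x `^ (- m)).
Proof.
move=> hY; have m1 := profile_m hY.
pose E y := derive1 Y y * derive1 Y y + 4 / (m * (m + 1)) * Y y `^ (- m).
have dE (y : R) : is_derive y 1 E 0.
  apply: is_derive_val (dvD (dvM (Y1_dv y hY) (Y1_dv y hY)) (dvZ _ (Ypow_dv (- m) y hY))) _.
  rewrite /Ysnd (_ : - m - 1 = - (m + 1)); last by ring.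
  by field; apply/andP; split; lra.
have : E = fun=> 4 / (m * (m + 1)).
  apply: dv_eq dE (fun y => dvC y _) _.
  by rewrite /E (Y_0 hY) (Y1_0 hY) powR1; ring.
move=> /(congr1 (fun f => f x)); rewrite /E => h.
by move: h; rewrite expr2 mulrBr mulr1; clear; lra.
Qed.

Lemma Y_ge1 m Y x : profile m Y -> 1 <= Y x.
Proof.
move=> hY; have m1 := profile_m hY; have Y0 := Y_gt0 x hY.
have : 0 <= 1 - Y x `^ (- m).
  have k0 : 0 < 4 / (m * (m + 1)) by rewrite divr_gt0// mulr_gt0//; lra.
  by rewrite -(pmulr_rge0 _ k0) -(Y_energy x hY) sqr_ge0.
rewrite subr_ge0 powRN => h.
have h1 : 1 <= Y x `^ m by move: h; rewrite invf_le1// powR_gt0.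
rewrite leNgt; apply/negP => Y1.
have : Y x `^ m < 1 `^ m by apply: gt0_ltr_powR; rewrite ?nnegrE//; lra.
by rewrite powR1 ltNge h1.
Qed.

Lemma Y1_norm m Y x : profile m Y -> `|derive1 Y x| <= 2.
Proof.
move=> hY; have m1 := profile_m hY.
rewrite -(@ler_pXn2r _ 2)// ?nnegrE//.
rewrite real_normK ?num_real// (Y_energy x hY).
have h1 : 4 / (m * (m + 1)) <= 4.
  rewrite ler_pdivrMr; last by rewrite mulr_gt0//; lra.
  by nra.
have h0 : 0 <= 4 / (m * (m + 1)) by rewrite divr_ge0// mulr_ge0//; lra.
have h2 : 0 <= Y x `^ (- m) by exact: powR_ge0.
have h3 : 2 ^+ 2 = 4 :> R by ring.
rewrite h3; nra.
Qed.

(** The right-hand side of the profile equation is singular at [0], but [Y >= 1] confines it to a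
    range where its derivative [- 2 * t ^ (- (m + 2))] has modulus at most 2. *)
Lemma Ysnd_lip m Y x y : profile m Y -> `|Ysnd m Y x - Ysnd m Y y| <= 2 * `|Y x - Y y|.
Proof.
move=> hY; have m1 := profile_m hY.
pose F (t : R) := 2 / (m + 1) * t `^ (- (m + 1)).
have dF (t : R) : 0 < t -> is_derive t 1 F (- 2 * t `^ (- (m + 2))).
  move=> t0; apply: is_derive_val (dvZ _ (is_derive1_powR (- (m + 1)) t0)) _.
  rewrite (_ : - (m + 1) - 1 = - (m + 2)); last by ring.
  by field; lra.
have key u v : 1 <= u -> u <= v -> `|F v - F u| <= 2 * `|v - u|.
  move=> u1 uv; have [||t [t1 t2 ->]] := @mvt _ F (fun t => - 2 * t `^ (- (m + 2))) u v uv.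
  - by move=> t ut _; apply: dF; lra.
  - apply: derivable_within_continuous => t; rewrite in_itv/= => /andP[ut _].
    have t0 : 0 < t by lra.
    by case: (dF t t0).
  - rewrite normrM ler_wpM2r// normrM normrN (ger0_norm (powR_ge0 _ _)) ger0_norm//.
    have : t `^ (- (m + 2)) <= 1.
      by rewrite -[leRHS](powRr0 t); apply: ler_powR => //; lra.
    lra.
have hx := Y_ge1 x hY; have hy := Y_ge1 y hY.
have [h|/ltW h] := leP (Y y) (Y x); first exact: key.
by rewrite distrC (distrC (Y x)); exact: key.
Qed.

(** The reflected profile solves the same initial value problem; the lemma is uniqueness for that
    problem, proved by a Gronwall argument. *)
Lemma Y_even m Y x : profile m Y -> Y (- x) = Y x.
Proof.
move=> hY.
wlog x0 : x / 0 <= x.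
  by move=> h; have [/h//|/ltW x0] := leP 0 x; rewrite -(h (- x)) ?opprK ?oppr_ge0.
pose d y := Y y - Y (- y); pose d1 y := derive1 Y y + derive1 Y (- y).
pose d2 y := Ysnd m Y y - Ysnd m Y (- y).
have dd (y : R) : is_derive y 1 d (d1 y).
  by apply: is_derive_val (dvB (Y_dv y hY) (dv_refl (Y_dv (- y) hY))) _; rewrite /d1; ring.
have dd1 (y : R) : is_derive y 1 d1 (d2 y).
  exact: (dvD (Y1_dv y hY) (dv_refl (Y1_dv (- y) hY))).
(* The rate 3 is what the Lipschitz constant 2 requires: [2 * u * v + 2 * v * w] is at most
   [6 * |u| * |v|], hence at most [3 * (u ^ 2 + v ^ 2)]. *)
pose G y := (d y * d y + d1 y * d1 y) * expR (- 3 * y).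
pose G1 y := (d y * d y + d1 y * d1 y) * (expR (- 3 * y) * (- 3)) +
  expR (- 3 * y) * (d y * d1 y + d y * d1 y + (d1 y * d2 y + d1 y * d2 y)).
have dG (y : R) : is_derive y 1 G (G1 y).
  have := dv_comp (is_derive_expR (- 3 * y)) (dvZ (- 3) (dvI y)).
  rewrite mulr1 => de.
  exact: (dvM (dvD (dvM (dd y) (dd y)) (dvM (dd1 y) (dd1 y))) de).
have G1le y : G1 y <= 0.
  have -> : G1 y = expR (- 3 * y) * (2 * d y * d1 y + 2 * d1 y * d2 y - 3 * (d y * d y + d1 y * d1 y)).
    by rewrite /G1; ring.
  rewrite pmulr_rle0 ?expR_gt0//.
  have := Ysnd_lip y (- y) hY; rewrite -/(d y) -/(d2 y).
  move: (d y) (d1 y) (d2 y) => u v w h.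
  have h1 : v * w <= `|v| * (2 * `|u|).
    by apply: le_trans (ler_norm _) _; rewrite normrM ler_wpM2l.
  have h2 : u * v <= `|v| * `|u| by apply: le_trans (ler_norm _) _; rewrite normrM mulrC.
  have h3 : u * u = `|u| * `|u| by rewrite -normrM ger0_norm// -expr2 sqr_ge0.
  have h4 : v * v = `|v| * `|v| by rewrite -normrM ger0_norm// -expr2 sqr_ge0.
  rewrite h3 h4; have := sqr_ge0 (`|u| - `|v|); rewrite expr2; nra.
have G0 : G 0 = 0.
  by rewrite /G /d /d1 oppr0 !subrr (Y1_0 hY); ring.
have Gx : G x <= 0.
  rewrite -G0 -lerN2; apply: (@ge0_dv_le R (fun y => - G y) (fun y => - G1 y) 0 x x0).
  - by move=> y; apply: cvgN; exact: (dv_continuous dG).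
  - by move=> y _ _; rewrite oppr_ge0.
have e0 := expR_gt0 (- 3 * x).
have : d x * d x + d1 x * d1 x <= 0 by rewrite -(pmulr_lle0 _ e0).
have h1 := sqr_ge0 (d x); have h2 := sqr_ge0 (d1 x); rewrite -!expr2 => h3.
have : d x ^+ 2 = 0 by apply/eqP; rewrite eq_le h1 andbT; lra.
by move=> /eqP; rewrite sqrf_eq0 subr_eq0 => /eqP.
Qed.

Lemma Y1_odd m Y x : profile m Y -> derive1 Y (- x) = - derive1 Y x.
Proof.
move=> hY.
have h : is_derive x 1 Y (- derive1 Y (- x)).
  have := dv_refl (Y_dv (- x) hY); congr is_derive.
  by apply/funext => y; exact: Y_even hY.
have [_ e1] := h; have [_ e2] := Y_dv x hY.
by rewrite -e2 e1 opprK.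
Qed.

Lemma Pbar_even m Y x : profile m Y -> Pbar m Y (- x) = Pbar m Y x.
Proof. by move=> hY; rewrite /Pbar (Y_even x hY). Qed.

Lemma Y_norm m Y x : profile m Y -> Y `|x| = Y x.
Proof.
move=> hY; have [x0|x0] := leP 0 x; first by rewrite ger0_norm.
by rewrite ltr0_norm// (Y_even x hY).
Qed.

Lemma Y1_nondecreasing m Y x y : profile m Y -> x <= y -> derive1 Y x <= derive1 Y y.
Proof.
move=> hY xy; apply: (@ge0_dv_le R _ (Ysnd m Y) x y xy (Y1_continuous hY)).
  by move=> t _ _; exact: Y1_dv.
by move=> t _ _; exact/ltW/Ysnd_gt0.
Qed.

Lemma Y1_ge0 m Y x : profile m Y -> 0 <= x -> 0 <= derive1 Y x.
Proof. by move=> hY x0; rewrite -(Y1_0 hY); exact: Y1_nondecreasing hY x0. Qed.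

Lemma Y_nondecreasing m Y x y : profile m Y -> 0 <= x -> x <= y -> Y x <= Y y.
Proof.
move=> hY x0 xy; apply: (@ge0_dv_le R _ (derive1 Y) x y xy (Y_continuous hY)).
  by move=> t _ _; exact: Y_dv hY.
by move=> t xt _; apply: Y1_ge0 hY _; lra.
Qed.

Lemma Y_le m Y x : profile m Y -> Y x <= 1 + 2 * `|x|.
Proof.
move=> hY; rewrite -(Y_norm x hY); move: (normr_ge0 x); move: `|x| => y y0.
have := @ge0_dv_le R (fun t => 2 * t - Y t) (fun t => 2 * 1 - derive1 Y t) 0 y y0.
rewrite (Y_0 hY) mulr0 => h; suff : 0 - 1 <= 2 * y - Y y by lra.
apply: h.
- move=> t; apply: cvgB; last exact: (Y_continuous hY).
  by apply: cvgM; [exact: cst_continuous|exact: cvg_id].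
- by move=> t _ _; exact: dvB (dvZ _ (dvI t)) (Y_dv t hY).
- by move=> t _ _; have := Y1_norm t hY; rewrite ler_norml => /andP[]; lra.
Qed.

Lemma Y_convex m Y x : profile m Y -> 0 <= x -> Y x <= 1 + x * derive1 Y x.
Proof.
move=> hY x0.
have := @ge0_dv_le R (fun t => t * derive1 Y t - Y t)
  (fun t => t * Ysnd m Y t + derive1 Y t * 1 - derive1 Y t) 0 x x0.
rewrite (Y_0 hY) mul0r => h; suff : 0 - 1 <= x * derive1 Y x - Y x by lra.
apply: h.
- move=> t; apply: cvgB; last exact: (Y_continuous hY).
  by apply: cvgM; [exact: cvg_id|exact: (Y1_continuous hY)].
- by move=> t _ _; exact: dvB (dvM (dvI t) (Y1_dv t hY)) (Y_dv t hY).
- move=> t t0 _; rewrite mulr1 addrK mulr_ge0 ?(ltW t0)//.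
  exact/ltW/Ysnd_gt0.
Qed.

(** The value of the right-hand side of the profile equation at [Y = 3]. Since
    [Y <= 1 + 2 * |x| <= 3] on [[0, 1]], it bounds the second derivative from below there, hence
    [Y'] from below on all of [[1, +oo)]. *)
Definition slope m : R := 2 / (m + 1) * 3 `^ (- (m + 1)).

Lemma slope_gt0 m : 1 < m -> 0 < slope m.
Proof. by move=> m1; rewrite mulr_gt0 ?powR_gt0// divr_gt0//; lra. Qed.

Lemma slope_le1 m : 1 < m -> slope m <= 1.
Proof.
move=> m1; rewrite /slope -[leRHS]mulr1; apply: ler_pM.
- by rewrite divr_ge0//; lra.
- exact: powR_ge0.
- by rewrite ler_pdivrMr; lra.
- by rewrite -[leRHS](powRr0 3); apply: ler_powR; lra.
Qed.

Lemma Y1_slope m Y x : profile m Y -> 1 <= x -> slope m <= derive1 Y x.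
Proof.
move=> hY x1; have m1 := profile_m hY.
apply: le_trans (Y1_nondecreasing hY x1).
have := @ge0_dv_le R (fun t => derive1 Y t - slope m * t) (fun t => Ysnd m Y t - slope m * 1) 0 1 ler01.
rewrite (Y1_0 hY) mulr0 => h; suff : 0 - 0 <= derive1 Y 1 - slope m * 1 by lra.
apply: h.
- move=> t; apply: cvgB; first exact: (Y1_continuous hY).
  by apply: cvgM; [exact: cst_continuous|exact: cvg_id].
- by move=> t _ _; exact: dvB (Y1_dv t hY) (dvZ _ (dvI t)).
- move=> t t0 t1; rewrite subr_ge0 mulr1; apply: ler_wpM2l; first by rewrite divr_ge0//; lra.
  rewrite !powRN lef_pV2 ?posrE ?powR_gt0//; last exact: Y_gt0 hY.
  apply: ge0_ler_powR; rewrite ?nnegrE//; first lra.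
    exact/ltW/(Y_gt0 t hY).
  by have := Y_le t hY; rewrite gtr0_norm//; lra.
Qed.

Lemma Y_ge m Y x : profile m Y -> slope m / 2 * (1 + `|x|) <= Y x.
Proof.
move=> hY; rewrite -(Y_norm x hY); move: (normr_ge0 x); move: `|x| => y y0.
have m1 := profile_m hY; have s0 := slope_gt0 m1; have s1 := slope_le1 m1.
have Y1 := Y_ge1 y hY.
have [y1|y1] := leP y 1; first by nra.
have := @ge0_dv_le R (fun t => Y t - slope m * t) (fun t => derive1 Y t - slope m * 1) 1 y (ltW y1).
move=> h; have {}h : Y 1 - slope m * 1 <= Y y - slope m * y.
  apply: h.
  - move=> t; apply: cvgB; first exact: (Y_continuous hY).
    by apply: cvgM; [exact: cst_continuous|exact: cvg_id].
  - by move=> t _ _; exact: dvB (Y_dv t hY) (dvZ _ (dvI t)).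
  - by move=> t t1 _; rewrite subr_ge0 mulr1; exact: Y1_slope hY (ltW t1).
have Y11 := Y_ge1 1 hY; lra.
Qed.

Definition Tsol m Y x := Y x - (m + 2) / 2 * (x * derive1 Y x).
Definition Tsol1 m Y x := derive1 Y x - (m + 2) / 2 * (derive1 Y x + x * Ysnd m Y x).

Lemma T_dv m Y x : profile m Y -> is_derive x 1 (Tsol m Y) (Tsol1 m Y x).
Proof.
move=> hY; apply: is_derive_val (dvB (Y_dv x hY) (dvZ _ (dvM (dvI x) (Y1_dv x hY)))) _.
by rewrite /Tsol1; ring.
Qed.

Lemma T1_dv m Y x : profile m Y -> is_derive x 1 (Tsol1 m Y) (- 2 * Pbar m Y x * Tsol m Y x).
Proof.
move=> hY; have m1 := profile_m hY.
apply: is_derive_val (dvB (Y1_dv x hY) (dvZ _ (dvD (Y1_dv x hY) (dvM (dvI x) (Ysnd_dv x hY))))) _.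
by rewrite /Tsol (Ysnd_Pbar x hY); field; lra.
Qed.

Lemma T_continuous m Y : profile m Y -> continuous (Tsol m Y).
Proof. by move=> hY; exact: (dv_continuous (fun x => T_dv x hY)). Qed.

Lemma T1_continuous m Y : profile m Y -> continuous (Tsol1 m Y).
Proof. by move=> hY; exact: (dv_continuous (fun x => T1_dv x hY)). Qed.

Lemma T_0 m Y : profile m Y -> Tsol m Y 0 = 1.
Proof. by move=> hY; rewrite /Tsol (Y_0 hY); ring. Qed.

Lemma T1_0 m Y : profile m Y -> Tsol1 m Y 0 = 0.
Proof. by move=> hY; rewrite /Tsol1 (Y1_0 hY); ring. Qed.

Lemma T_even m Y x : profile m Y -> Tsol m Y (- x) = Tsol m Y x.
Proof. by move=> hY; rewrite /Tsol (Y_even x hY) (Y1_odd x hY); ring. Qed.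

Lemma wronskian m Y x : profile m Y ->
  Tsol m Y x * Ysnd m Y x - Tsol1 m Y x * derive1 Y x = 2 / (m + 1).
Proof.
move=> hY; pose W y := Tsol m Y y * Ysnd m Y y - Tsol1 m Y y * derive1 Y y.
have dW (y : R) : is_derive y 1 W 0.
  apply: is_derive_val (dvB (dvM (T_dv y hY) (Ysnd_dv y hY)) (dvM (T1_dv y hY) (Y1_dv y hY))) _.
  by ring.
have : W = fun=> 2 / (m + 1).
  apply: dv_eq dW (fun y => dvC y _) _.
  by rewrite /W (T_0 hY) (Y1_0 hY) /Ysnd (Y_0 hY) powR1; ring.
by move=> /(congr1 (fun f => f x)).
Qed.

(** Linear growth of [Y] against a second derivative of at most [1 / Y]. It keeps the factor
    [s * Y'' + Y'] of the boundary identity bounded as [s] grows. *)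
Lemma xYsnd_le m Y x : profile m Y -> `|x| * Ysnd m Y x <= 2 / slope m.
Proof.
move=> hY; have m1 := profile_m hY; have s0 := slope_gt0 m1.
have Y1 := Y_ge1 x hY; have Y0 := Y_gt0 x hY; have Yx := Y_ge x hY.
have h1 : Ysnd m Y x <= (Y x)^-1.
  rewrite /Ysnd -[leRHS]mul1r; apply: ler_pM.
  - by rewrite divr_ge0//; lra.
  - exact: powR_ge0.
  - by rewrite ler_pdivrMr; lra.
  - by rewrite -powR_inv1 ?(ltW Y0)//; apply: ler_powR => //; lra.
apply: (@le_trans _ _ (`|x| * (Y x)^-1)); first exact: ler_wpM2l.
rewrite ler_pdivrMr// mulrAC ler_pdivlMr//.
have x0 := normr_ge0 x; nra.
Qed.

Lemma T_norm m Y x : profile m Y -> `|Tsol m Y x| <= (m + 4) * (1 + `|x|).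
Proof.
move=> hY; have m1 := profile_m hY.
rewrite /Tsol; apply: le_trans (ler_normB _ _) _.
have m2 : 0 <= (m + 2) / 2 by lra.
rewrite (gtr0_norm (Y_gt0 x hY)) normrM (normrM x) (ger0_norm m2).
have h1 := Y_le x hY; have h2 := Y1_norm x hY.
have h3 : `|x| * `|derive1 Y x| <= `|x| * 2 by apply: ler_wpM2l.
have x0 := normr_ge0 x; nra.
Qed.

(* Nondegeneracy of the even solution with respect to the Robin condition. *)
Lemma T_boundary m Y s : profile m Y -> 1 <= s -> 2 / (m * slope m) <= s ->
  s * Tsol1 m Y s + Tsol m Y s <= - (m * slope m / 2 * s).
Proof.
move=> hY s1 h; have m1 := profile_m hY; have s0 := slope_gt0 m1.
have h1 := Y1_slope hY s1.
have sp : 0 <= s by lra.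
have h2 := Y_convex hY sp.
have h3 := Ysnd_gt0 s hY.
(* By convexity the boundary expression is at most [1 - m * (s * Y' s)]; for such [s] the [1] takes
   up at most half of the negative term. *)
have h4 : 2 <= s * (m * slope m) by rewrite -ler_pdivrMr// mulr_gt0//; lra.
have h5 : 0 <= (m + 2) / 2 * (s * (s * Ysnd m Y s)).
  by apply: mulr_ge0; [lra|apply: mulr_ge0 => //; apply: mulr_ge0 => //; exact: ltW].
have h6 : m * slope m * s <= m * (s * derive1 Y s).
  by rewrite -mulrA ler_wpM2l//; [lra|rewrite mulrC ler_wpM2l].
rewrite /Tsol1 /Tsol; nra.
Qed.

End profile.

Opaque slope.

(** * The linearized equation *)

Section linear.
Context {R : realType}.
Implicit Types (f g Y e q p U : R -> R) (m s x y a b c : R).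

Lemma continuous_mul f g : continuous f -> continuous g -> continuous (fun x => f x * g x).
Proof. by move=> cf cg x; apply: cvgM; [exact: cf|exact: cg]. Qed.

Lemma continuous_add f g : continuous f -> continuous g -> continuous (fun x => f x + g x).
Proof. by move=> cf cg x; apply: cvgD; [exact: cf|exact: cg]. Qed.

Lemma continuous_scale k f : continuous f -> continuous (fun x => k * f x).
Proof. by move=> cf x; apply: cvgM; [exact: cst_continuous|exact: cf]. Qed.

Definition large m s := 1 <= s /\ 2 / (m * slope m) <= s.

(** The unknown is [Z + e], where [e] is the double convolution of the given source. Subtracting [e]
    leaves a source supported in the window, to which [tent_inner] applies, and only continuity of
    [e] enters. *)
Lemma linear_solvable m Y s e : profile m Y -> large m s ->
  continuous e -> (forall x, e (- x) = e x) ->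
  exists Z, [/\ continuous Z, forall x, Z (- x) = Z x &
    forall x, Z x = tent s (cutsum s zero_fun (fun x => Pbar m Y x * (Z x + e x))) x].
Proof.
move=> hY [s1 s2] ce ee; have m1 := profile_m hY.
have s0 : 0 <= s by lra.
have s0' : 0 < s by lra.
have m0 : 0 < m by lra.
have tau := T_boundary hY s1 s2.
pose h x := - 2 * (Pbar m Y x * e x).
have cPe : continuous (fun x => Pbar m Y x * e x) by apply: continuous_mul => //; exact: Pbar_continuous.
have ch : continuous h by exact: continuous_scale.
have eh x : h (- x) = h x by rewrite /h ee (Pbar_even x hY).
have cTh := continuous_mul (T_continuous hY) ch.
have cYh := continuous_mul (Y1_continuous hY) ch.
pose A := prm (fun x => Tsol m Y x * h x).
pose B := prm (fun x => derive1 Y x * h x).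
pose W := 2 / (m + 1).
have W0 : 0 < W by rewrite divr_gt0//; lra.
pose Zp x := W^-1 * (derive1 Y x * A x - Tsol m Y x * B x).
pose Zp1 x := W^-1 * (Ysnd m Y x * A x - Tsol1 m Y x * B x).
have dA x := prm_dv x cTh : is_derive x 1 A _.
have dB x := prm_dv x cYh : is_derive x 1 B _.
have dZp (x : R) : is_derive x 1 Zp (Zp1 x).
  apply: is_derive_val (dvZ _ (dvB (dvM (Y1_dv x hY) (dA x)) (dvM (T_dv x hY) (dB x)))) _.
  by rewrite /Zp1; ring.
have dZp1 (x : R) : is_derive x 1 Zp1 (- 2 * Pbar m Y x * Zp x + h x).
  apply: is_derive_val (dvZ _ (dvB (dvM (Ysnd_dv x hY) (dA x)) (dvM (T1_dv x hY) (dB x)))) _.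
  have w := wronskian x hY; rewrite -/W in w.
  rewrite /Zp -[X in _ = _ + X]mul1r -(mulVf (lt0r_neq0 W0)) -[X in _ * X * h x]w.
  ring.
pose tau_ := s * Tsol1 m Y s + Tsol m Y s.
have tau0 : tau_ < 0.
  have s00 := slope_gt0 m1.
  have : 0 < m * slope m / 2 * s by apply: mulr_gt0 => //; apply: divr_gt0 => //; exact: mulr_gt0.
  by move: tau; rewrite -/tau_; lra.
(* The multiple of the even homogeneous solution that repairs the boundary condition; it exists
   because the defect [tau_] is nonzero. *)
pose a := - (s * Zp1 s + Zp s) / tau_.
pose Z0 x := a * Tsol m Y x + Zp x.
pose Z1 x := a * Tsol1 m Y x + Zp1 x.
have dZ0 (x : R) : is_derive x 1 Z0 (Z1 x) by exact: (dvD (dvZ a (T_dv x hY)) (dZp x)).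
have dZ1 (x : R) : is_derive x 1 Z1 (- 2 * (Pbar m Y x * (Z0 x + e x))).
  apply: is_derive_val (dvD (dvZ a (T1_dv x hY)) (dZp1 x)) _.
  by rewrite /Z0 /h; ring.
have bd : s * Z1 s + Z0 s = 0.
  have -> : s * Z1 s + Z0 s = a * tau_ + (s * Zp1 s + Zp s) by rewrite /Z1 /Z0 /tau_; ring.
  by rewrite /a mulfVK ?ltr0_neq0// addNr.
have eZ0 x : Z0 (- x) = Z0 x.
  rewrite /Z0 /Zp (T_even x hY) (Y1_odd x hY) /A prm_odd//; last first.
    by move=> y; rewrite eh (T_even y hY).
  rewrite /B prm_even//; last by move=> y; rewrite eh (Y1_odd y hY) mulNr.
  by rewrite mulrNN.
have cZ0 := dv_continuous dZ0.
pose pi_ x := Pbar m Y x * (Z0 x + e x).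
have cpi : continuous pi_.
  by apply: continuous_mul; [exact: Pbar_continuous hY|exact: continuous_add].
have epi x : pi_ (- x) = pi_ x by rewrite /pi_ eZ0 ee (Pbar_even x hY).
have p1 : prm pi_ = fun x => - 2^-1 * Z1 x.
  apply: prm_eq => // [x|].
    by apply: is_derive_val (dvZ _ (dZ1 x)) _; rewrite /pi_; field.
  by rewrite /Z1 /Zp1 (T1_0 hY) /A /B !prm0; ring.
have p2 : prm (prm pi_) = fun x => - 2^-1 * Z0 x - (- 2^-1 * Z0 0).
  rewrite p1; apply: prm_eq => [|x|]; last by rewrite subrr.
    by apply: continuous_scale; exact: dv_continuous dZ1.
  by apply: is_derive_val (dvB (dvZ _ (dZ0 x)) (dvC x _)) _; rewrite subr0.
have inner x : - s <= x -> x <= s -> tent s (cutsum s zero_fun pi_) x = Z0 x.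
  move=> x1 x2; rewrite (tent_inner s0 cpi epi x1 x2) p2 p1.
  by rewrite -[RHS]subr0 -bd; move: (Z0 s) (Z0 x) (Z0 0) (Z1 s) => *; field.
(* [Z0] solves the equation only inside the window. The convolution of its source agrees with it
   there and supplies the right extension outside. *)
exists (tent s (cutsum s zero_fun pi_)); split.
- by apply: tent_continuous => //; exact: zero_fun_continuous.
- by move=> x; apply: tent_even => //; exact: zero_fun_continuous.
- move=> x; congr (tent s _ x); apply: cutsum_eq => // y y1 y2.
  by rewrite inner.
Qed.

(** [C_var] combines the variation 4 of the source with the growth constant [m + 4] of [T];
    [C_origin] is the outcome of [apriori_arith] with the boundary defect [m * slope m / 2] in the
    denominator; [C_growth] comes from recovering the solution out of its two Wronskians. *)
Definition C_var m : R := 4 * (m + 4).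
Definition C_origin m : R :=
  ((4 * (2 / (m + 1)) + 2 * C_var m * (2 / slope m + 2)) / (m * slope m / 2) + 8) / (2 / (m + 1)).
Definition C_growth m : R := 4 * C_var m / (2 / (m + 1)) + C_origin m * (m + 4).

(** Both error terms grow like [s], and so does the lower bound [k * s] of the defect [t]; dividing
    by [t] makes the factor [s] disappear. *)
Lemma apriori_arith (u W t c s k a i : R) : 0 < W -> 0 < k -> 0 <= c -> 1 <= s ->
  0 <= a -> 0 <= i -> k * s <= t ->
  u * W * t <= 4 * s * c * W + a * (1 + s) * c * i + 8 * c * t ->
  u <= ((4 * W + 2 * a * i) / k + 8) / W * c.
Proof.
move=> W0 k0 c0 s1 a0 i0 kt h.
have t0 : 0 < t by apply: lt_le_trans kt; apply: mulr_gt0 => //; lra.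
have D0 : 0 <= 4 * W + 2 * a * i by rewrite addr_ge0// !mulr_ge0// ltW.
rewrite mulrAC ler_pdivlMr// -(ler_pM2r t0); apply: (le_trans h).
have -> : ((4 * W + 2 * a * i) / k + 8) * c * t =
  (4 * W + 2 * a * i) / k * c * t + 8 * c * t by ring.
rewrite lerD2r.
have h1 : 4 * s * c * W + a * (1 + s) * c * i <= (4 * W + 2 * a * i) * c * s.
  have : a * (1 + s) * c * i <= a * (2 * s) * c * i.
    by apply: ler_wpM2r => //; apply: ler_wpM2r => //; apply: ler_wpM2l => //; lra.
  lra.
apply: (le_trans h1).
have -> : (4 * W + 2 * a * i) * c * s = (4 * W + 2 * a * i) / k * c * (k * s).
  by field; rewrite gt_eqF.
apply: ler_wpM2l => //; apply: mulr_ge0 => //; apply: divr_ge0 => //; exact: ltW.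
Qed.

(** The absolute value of the source stays in the class of cut sums, so its primitive, the total
    variation, is again explicit. *)
Lemma cutsum_norm s q p :
  (fun x => `|cutsum s q p x|) =
  cutsum s (fun x => `|q x|) (fun x => `|q x + p x| - `|q x|).
Proof.
apply/funext => x; rewrite /cutsum.
have [h|h] := leP `|x| s; last by rewrite !chi_out// !mul0r !addr0.
by move: h; rewrite ler_norml => /andP[? ?]; rewrite chi_in// !mul1r; ring.
Qed.

Lemma L1_le_norm f c : L1_le f c -> L1_le (fun x => `|f x|) c.
Proof.
move=> fc; apply: L1_le_mono (fc) _; last by move=> x; rewrite normr_id.
by case: fc => mf _; exact: measurableT_comp.
Qed.

Lemma continuous_norm f : continuous f -> continuous (fun x => `|f x|).
Proof. by move=> cf x; apply: cvg_norm; exact: cf. Qed.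

(** The Wronskians of the solution with [T] and with [Y'] have derivatives in which the solution
    itself does not occur, only the source, so they are bounded without any Gronwall loss. The
    boundary condition at [s] then determines the value at [0], and the constant Wronskian of [T]
    and [Y'] recovers the solution everywhere in the window. *)
Lemma apriori_inner m Y s q p U c : profile m Y -> large m s ->
  continuous q -> continuous p -> continuous U ->
  (forall x, q (- x) = q x) -> (forall x, p (- x) = p x) -> (forall x, U (- x) = U x) ->
  L1_le (cutsum s q p) c ->
  (forall x, U x = tent s (cutsum s q (fun x => p x + Pbar m Y x * U x)) x) ->
  `|U 0| <= C_origin m * c /\
  forall x, - s <= x -> x <= s -> `|U x| <= C_growth m * c * (1 + `|x|).
Proof.
move=> hY [s1 s2] cq cp cU eq ep eU fc hU; have m1 := profile_m hY.
have s0 : 0 <= s by lra.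
have c0 := L1_le_ge0 fc.
have sl0 := slope_gt0 m1.
have s0' : 0 < s by lra.
have m0 : 0 < m by lra.
pose pi_ x := Pbar m Y x * U x.
have cpi : continuous pi_ by apply: continuous_mul => //; exact: Pbar_continuous hY.
have epi x : pi_ (- x) = pi_ x by rewrite /pi_ eU (Pbar_even x hY).
have cz := @zero_fun_continuous R.
pose F := cutsum1 s q p; pose H := cutsum2 s q p.
have dH (x : R) : is_derive x 1 H (F x) by exact: cutsum2_dv.
have split x : U x = tent s (cutsum s zero_fun pi_) x + diff2 s H x.
  rewrite {1}hU -(tent_cutsum s0 cq cp) (tentD x s0 cz cpi cq cp).
  by congr (tent s _ x); apply: cutsum_eq => y *; rewrite /zero_fun ?add0r// addrC.
(* [V] is a continuation of [U] from the window: it is differentiable everywhere with an explicit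
   derivative [V1], while the differential equation is used only where it equals [U]. *)
pose k0 := 2 * (prm (prm pi_) s + s * prm pi_ s).
pose V x := k0 - 2 * prm (prm pi_) x + diff2 s H x.
pose V1 x := 0 - 2 * prm pi_ x + diff2 s F x.
have UV x : - s <= x -> x <= s -> U x = V x.
  by move=> x1 x2; rewrite split (tent_inner s0 cpi epi x1 x2).
have dV (x : R) : is_derive x 1 V (V1 x).
  exact: (dvD (dvB (dvC x k0) (dvZ 2 (prm_dv x (prm_continuous cpi)))) (diff2_dv s dH x)).
pose h x := q (x + 2 * s) - 2 * (q x + p x) + q (x - 2 * s).
have dV1 (x : R) : 0 < x -> x < s -> is_derive x 1 V1 (- 2 * Pbar m Y x * U x + h x).
  move=> x0 xs.
  have x1 : s < x + 2 * s by lra.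
  have x2 : x - 2 * s < - s by lra.
  have x3 : - s < x by lra.
  have dF1 : is_derive x 1 (fun y => F (y + 2 * s)) (q (x + 2 * s)).
    exact: dv_shift (cutsum1_dv_gt _ s0 cq x1).
  have dF2 : is_derive x 1 (fun y => F (y - 2 * s)) (q (x - 2 * s)).
    exact: (dv_shift (cutsum1_dv_lt _ s0 cq x2)).
  have dF3 : is_derive x 1 F (q x + p x).
    by apply: is_derive_val (cutsum1_dv_in cq cp x3 xs) _; ring.
  apply: is_derive_val (dvD (dvB (dvC x 0) (dvZ 2 (prm_dv x cpi))) (dvD (dvB dF1 (dvZ 2 dF3)) dF2)) _.
  by rewrite /pi_ /h; ring.
have oF x : F (- x) = - F x by rewrite /F /cutsum1 clampN// !prm_odd//; ring.
have F0 : F 0 = 0 by have := oF 0; rewrite oppr0; lra.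
have V10 : V1 0 = 0.
  have e1 : 0 + 2 * s = 2 * s by ring.
  have e2 : 0 - 2 * s = - (2 * s) by ring.
  by rewrite /V1 prm0 /diff2 e1 e2 oF F0; ring.
have cF : continuous F by exact: cutsum1_continuous.
have cV1 : continuous V1.
  move=> x; apply: cvgD.
    by apply: cvgB; [exact: cst_continuous|apply: continuous_scale; exact: prm_continuous].
  apply: cvgD; last exact: (@continuous_shift1 R F (- (2 * s))).
  by apply: cvgB; [exact: (@continuous_shift1 R F (2 * s))|exact: continuous_scale].
have cV := dv_continuous dV.
(* M dominates the total variation of the source *)
pose Fa := cutsum1 s (fun x => `|q x|) (fun x => `|q x + p x| - `|q x|).
have cqa := continuous_norm cq.
have cpa : continuous (fun x => `|q x + p x| - `|q x|).
  move=> x; apply: cvgB; last exact: cqa.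
  by apply: (@continuous_norm (fun x => q x + p x)); exact: continuous_add.
have fca : L1_le (cutsum s (fun x => `|q x|) (fun x => `|q x + p x| - `|q x|)) c.
  by rewrite -cutsum_norm; exact: L1_le_norm.
have osc x y : `|Fa y - Fa x| <= c by exact: (cutsum1_osc s0 cqa cpa fca).
have cFa : continuous Fa by exact: cutsum1_continuous.
pose M x := Fa (x + 2 * s) + 2 * Fa x + Fa (x - 2 * s).
have cM : continuous M.
  apply: continuous_add; last exact: (@continuous_shift1 R Fa (- (2 * s))).
  by apply: continuous_add; [exact: (@continuous_shift1 R Fa (2 * s))|exact: continuous_scale].
pose M1 x := `|q (x + 2 * s)| + 2 * `|q x + p x| + `|q (x - 2 * s)|.
have dM (x : R) : 0 < x -> x < s -> is_derive x 1 M (M1 x).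
  move=> x0 xs.
  have x1 : s < x + 2 * s by lra.
  have x2 : x - 2 * s < - s by lra.
  have x3 : - s < x by lra.
  have dF1 : is_derive x 1 (fun y => Fa (y + 2 * s)) (`|q (x + 2 * s)|).
    exact: dv_shift (cutsum1_dv_gt _ s0 cqa x1).
  have dF2 : is_derive x 1 (fun y => Fa (y - 2 * s)) (`|q (x - 2 * s)|).
    exact: (dv_shift (cutsum1_dv_lt _ s0 cqa x2)).
  have dF3 : is_derive x 1 Fa (`|q x + p x|).
    by apply: is_derive_val (cutsum1_dv_in cqa cpa x3 xs) _; ring.
  apply: is_derive_val (dvD (dvD dF1 (dvZ 2 dF3)) dF2) _.
  by rewrite /M1; ring.
have hM x : `|h x| <= M1 x.
  rewrite /h /M1; apply: le_trans (ler_normD _ _) _; apply: lerD => //.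
  by apply: le_trans (ler_normB _ _) _; apply: lerD => //; rewrite normrM ger0_norm.
have Mle X : M X - M 0 <= 4 * c.
  have -> : M X - M 0 = (Fa (X + 2 * s) - Fa (0 + 2 * s)) + 2 * (Fa X - Fa 0)
    + (Fa (X - 2 * s) - Fa (0 - 2 * s)).
    by rewrite /M; move: (Fa _) (Fa _) (Fa _) (Fa _) (Fa _) (Fa _) => *; ring.
  have -> : 4 * c = c + 2 * c + c by ring.
  have osc' x y := le_trans (ler_norm _) (osc x y).
  by apply: lerD => //; apply: lerD => //; apply: ler_wpM2l.
(* [A] vanishes at [0] by evenness, whereas [B] starts at a multiple of the unknown [U 0]. *)
pose A x := V1 x * Tsol m Y x - V x * Tsol1 m Y x.
pose B x := V1 x * derive1 Y x - V x * Ysnd m Y x.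
have A0 : A 0 = 0 by rewrite /A V10 (T1_0 hY); ring.
pose W := 2 / (m + 1).
have W0 : 0 < W by rewrite divr_gt0//; lra.
have B0 : B 0 = - (U 0 * W).
  rewrite UV; [|lra|lra].
  by rewrite /B V10 /W /Ysnd (Y_0 hY) powR1; ring.
have dA (x : R) : 0 < x -> x < s -> is_derive x 1 A (h x * Tsol m Y x).
  move=> x0 xs.
  apply: is_derive_val (dvB (dvM (dV1 x x0 xs) (T_dv x hY)) (dvM (dV x) (T1_dv x hY))) _.
  by rewrite UV; [ring|clear -x0 s0; lra|clear -xs; lra].
have dB (x : R) : 0 < x -> x < s -> is_derive x 1 B (h x * derive1 Y x).
  move=> x0 xs.
  apply: is_derive_val (dvB (dvM (dV1 x x0 xs) (Y1_dv x hY)) (dvM (dV x) (Ysnd_dv x hY))) _.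
  by rewrite UV; [ring|clear -x0 s0; lra|clear -xs; lra].
have cA : continuous A.
  move=> x; apply: cvgB; apply: cvgM.
  - exact: cV1. - exact: (T_continuous hY). - exact: cV. - exact: (T1_continuous hY).
have cB : continuous B.
  move=> x; apply: cvgB; apply: cvgM.
  - exact: cV1. - exact: (Y1_continuous hY). - exact: cV.
  - exact: (dv_continuous (fun x => Ysnd_dv x hY)).
have Ale x : 0 <= x -> x <= s -> `|A x| <= C_var m * (1 + x) * c.
  move=> x0 xs.
  have kk : 0 <= (m + 4) * (1 + x) by rewrite mulr_ge0// addr_ge0// ltW.
  have := @dv_norm_le R A (fun x => h x * Tsol m Y x) (fun y => (m + 4) * (1 + x) * M y)
    (fun y => (m + 4) * (1 + x) * M1 y) 0 x x0 cA (continuous_scale cM).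
  rewrite A0 subr0 => hh.
  apply: (@le_trans _ _ ((m + 4) * (1 + x) * M x - (m + 4) * (1 + x) * M 0)).
    apply: hh.
    - by move=> y y0 yx; apply: dA => //; exact: lt_le_trans yx xs.
    - by move=> y y0 yx; apply: dvZ; apply: dM => //; exact: lt_le_trans yx xs.
    - move=> y y0 yx; rewrite normrM mulrC; apply: ler_pM => //.
      apply: le_trans (T_norm y hY) _; rewrite gtr0_norm//.
      by apply: ler_wpM2l; [clear -m0|clear -yx]; lra.
  rewrite -mulrBr /C_var; by have := ler_wpM2l kk (Mle x); clear; lra.
have Ble x : 0 <= x -> x <= s -> `|B x - B 0| <= 8 * c.
  move=> x0 xs.
  have := @dv_norm_le R B (fun x => h x * derive1 Y x) (fun y => 2 * M y)
    (fun y => 2 * M1 y) 0 x x0 cB (continuous_scale cM).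
  move=> hh; apply: (@le_trans _ _ (2 * M x - 2 * M 0)); last by have := Mle x; clear; lra.
  apply: hh.
  - by move=> y y0 yx; apply: dB => //; exact: lt_le_trans yx xs.
  - by move=> y y0 yx; apply: dvZ; apply: dM => //; exact: lt_le_trans yx xs.
  - by move=> y y0 yx; rewrite normrM mulrC; apply: ler_pM => //; exact: Y1_norm hY.
have VW x : V x * W = A x * derive1 Y x - (B x - B 0) * Tsol m Y x + U 0 * W * Tsol m Y x.
  rewrite B0 /W -(wronskian x hY) /A /B; ring.
have V1W x : V1 x * W = A x * Ysnd m Y x - (B x - B 0) * Tsol1 m Y x + U 0 * W * Tsol1 m Y x.
  rewrite B0 /W -(wronskian x hY) /A /B; ring.
pose tau := s * Tsol1 m Y s + Tsol m Y s.
(* The homogeneous part satisfies the Robin condition exactly, by the choice of [k0]; only the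
   source is left, and each of its two terms is at most [2 * s * c]. *)
have gam : `|s * V1 s + V s| <= 4 * s * c.
  have -> : s * V1 s + V s = s * diff2 s F s + diff2 s H s by rewrite /V1 /V /k0; ring.
  apply: le_trans (ler_normD _ _) _; rewrite normrM (ger0_norm s0).
  have h1 := ler_wpM2l s0 (diff2_cutsum1_le s0 cq cp fc s).
  have h2 := tent_le s0 cq cp fc s; rewrite (tent_cutsum s0 cq cp) in h2.
  rewrite -/F in h1; rewrite -/H in h2.
  lra.
have taule := T_boundary hY s1 s2; rewrite -/tau in taule.
pose kap := m * slope m / 2.
have kap0 : 0 < kap by apply: divr_gt0 => //; exact: mulr_gt0.
(* Insert the recovery formulas for [V] and [V1] into the boundary expression; the coefficient of
   [U 0] is the defect [tau], of order [s]. *)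
have id1 : U 0 * W * tau = (s * V1 s + V s) * W - A s * (s * Ysnd m Y s + derive1 Y s)
    + (B s - B 0) * tau.
  have -> : (s * V1 s + V s) * W = s * (V1 s * W) + V s * W by ring.
  by rewrite V1W VW /tau; ring.
have ss : s <= s by [].
have kk : `|s * Ysnd m Y s + derive1 Y s| <= 2 / slope m + 2.
  apply: le_trans (ler_normD _ _) _; apply: lerD; last exact: Y1_norm hY.
  by rewrite normrM (gtr0_norm (Ysnd_gt0 s hY)); exact: xYsnd_le hY.
have h0 : `|U 0| * W * `|tau| <= 4 * s * c * W + C_var m * (1 + s) * c * (2 / slope m + 2) + 8 * c * `|tau|.
  rewrite -{1}(gtr0_norm W0) -!normrM id1.
  apply: le_trans (ler_normD _ _) _; apply: lerD.
    apply: le_trans (ler_normB _ _) _; apply: lerD.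
      by rewrite normrM (gtr0_norm W0) ler_wpM2r// ltW.
    by rewrite normrM; apply: ler_pM => //; exact: Ale.
  by rewrite normrM; apply: ler_pM => //; exact: Ble.
have CA0 : 0 <= C_var m by rewrite /C_var mulr_ge0// addr_ge0// ltW.
have i0 : 0 <= 2 / slope m + 2 by rewrite addr_ge0// divr_ge0// ltW.
have U0 : `|U 0| <= C_origin m * c.
  apply: apriori_arith h0 => //.
  have := mulr_ge0 (ltW kap0) s0; move: taule; rewrite -/kap; clear => h1 h2.
  by rewrite ler0_norm; lra.
split => // x xs1 xs2.
have eUx : U x = U `|x| by case: (ger0P x) => _; rewrite ?eU.
rewrite eUx; have x0 := normr_ge0 x.
have xs : `|x| <= s by rewrite ler_norml xs1 xs2.
move: (`|x|) x0 xs => y y0 ys {x xs1 xs2 eUx}.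
have Vy : U y = V y by apply: UV => //; clear -y0 s0; lra.
have y1 : 0 <= 1 + y by rewrite addr_ge0.
have T0 : `|Tsol m Y y| <= (m + 4) * (1 + y) by have := T_norm y hY; rewrite (ger0_norm y0).
have : `|U y| * W <= C_var m * (1 + y) * c * 2 + 8 * c * ((m + 4) * (1 + y))
    + C_origin m * c * W * ((m + 4) * (1 + y)).
  rewrite -{1}(gtr0_norm W0) -normrM Vy VW.
  apply: le_trans (ler_normD _ _) _; apply: lerD.
    apply: le_trans (ler_normB _ _) _; apply: lerD.
      by rewrite normrM; apply: ler_pM => //; [exact: Ale|exact: Y1_norm hY].
    by rewrite normrM; apply: ler_pM => //; exact: Ble.
  rewrite normrM (normrM (U 0)); apply: ler_pM => //; rewrite ?mulr_ge0//.
  by rewrite (gtr0_norm W0) ler_wpM2r// ltW.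
rewrite -ler_pdivlMr// => /le_trans; apply.
rewrite /C_growth -/W /C_var le_eqVlt; apply/orP; left; apply/eqP.
by field; rewrite gt_eqF.
Qed.

End linear.

(** * The potential and the scaling regime *)

Section potential.
Context {R : realType}.
Implicit Types (f Phi : R -> R) (m k r x y a b : R).

Lemma domPhiE x : domPhi x <-> -1 < x /\ x <= 0.
Proof. by rewrite /domPhi/= in_itv/=; split => [/andP|/andP]. Qed.

Lemma derive_in_eps f x eps : derivable_in domPhi f -> domPhi x -> 0 < eps ->
  exists2 d : R, 0 < d & forall y, domPhi y -> y != x -> `|y - x| < d ->
    `|derive_in domPhi f x - (f y - f x) / (y - x)| < eps.
Proof.
move=> df dx e0; have /cvgrPdist_lt /(_ eps e0) := df x dx.
move=> [d /= d0 h]; exists d => // y dy yx yd.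
by apply: h => //=; rewrite distrC.
Qed.

Lemma derive_in_lip f x : derivable_in domPhi f -> domPhi x ->
  exists2 d : R, 0 < d & forall y, domPhi y -> `|y - x| < d ->
    `|f y - f x| <= (`|derive_in domPhi f x| + 1) * `|y - x|.
Proof.
move=> df dx; have [d d0 h] := derive_in_eps df dx ltr01.
exists d => // y dy yd; have [->|yx] := eqVneq y x; first by rewrite !subrr normr0 mulr0.
have := h y dy yx yd; set q := (f y - f x) / (y - x) => hq.
have -> : f y - f x = q * (y - x) by rewrite /q divfK// subr_eq0.
rewrite normrM ler_wpM2r//.
have -> : q = derive_in domPhi f x - (derive_in domPhi f x - q) by ring.
by apply: le_trans (ler_normB _ _) _; rewrite lerD2l ltW.
Qed.

Lemma derivable_in_continuous f a b : derivable_in domPhi f ->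
  -1 < a -> b <= 0 -> {within `[a, b], continuous f}.
Proof.
move=> df a1 b0; apply/subspace_continuousP => x /=; rewrite in_itv/= => /andP[ax xb].
have dx : domPhi x by apply/domPhiE; split; lra.
apply/cvgrPdist_lt => e e0; have [d d0 h] := derive_in_lip df dx.
set L := `|derive_in domPhi f x| + 1 in h.
have L0 : 0 < L by rewrite /L; have := normr_ge0 (derive_in domPhi f x); lra.
exists (Num.min d (e / L)) => /=; first by rewrite lt_min d0 divr_gt0.
move=> y /=; rewrite lt_min distrC => /andP[yd ye]; rewrite in_itv/= => /andP[ay yb].
have dy : domPhi y by apply/domPhiE; split; lra.
rewrite distrC; apply: le_lt_trans (h y dy yd) _.
by rewrite mulrC -ltr_pdivlMr.
Qed.

Lemma derivable_in_is_derive f x : derivable_in domPhi f -> -1 < x -> x < 0 ->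
  is_derive x 1 f (derive_in domPhi f x).
Proof.
move=> df x1 x0; set l := derive_in domPhi f x.
have dx : domPhi x by apply/domPhiE; split; lra.
have c : h^-1 *: (f (h *: 1 + x) - f x) @[h --> 0^'] --> l.
  apply/cvgrPdist_lt => e e0; have [d d0 h] := derive_in_eps df dx e0.
  exists (Num.min d (Num.min (x + 1) (- x))) => /=.
    by rewrite !lt_min d0; apply/andP; split => //; apply/andP; split; lra.
  move=> y /=; rewrite !lt_min sub0r normrN => /andP[yd /andP[y1 y2]] yn0.
  have -> : y%:A + x = x + y by rewrite -[y%:A]/(y * 1) mulr1 addrC.
  have [y3 y4] : - (x + 1) < y /\ y < - x.
    by move: y1 y2; rewrite !ltr_norml => /andP[? _] /andP[_ ?].
  have dxy : domPhi (x + y) by apply/domPhiE; split; lra.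
  have yx : x + y != x by rewrite -subr_eq0 addrC addKr.
  have := h _ dxy yx; rewrite (_ : x + y - x = y); last by ring.
  by move=> /(_ yd); rewrite mulrC.
apply: DeriveDef; first by apply/cvg_ex; exists l.
exact/cvg_lim.
Qed.

Section adm.
Variables (m k : R) (Phi : R -> R).
Hypothesis hPhi : admissible_potential m k Phi.

Local Notation Phi1 := (dPhi 1 Phi).
Local Notation Phi2 := (dPhi 2 Phi).

(** Interior derivability and continuity up to the endpoint suffice, so [b = 0] is allowed although
    the derivative is only one-sided there. *)
Lemma potential_mvt a b : -1 < a -> a <= b -> b <= 0 ->
  exists c, [/\ a <= c, c <= b & Phi1 b - Phi1 a = Phi2 c * (b - a)].
Proof.
move=> a1 ab b0; have [_ d1 _ _] := Phi_C3 hPhi.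
apply: (mvt ab).
  by move=> x ax xb; apply: derivable_in_is_derive => //; lra.
exact: derivable_in_continuous.
Qed.

(** A positive derivative at [x < 0] would make some difference quotient to the right positive. But
    [x + t] is a convex combination of [x] and the minimum [0], with weight [1 + t / x] on [x], so
    [Phi (x + t) <= Phi x]. *)
Lemma potential_le0 x : -1 < x -> x <= 0 -> Phi1 x <= 0.
Proof.
move=> x1; rewrite le_eqVlt => /predU1P[->|x0]; first by rewrite (dPhi0 hPhi).
have dx : domPhi x by apply/domPhiE; split; lra.
have [d0 _ _ _] := Phi_C3 hPhi.
rewrite leNgt; apply/negP => l0.
have [d dpos h] := derive_in_eps d0 dx l0.
pose t := Num.min (d / 2) (- x / 2).
have t0 : 0 < t by rewrite lt_min; apply/andP; split; lra.
have [td tx] : t < d /\ t < - x.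
  by rewrite /t !gt_min; split; apply/orP; [left|right]; lra.
have dy : domPhi (x + t) by apply/domPhiE; split; lra.
have yx : x + t != x by rewrite -subr_eq0 addrC addKr gt_eqF.
have := h _ dy yx; rewrite (_ : x + t - x = t); last by ring.
rewrite gtr0_norm// => /(_ td).
have dom0 : @domPhi R 0 by apply/domPhiE; split; lra.
have x00 : x != 0 by rewrite lt_eqF.
have fx := Phi_min0 hPhi dx; rewrite (Phi0 hPhi) in fx.
have l1 : 0 < 1 + t / x.
  have : -1 < t / x by rewrite ltr_ndivlMr//; lra.
  lra.
have l2 : 1 + t / x < 1 by rewrite gtrDl ltr_ndivrMr// mul0r.
have := Phi_strictly_convex hPhi dx dom0 x00 l1 l2.
rewrite (Phi0 hPhi) !mulr0 !addr0 (_ : (1 + t / x) * x = x + t); last by field.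
move=> conv_; have fle : Phi (x + t) - Phi x <= 0.
  have : (1 + t / x) * Phi x <= Phi x by rewrite ler_piMl// ltW.
  lra.
have : (Phi (x + t) - Phi x) / t <= 0 by rewrite pmulr_lle0 ?invr_gt0.
rewrite -[dPhi 1 Phi x]/(derive_in domPhi Phi x).
move: ((Phi (x + t) - Phi x) / t) (derive_in domPhi Phi x) => u v u0.
by rewrite ltr_norml => /andP[_]; lra.
Qed.

(** The singular bounds are assumed only near [-1]. On [[-1/4, 0]] the left sides are bounded by
    compactness and [(1 + r) ^ k] stays above [(3/4) ^ k], so a larger constant covers the whole
    domain. *)
Lemma potential_bounds : exists2 C : R, 1 <= C & forall r, -1 < r -> r <= 0 ->
  `|1 + (m + 1) * Phi1 r * (1 + r) `^ (m + 1)| <= C * (1 + r) `^ k /\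
  `|Phi2 r * (1 + r) `^ (m + 2) - 1| <= C * (1 + r) `^ k.
Proof.
have m0 := m_gt0 hPhi; have k0 := k_gt0 hPhi.
have [_ _ d2 _] := Phi_C3 hPhi.
have q0 : - (1 / 4) <= 0 :> R by lra.
have q1 : -1 < - (1 / 4) :> R by lra.
have cPhi2 : {within `[- (1 / 4), 0], continuous (fun x => `|Phi2 x|)}.
  have c2 := derivable_in_continuous d2 q1 (lexx 0).
  by move=> x; apply: cvg_norm; exact: c2.
have [c _ Bc] := EVT_max q0 cPhi2; set B := `|Phi2 c| in Bc.
have B0 : 0 <= B by rewrite /B.
have [CP hCP] := Phi_singular hPhi.
pose K := (3 / 4) `^ k : R.
have K0 : 0 < K by rewrite powR_gt0//; lra.
pose C := 1 + `|CP| + (1 + (m + 1) * B) / K.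
have D0 : 0 <= (1 + (m + 1) * B) / K.
  by apply: divr_ge0; [rewrite addr_ge0// mulr_ge0//; lra|exact: ltW].
exists C; first by rewrite /C; have := normr_ge0 CP; lra.
move=> r r1 r0; have p0 : 0 <= (1 + r) `^ k by exact: powR_ge0.
have [h|h] := ltP r (- (1 / 4)).
  have [_ h2] := hCP r r1 h.
  have CPle : CP * (1 + r) `^ k <= C * (1 + r) `^ k.
    by rewrite ler_wpM2r// /C; have := ler_norm CP; lra.
  have n1 := normr_ge0 (1 + (m + 1) * Phi1 r * (1 + r) `^ (m + 1)).
  have n2 := normr_ge0 (-1 + Phi2 r * (1 + r) `^ (m + 2)).
  by split; [|rewrite [_ - 1]addrC]; lra.
have Kle : 1 + (m + 1) * B <= C * (1 + r) `^ k.
  have h1 : K <= (1 + r) `^ k by apply: ge0_ler_powR; rewrite ?nnegrE; lra.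
  have h2 : (1 + (m + 1) * B) / K * K <= (1 + (m + 1) * B) / K * (1 + r) `^ k by rewrite ler_wpM2l.
  rewrite divfK ?gt_eqF// in h2; apply: (le_trans h2); rewrite ler_wpM2r// /C.
  by have := normr_ge0 CP; lra.
have ple1 (a : R) : 0 <= a -> (1 + r) `^ a <= 1.
  move=> a0; have := @ge0_ler_powR R a a0 (1 + r) 1; rewrite powR1; apply; rewrite ?nnegrE//; lra.
have Phi2B x : - (1 / 4) <= x -> x <= 0 -> `|Phi2 x| <= B.
  by move=> x1 x2; apply: Bc; rewrite in_itv/= x1 x2.
have Phi1B : `|Phi1 r| <= B.
  have [t [t1 t2 e]] := potential_mvt r1 r0 (lexx 0).
  have -> : Phi1 r = - (Phi2 t * (0 - r)) by rewrite -e (dPhi0 hPhi); ring.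
  rewrite normrN normrM sub0r normrN (ler0_norm r0) -[leRHS]mulr1.
  apply: ler_pM => //; first lra.
  + by apply: Phi2B => //; lra.
  + by lra.
split; apply: le_trans Kle.
- apply: le_trans (ler_normD _ _) _; rewrite normr1 lerD2l -mulrA normrM ger0_norm; last lra.
  apply: ler_wpM2l; first lra.
  rewrite normrM (ger0_norm (powR_ge0 _ _)) -[leRHS]mulr1; apply: ler_pM => //; first exact: powR_ge0.
  by apply: ple1; lra.
- apply: le_trans (ler_normB _ _) _; rewrite normr1 addrC lerD2l.
  rewrite normrM (ger0_norm (powR_ge0 _ _)); apply: (@le_trans _ _ (1 * B)).
    rewrite mulrC; apply: ler_pM => //; first exact: powR_ge0.
      by apply: ple1; lra.
    exact: Phi2B.
  by apply: ler_wpM2r => //; lra.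
Qed.

End adm.
End potential.

(** * The regime of small delta and the approximate wave *)

Section scaling_regime.
Context {R : realType}.
Implicit Types (f g Y : R -> R) (m k d al s x a b c : R).

Lemma powR_between (u z b : R) : 1 <= u -> u^-1 <= z -> z <= u -> z `^ b <= u `^ `|b|.
Proof.
move=> u1 uz zu; have u0 : 0 < u by lra.
have z0 : 0 < z by apply: lt_le_trans uz; rewrite invr_gt0.
have [b0|b0] := leP 0 b.
  by rewrite ger0_norm//; apply: ge0_ler_powR => //; rewrite nnegrE ltW.
rewrite ltr0_norm//.
have -> : z `^ b = (z^-1) `^ (- b) by rewrite -powR_inv1 ?ltW// -powRrM mulN1r opprK.
apply: ge0_ler_powR; rewrite ?nnegrE ?invr_ge0 ?(ltW z0) ?(ltW u0) ?oppr_ge0 ?(ltW b0)//.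
by rewrite invf_ple.
Qed.

Lemma powR_near1 (a t : R) : `|t| <= 1 / 2 ->
  `|(1 + t) `^ a - 1| <= `|a| * 2 `^ `|a - 1| * `|t|.
Proof.
move=> ht; have [t1 t2] : - (1 / 2) <= t /\ t <= 1 / 2.
  by move: ht; rewrite ler_norml => /andP.
have key u v : 1 / 2 <= u -> u <= v -> v <= 3 / 2 ->
    `|v `^ a - u `^ a| <= `|a| * 2 `^ `|a - 1| * `|v - u|.
  move=> u1 uv v1.
  have [||c [c1 c2 ->]] := @mvt _ (fun x => x `^ a) (fun x => a * x `^ (a - 1)) u v uv.
  - by move=> x ux _; apply: is_derive1_powR; lra.
  - apply: derivable_within_continuous => x; rewrite in_itv/= => /andP[ux _].
    have x0 : 0 < x by lra.
    by case: (is_derive1_powR a x0).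
  - rewrite normrM ler_wpM2r// normrM ler_wpM2l// ger0_norm ?powR_ge0//.
    by apply: powR_between; lra.
have e1 : 1 `^ a = 1 :> R by rewrite powR1.
have [t0|/ltW t0] := leP 0 t.
- by have := key 1 (1 + t); rewrite e1 (_ : 1 + t - 1 = t); [apply; lra|ring].
- have := key (1 + t) 1; rewrite e1 (_ : 1 - (1 + t) = - t); last by ring.
  by rewrite normrN distrC; apply; lra.
Qed.

(** The equation for [xi] says that [(d * s) ^ (m / (m + 2))] times [(s * Y' s + Y s) / s] equals
    [2 ^ (2 / (m + 2))]. The second factor lies between [slope m] and 5, and solving for [d * s]
    gives [a_lo] and [a_hi]. *)
Definition a_lo m : R := (2 `^ (2 / (m + 2)) / 5) `^ ((m + 2) / m).
Definition a_hi m : R := (2 `^ (2 / (m + 2)) / slope m) `^ ((m + 2) / m).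

Lemma a_lo_gt0 m : 0 < a_lo m.
Proof. by apply: powR_gt0; apply: divr_gt0 => //; apply: powR_gt0. Qed.

Lemma a_hi_gt0 m : 1 < m -> 0 < a_hi m.
Proof. by move=> m1; apply: powR_gt0; apply: divr_gt0; [apply: powR_gt0|exact: slope_gt0]. Qed.

Lemma Lambda_bounds m Y s : profile m Y -> 1 <= s ->
  slope m * s <= s * derive1 Y s + Y s /\ s * derive1 Y s + Y s <= 5 * s.
Proof.
move=> hY s1; have s0 : 0 <= s by lra.
have h1 := Y1_slope hY s1; have h2 := Y1_norm s hY; have h3 := Y_le s hY.
rewrite (ger0_norm s0) in h3; have h4 := Y_gt0 s hY.
have := ler_wpM2l s0 h1; have := ler_wpM2l s0 (le_trans (ler_norm _) h2).
by split; lra.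
Qed.

(** What later estimates use about delta, alpha and xi. [sc_eq] is the Robin condition
    [s * r' s + r s = 0] for [r = -1 + d * al * Y]; [sc_lo] and [sc_hi] fix the order [1 / d] of
    [s]. *)
Record scaled m Y d al s : Prop := Scaled {
  sc_prof : profile m Y;
  sc_large : large m s;
  sc_big : 1 <= slope m * s;
  sc_d0 : 0 < d;
  sc_d1 : d <= 1;
  sc_al0 : 0 < al;
  sc_eq : d * al * (s * derive1 Y s + Y s) = 1;
  sc_lo : a_lo m <= d * s;
  sc_hi : d * s <= a_hi m }.

Lemma scaled_of_xi m Y omega s : profile m Y -> 0 < omega ->
  delta_of m omega <= 1 ->
  delta_of m omega <= a_lo m / (2 / (m * slope m) + 1 / slope m) ->
  is_xi m Y omega s -> scaled m Y (delta_of m omega) (alpha_of m omega s) s.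
Proof.
move=> hY om0 d1 dsm [s1 e].
have m1 := profile_m hY; have sl0 := slope_gt0 m1.
set d := delta_of m omega in e d1 dsm *.
have d0 : 0 < d by apply: powR_gt0.
have s0 : 0 < s by lra.
have ds0 : 0 < d * s by apply: mulr_gt0.
have [L1 L2] := Lambda_bounds hY s1; set La := s * derive1 Y s + Y s in e L1 L2 *.
pose t := m / (m + 2).
have t0 : 0 < t by apply: divr_gt0; lra.
have et : 2 / (m + 2) = 1 - t by rewrite /t; field; lra.
have tV : t^-1 = (m + 2) / m by rewrite invf_div.
have La0 : 0 < La by apply: lt_le_trans L1; exact: mulr_gt0.
have key : (d * s) `^ t * (La / s) = 2 `^ (1 - t).
  rewrite powRM ?ltW// mulrACA -[_ * La]/(d `^ (m / (m + 2)) * La) e et powRM ?ltW//.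
  rewrite -[RHS]mulr1 -mulrA; congr (_ * _).
  rewrite mulrA -powRD; last by rewrite (gt_eqF s0) implybT.
  by rewrite subrK powRr1 ?ltW// divff ?gt_eqF.
have dst : d * s = ((d * s) `^ t) `^ t^-1.
  by rewrite -powRrM divff ?gt_eqF// powRr1 ?ltW.
have L1' : slope m <= La / s by rewrite ler_pdivlMr.
have L2' : La / s <= 5 by rewrite ler_pdivrMr.
have Las0 : 0 < La / s by exact: divr_gt0.
have dste : (d * s) `^ t = 2 `^ (1 - t) / (La / s).
  by rewrite -key mulfK ?gt_eqF.
have p2 : 0 <= 2 `^ (1 - t) :> R by exact: powR_ge0.
have lo : a_lo m <= d * s.
  rewrite dst /a_lo et -tV; apply: ge0_ler_powR; rewrite ?nnegrE ?powR_ge0 ?invr_ge0 ?(ltW t0)//.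
  by rewrite dste; apply: ler_wpM2l => //; rewrite lef_pV2 ?posrE.
have hi : d * s <= a_hi m.
  rewrite dst /a_hi et -tV; apply: ge0_ler_powR; rewrite ?nnegrE ?powR_ge0 ?invr_ge0 ?(ltW t0)//.
    by apply: divr_ge0 => //; exact: ltW.
  by rewrite dste; apply: ler_wpM2l => //; rewrite lef_pV2 ?posrE.
pose q := 2 / (m * slope m) + 1 / slope m.
have q1 : 0 < 2 / (m * slope m) by apply: divr_gt0 => //; apply: mulr_gt0 => //; exact: lt_trans ltr01 m1.
have q2 : 0 < 1 / slope m by apply: divr_gt0.
(* Small delta forces large [s], since [d * s] is bounded below; this gives both largeness
   conditions at once. *)
have sq : q <= s.
  have : q * d <= s * d.
    rewrite (mulrC s); apply: le_trans lo.
    by rewrite mulrC -ler_pdivlMr//; apply: addr_gt0.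
  by rewrite ler_pM2r.
have al0 : 0 < alpha_of m omega s.
  by apply: powR_gt0; rewrite -mulrA; apply: mulr_gt0.
split => //.
- by split => //; apply: le_trans sq; rewrite /q lerDl ltW.
- by rewrite mulrC -ler_pdivrMr//; apply: le_trans sq; rewrite /q lerDr ltW.
- rewrite /alpha_of -/d et powRN.
  have e2 : (2 * d * s) `^ (1 - t) = d `^ (1 - t) * (2 * s) `^ (1 - t).
    by rewrite -powRM ?ltW//; [congr (_ `^ _); ring|apply: mulr_gt0].
  rewrite e2 -et -e -/La et.
  have -> : d * (d `^ (1 - t) * (d `^ (m / (m + 2)) * La))^-1 * La
     = d * (d `^ (1 - t) * d `^ t)^-1 * (La^-1 * La).
    by rewrite -/t !invfM; ring.
  rewrite -powRD; last by rewrite (gt_eqF d0) implybT.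
  by rewrite subrK powRr1 ?ltW// divff ?gt_eqF// mulVf ?gt_eqF// mulr1.
Qed.

Section consequences.
Variables (m : R) (Y : R -> R) (d al s : R).
Hypothesis hS : scaled m Y d al s.

Lemma sc_m1 : 1 < m. Proof. exact: profile_m (sc_prof hS). Qed.
Lemma sc_s1 : 1 <= s. Proof. by case: (sc_large hS). Qed.
Lemma sc_s0 : 0 < s. Proof. by have := sc_s1; lra. Qed.
Lemma sc_dal0 : 0 < d * al.
Proof. by apply: mulr_gt0; [exact: (sc_d0 hS)|exact: (sc_al0 hS)]. Qed.

Lemma dals_lo : 1 / 5 <= d * al * s.
Proof.
have [_ L2] := Lambda_bounds (sc_prof hS) sc_s1.
have := ler_wpM2l (ltW sc_dal0) L2; rewrite (sc_eq hS); lra.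
Qed.

Lemma dals_hi : d * al * s <= 1 / slope m.
Proof.
have [L1 _] := Lambda_bounds (sc_prof hS) sc_s1.
rewrite ler_pdivlMr ?(slope_gt0 sc_m1)//.
by have := ler_wpM2l (ltW sc_dal0) L1; rewrite (sc_eq hS); lra.
Qed.

(** An upper bound for alpha itself: [d * al * s <= 1 / slope m], while [d * s >= a_lo m]. *)
Definition C_al m := 1 / (slope m * a_lo m).

Lemma dal_hi : d * al <= C_al m * d.
Proof.
have sl0 := slope_gt0 sc_m1; have al0 := a_lo_gt0 m; have d0 := sc_d0 hS.
have h := dals_hi; have h1 := sc_lo hS; have s0 := sc_s0.
have a0 := sc_al0 hS.
rewrite mulrC; apply: ler_wpM2r; first exact: ltW.
rewrite /C_al ler_pdivlMr; last exact: mulr_gt0.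
rewrite ler_pdivlMr// in h; apply: le_trans h.
have -> : d * al * s * slope m = al * (slope m * (d * s)) by ring.
by apply: ler_wpM2l; [exact: ltW|apply: ler_wpM2l => //; exact: ltW].
Qed.

Lemma dal_lo : d <= 5 * a_hi m * (d * al).
Proof.
have d0 := sc_d0 hS; have h := dals_lo; have h1 := sc_hi hS; have a0 := sc_al0 hS.
have h2 : 1 <= 5 * (al * (d * s)) by lra.
have h3 : al * (d * s) <= al * a_hi m by apply: ler_wpM2l => //; exact: ltW.
have : d * 1 <= d * (5 * (al * a_hi m)) by apply: ler_wpM2l; [exact: ltW|lra].
lra.
Qed.

Definition Rb : R -> R := tent s (cutsum s zero_fun (fun x => d * al * Kbar m Y x)).

Lemma Kbar_continuous : continuous (Kbar m Y).
Proof.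
have -> : Kbar m Y = fun x => - (m + 1)^-1 * (Pbar m Y x * Y x).
  by apply/funext => x; exact: Kbar_Pbar (sc_prof hS).
apply: continuous_scale.
have cP := Pbar_continuous (sc_prof hS); have cY := Y_continuous (sc_prof hS).
by move=> x; apply: cvgM; [exact: cP|exact: cY].
Qed.

Lemma Kbar_even x : Kbar m Y (- x) = Kbar m Y x.
Proof. by rewrite /Kbar (Y_even x (sc_prof hS)). Qed.

Lemma Kbar_le0 x : Kbar m Y x <= 0.
Proof.
rewrite /Kbar oppr_le0 invr_ge0 mulr_ge0 ?powR_ge0//.
by have := sc_m1; lra.
Qed.

Let p x := d * al * Kbar m Y x.
Let cp : continuous p.
Proof. by apply: continuous_scale; exact: Kbar_continuous. Qed.
Let ep x : p (- x) = p x. Proof. by rewrite /p Kbar_even. Qed.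
Let p0 x : p x <= 0.
Proof. by rewrite /p pmulr_rle0 ?sc_dal0// Kbar_le0. Qed.

Lemma Rb_continuous : continuous Rb.
Proof. by apply: tent_continuous cp => //; [exact: ltW sc_s0|exact: zero_fun_continuous]. Qed.

Lemma Rb_even x : Rb (- x) = Rb x.
Proof. by apply: tent_even => //; [exact: ltW sc_s0|exact: zero_fun_continuous]. Qed.

(** The source is [- (d * al / 2) * Y''], so both primitives are explicit, and the constant in
    [tent_inner] equals -1 by [sc_eq]. *)
Lemma Rb_inner x : - s <= x -> x <= s -> Rb x = -1 + d * al * Y x.
Proof.
move=> x1 x2; rewrite /Rb (tent_inner (ltW sc_s0) cp ep x1 x2).
have hY := sc_prof hS; have m1 := sc_m1.
have pE y : p y = - (d * al / 2) * Ysnd m Y y.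
  by rewrite /p (Kbar_Pbar y hY) (Ysnd_Pbar y hY); field; lra.
have p1 : prm p = fun y => - (d * al / 2) * derive1 Y y.
  apply: (prm_eq cp) => [y|]; last by rewrite (Y1_0 hY) mulr0.
  by rewrite pE; apply: dvZ; exact: Y1_dv.
have p2 : prm (prm p) = fun y => - (d * al / 2) * (Y y - 1).
  rewrite p1; apply: prm_eq => [|y|]; last by rewrite (Y_0 hY) subrr mulr0.
    by apply: continuous_scale; exact: Y1_continuous hY.
  apply: dvZ; rewrite -[derive1 Y y]subr0.
  exact: (dvB (Y_dv y hY) (dvC y 1)).
rewrite p2 p1.
have -> : 2 * (- (d * al / 2) * (Y s - 1) + s * (- (d * al / 2) * derive1 Y s))
  - 2 * (- (d * al / 2) * (Y x - 1)) =
  - (d * al * (s * derive1 Y s + Y s)) + d * al * Y x by field.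
by rewrite (sc_eq hS).
Qed.

(** Outside the window the wave increases with [|x|] from its value at [s], which exceeds -1 by
    [d * al * Y s], a quantity bounded below because [Y] grows linearly and
    [d * al * s >= 1 / 5]. *)
Lemma Rb_outer x : s <= `|x| -> -1 + slope m / 10 <= Rb x /\ Rb x <= 0.
Proof.
move=> sx; have [h1 h2] := tent_outer (ltW sc_s0) cp ep p0 sx.
split => //; apply: le_trans h1; rewrite -/Rb.
have s0 := sc_s0; have ss : - s <= s by lra.
rewrite (Rb_inner ss (lexx s)) lerD2l.
have := Y_ge s (sc_prof hS); rewrite (gtr0_norm s0) => h.
have sl := slope_gt0 sc_m1.
have h3 := ler_wpM2l (ltW sc_dal0) h.
apply: le_trans h3.
have -> : d * al * (slope m / 2 * (1 + s)) = slope m / 2 * (d * al + d * al * s) by ring.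
have -> : slope m / 10 = slope m / 2 * (1 / 5) by field.
apply: ler_wpM2l; first lra.
by have := dals_lo; have := sc_dal0; lra.
Qed.

Lemma Rb_support x : 3 * s <= `|x| -> Rb x = 0.
Proof. exact: (tent_support (ltW sc_s0) cp ep). Qed.

(** Convexity and [1 <= slope m * s <= s * Y' s] give [Y s <= 2 * (s * Y' s)], whence the factor
    2/3. The wave is thus at most -1/3 in the window, which leaves room for perturbations to remain
    nonpositive. *)
Lemma dalY_le x : - s <= x -> x <= s -> d * al * Y x <= 2 / 3.
Proof.
move=> x1 x2; have hY := sc_prof hS; have s0 := sc_s0.
have xs : `|x| <= s by rewrite ler_norml x1 x2.
have h1 : Y x <= Y s by rewrite -(Y_norm x hY); exact: Y_nondecreasing hY _ xs.
have h2 := Y_convex hY (ltW s0).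
have h3 := Y1_slope hY sc_s1.
have h4 := sc_big hS.
have h5 : slope m * s <= s * derive1 Y s by rewrite mulrC; apply: ler_wpM2l => //; exact: ltW.
have h6 : Y x <= 2 / 3 * (s * derive1 Y s + Y s) by lra.
have := ler_wpM2l (ltW sc_dal0) h6.
have -> : d * al * (2 / 3 * (s * derive1 Y s + Y s)) = 2 / 3 * (d * al * (s * derive1 Y s + Y s)) by ring.
by rewrite (sc_eq hS) mulr1.
Qed.

Lemma Rb_abs x : `|Rb x| <= 1.
Proof.
rewrite ler_norml; have [h|h] := leP `|x| s.
  move: (h); rewrite ler_norml => /andP[x1 x2].
  have := dalY_le x1 x2; rewrite (Rb_inner x1 x2).
  by have := mulr_gt0 sc_dal0 (Y_gt0 x (sc_prof hS)); lra.
have [h1 h2] := Rb_outer (ltW h).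
have := slope_gt0 sc_m1; lra.
Qed.

End consequences.
End scaling_regime.

(** * Weighted and a priori estimates *)

Section tame.
Context {R : realType}.
Implicit Types (f g Y U q p w : R -> R) (m k d al s x y a b c eps : R).

(* Up to constants what a bound on the star norm says about U itself, without
   U'': this survives pointwise limits. *)
Definition tame d eps U := [/\ forall x, U (- x) = U x, `|U 0| <= eps,
  forall x y, `|U x - U y| <= eps * `|x - y|, forall x, d * `|U x| <= eps &
  L1_le U (eps / d ^+ 2)].

Lemma tame_ge0 d eps U : tame d eps U -> 0 <= eps.
Proof. by case=> _ h _ _ _; exact: le_trans h. Qed.

Lemma lipschitz_continuous L U : 0 <= L ->
  (forall x y, `|U x - U y| <= L * `|x - y|) -> continuous U.
Proof.
move=> L0 lip x; apply/cvgrPdist_lt => e ee.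
have L1 : 0 < L + 1 by lra.
exists (e / (L + 1)) => /=; first exact: divr_gt0.
move=> y /= xy; apply: le_lt_trans (lip x y) _.
apply: (@le_lt_trans _ _ ((L + 1) * `|x - y|)); first by rewrite ler_wpM2r//; lra.
by rewrite mulrC -ltr_pdivlMr.
Qed.

Lemma tame_continuous d eps U : tame d eps U -> continuous U.
Proof.
by move=> hU; have e0 := tame_ge0 hU; case: hU => _ _ lip _ _; exact: lipschitz_continuous lip.
Qed.

Lemma tame_grow d eps U x : tame d eps U -> `|U x| <= eps * (1 + `|x|).
Proof.
case=> _ h0 lip _ _; rewrite -(subrK (U 0) (U x)) mulrDr mulr1 addrC.
apply: le_trans (ler_normD _ _) _; apply: lerD => //.
by have := lip x 0; rewrite subr0.
Qed.

Lemma tame_le d a b U : 0 < d -> a <= b -> tame d a U -> tame d b U.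
Proof.
move=> d0 ab [h1 h2 h3 h4 h5]; split => //.
- exact: le_trans ab.
- by move=> x y; apply: le_trans (h3 x y) _; rewrite ler_wpM2r.
- by move=> x; exact: le_trans ab.
- by apply: L1_le_trans h5; rewrite ler_wpM2r// invr_ge0 exprn_ge0// ltW.
Qed.

Lemma tameB d a b U V : 0 < d -> tame d a U -> tame d b V ->
  tame d (a + b) (fun x => U x - V x).
Proof.
move=> d0 [h1 h2 h3 h4 h5] [g1 g2 g3 g4 g5]; split.
- by move=> x; rewrite h1 g1.
- by apply: le_trans (ler_normB _ _) _; exact: lerD.
- move=> x y; rewrite (_ : _ - _ = (U x - U y) - (V x - V y)); last by ring.
  by apply: le_trans (ler_normB _ _) _; rewrite mulrDl; exact: lerD.
- move=> x; apply: (@le_trans _ _ (d * (`|U x| + `|V x|))).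
    exact: ler_wpM2l (ltW d0) _ _ (ler_normB _ _).
  by rewrite mulrDr; exact: lerD.
- by rewrite mulrDl; exact: L1_leB.
Qed.

Lemma tame_lim d eps (Un : nat -> R -> R) U : 0 < d -> 0 <= eps ->
  (forall n, tame d eps (Un n)) ->
  (forall x, (fun n => Un n x) @ \oo --> U x) -> tame d eps U.
Proof.
move=> d0 e0 tU cU.
have cN (v : nat -> R) (l M : R) : v @ \oo --> l -> (forall n, `|v n| <= M) -> `|l| <= M.
  move=> vl vM; have cv : `|v n| @[n --> \oo] --> `|l| by apply: cvg_norm.
  rewrite -(cvg_lim (@Rhausdorff R) cv); apply: limr_le; first by apply/cvg_ex; exists `|l|.
  exact: nearW.
have lip x y : `|U x - U y| <= eps * `|x - y|.
  apply: (cN (fun n => Un n x - Un n y)); first by apply: cvgB; exact: cU.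
  by move=> n; case: (tU n).
have cont := lipschitz_continuous e0 lip.
split => //.
- move=> x; apply: (@cvg_unique _ (@Rhausdorff R) ((fun n => Un n x) @ \oo)); last exact: cU.
  have e : (fun n => Un n x) = (fun n => Un n (- x)) by apply/funext => n; case: (tU n).
  by rewrite /= e; exact: cU.
- by apply: (cN (fun n => Un n 0)) => // n; case: (tU n).
- move=> x; have -> : d * `|U x| = `|d * U x| by rewrite normrM gtr0_norm.
  apply: (cN (fun n => d * Un n x)); first by apply: cvgM; [exact: cvg_cst|exact: cU].
  by move=> n; rewrite normrM gtr0_norm//; case: (tU n).
- apply: (@L1_le_fatou _ Un) => //; first by move=> n; case: (tU n).
  exact: continuous_measurable.
Qed.

(** The weight is a multiple of [Y''], so its integral is a multiple of the bounded slope [Y' s]. *)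
Lemma weight_integral m Y d al s : scaled m Y d al s ->
  prm (fun x => Pbar m Y x * Y x) s <= m + 1.
Proof.
move=> hS; have hY := sc_prof hS; have m1 := sc_m1 hS.
have -> : prm (fun x => Pbar m Y x * Y x) = fun x => (m + 1) / 2 * derive1 Y x.
  have cP := Pbar_continuous hY; have cY := Y_continuous hY.
  apply: prm_eq => [|y|].
  - by move=> x; apply: cvgM; [exact: cP|exact: cY].
  - apply: is_derive_val (dvZ _ (Y1_dv y hY)) _.
    by rewrite (Ysnd_Pbar y hY); field; lra.
  - by rewrite (Y1_0 hY) mulr0.
have := Y1_norm s hY; rewrite ler_norml => /andP[_ h].
have : (m + 1) / 2 * derive1 Y s <= (m + 1) / 2 * 2 by apply: ler_wpM2l => //; lra.
lra.
Qed.

(** For [k < m] the power of [1 + s] is at most 1 and the factor [d ^ k] is kept. For [k > m] it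
    grows like [d ^ (m - k)], because [s] is of order [1 / d], and turns [d ^ k] into [d ^ m]. For
    [k = m] the integral would be logarithmic. *)
Lemma weight_arith m k s d A B ck ah : 1 <= s -> 0 < d -> 0 <= A -> 0 <= B ->
  0 <= ck -> 0 < ah -> m != k -> B <= A * (ck * d `^ k) -> d * s <= ah ->
  B / (k - m) * ((1 + s) `^ (k - m) - 1) <=
  A / `|k - m| * ck * (1 + 2 `^ (k - m) * ah `^ (k - m)) * d `^ Num.min k m.
Proof.
move=> s1 d0 A0 B0 ck0 ah0 mk Ble dsa.
have s0 : 0 < s by lra.
set sg := k - m; have sg0 : sg != 0 by rewrite subr_eq0 eq_sym.
have ns0 : 0 < `|sg| by rewrite normr_gt0.
have dk0 : 0 <= d `^ k by exact: powR_ge0.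
have H0 : 0 <= 2 `^ sg * ah `^ sg by rewrite mulr_ge0// powR_ge0.
have X0 : 0 <= A / `|sg| * ck.
  exact: (mulr_ge0 (divr_ge0 A0 (ltW ns0)) ck0).
have Bs : B / `|sg| <= A / `|sg| * ck * d `^ k.
  rewrite mulrAC -mulrA mulrAC; apply: ler_wpM2r; first by rewrite invr_ge0 ltW.
  by rewrite [d `^ k * _]mulrC.
have [sneg|spos] := ltP sg 0.
- have km : k < m by rewrite -subr_lt0.
  rewrite min_l ?(ltW km)//.
  apply: (@le_trans _ _ (B / `|sg|)).
    have -> : B / sg * ((1 + s) `^ sg - 1) = B / `|sg| * (1 - (1 + s) `^ sg).
      by rewrite ltr0_norm// invrN; ring.
    rewrite -[leRHS]mulr1; apply: ler_wpM2l; first by apply: divr_ge0 => //; exact: ltW.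
    by rewrite lerBlDr lerDl powR_ge0.
  apply: (le_trans Bs); apply: ler_wpM2r => //.
  by rewrite -[leLHS]mulr1; apply: ler_wpM2l => //; rewrite lerDl.
- have sgp : 0 < sg by rewrite lt_neqAle eq_sym sg0.
  have mk' : m <= k by rewrite -subr_ge0.
  rewrite min_r// (gtr0_norm sgp) in Bs *.
  apply: (@le_trans _ _ (B / sg * (2 * s) `^ sg)).
    apply: ler_wpM2l; first by apply: divr_ge0.
    apply: (@le_trans _ _ ((1 + s) `^ sg)); first by rewrite gerBl.
    by apply: ge0_ler_powR; rewrite ?nnegrE//; [clear -s1; lra|rewrite mulr_ge0// ltW|clear -s1; lra].
  apply: (@le_trans _ _ (A / sg * ck * d `^ k * (2 * s) `^ sg)).
    by apply: ler_wpM2r => //; exact: powR_ge0.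
  have ekey : d `^ k * (2 * s) `^ sg = 2 `^ sg * (d * s) `^ sg * d `^ m.
    rewrite !powRM ?(ltW s0) ?(ltW d0)//.
    have -> : d `^ k = d `^ sg * d `^ m.
      by rewrite -powRD; [rewrite /sg subrK|rewrite (gt_eqF d0) implybT].
    ring.
  rewrite -mulrA ekey mulrA; apply: ler_wpM2r; first exact: powR_ge0.
  rewrite (gtr0_norm sgp) in X0.
  apply: ler_wpM2l => //; apply: (@le_trans _ _ (2 `^ sg * ah `^ sg)); last by rewrite lerDr.
  apply: ler_wpM2l; first exact: powR_ge0.
  apply: ge0_ler_powR => //; rewrite nnegrE; last exact: ltW.
  by rewrite mulr_ge0// ltW.
Qed.

Definition C_weight m k : R :=
  (2 / slope m) `^ `|k - m - 1| / `|k - m| * C_al m `^ k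
    * (1 + 2 `^ (k - m) * a_hi m `^ (k - m)).

(** The integrand is [(d * al) ^ k * Y ^ (k - m - 1)]. As [Y] is comparable to [1 + t] with ratio at
    most [2 / slope m] either way, it is dominated by a pure power with an explicit primitive. *)
Lemma weight_integral_k m k Y d al s : scaled m Y d al s -> 0 < k -> m != k ->
  prm (fun x => Pbar m Y x * Y x * (d * al * Y x) `^ k) s <= C_weight m k * d `^ Num.min k m.
Proof.
move=> hS k0 mk; have hY := sc_prof hS; have m1 := sc_m1 hS.
have sl0 := slope_gt0 m1; have sl1 := slope_le1 m1.
have s0 := sc_s0 hS; have s1 := sc_s1 hS; have d0 := sc_d0 hS; have dal0 := sc_dal0 hS.
pose sg := k - m; have sg0 : sg != 0 by rewrite subr_eq0 eq_sym.
pose u := 2 / slope m.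
have u0 : 0 < u by exact: divr_gt0.
have u1 : 1 <= u by rewrite /u ler_pdivlMr//; lra.
pose A := u `^ `|sg - 1|.
pose B := A * (d * al) `^ k.
have A0 : 0 <= A by exact: powR_ge0.
have B0 : 0 <= B by rewrite mulr_ge0// powR_ge0.
have u0' := ltW u0.
have pos1 (t : R) : 0 <= t -> 0 < 1 + t by move=> t0; lra.
have bnd (t : R) : 0 < t -> Pbar m Y t * Y t * (d * al * Y t) `^ k <= B * (1 + t) `^ (sg - 1).
  move=> t0; have t1 := pos1 t (ltW t0).
  have Y0 := Y_gt0 t hY.
  have -> : Pbar m Y t * Y t * (d * al * Y t) `^ k = (d * al) `^ k * Y t `^ (sg - 1).
    rewrite (Pbar_Y t hY) powRM ?ltW// mulrCA -powRD; last by rewrite (gt_eqF Y0) implybT.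
    by congr (_ * _ `^ _); rewrite /sg; ring.
  rewrite /B [A * _]mulrC -mulrA; apply: ler_wpM2l; first exact: powR_ge0.
  have yt0 : 0 <= Y t / (1 + t) by apply: divr_ge0; exact: ltW.
  have -> : Y t `^ (sg - 1) = (Y t / (1 + t)) `^ (sg - 1) * (1 + t) `^ (sg - 1).
    by rewrite -(powRM _ yt0 (ltW t1)) divfK ?gt_eqF.
  apply: ler_wpM2r; first exact: powR_ge0.
  apply: powR_between => //.
  - rewrite ler_pdivlMr// /u invf_div; have := Y_ge t hY; by rewrite gtr0_norm.
  - rewrite ler_pdivrMr//; have := Y_le t hY; rewrite gtr0_norm// => h.
    apply: (le_trans h); apply: (@le_trans _ _ (2 * (1 + t))); first lra.
    apply: ler_wpM2r; [exact: ltW|rewrite /u ler_pdivlMr//]; lra.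
pose G t := B / sg * (1 + t) `^ sg.
have dG (t : R) : 0 < t -> is_derive t 1 G (B * (1 + t) `^ (sg - 1)).
  move=> t0; have t1 := pos1 t (ltW t0).
  have h := dv_comp (is_derive1_powR sg t1) (dvD (dvC t 1) (dvI t)).
  apply: is_derive_val (dvZ (B / sg) h) _.
  by field.
have cw : continuous (fun x => Pbar m Y x * Y x * (d * al * Y x) `^ k).
  have cP := Pbar_continuous hY; have cY := Y_continuous hY; have cYk : continuous (fun x => Y x `^ k) by exact: (Ypow_continuous hY).
  have -> : (fun x => Pbar m Y x * Y x * (d * al * Y x) `^ k) =
      (fun x => Pbar m Y x * Y x * ((d * al) `^ k * Y x `^ k)).
    by apply/funext => x; rewrite powRM// ltW// (Y_gt0 x hY).
  move=> x; apply: cvgM; first by apply: cvgM; [exact: cP|exact: cY].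
  by apply: cvgM; [exact: cst_continuous|exact: cYk].
have main : prm (fun x => Pbar m Y x * Y x * (d * al * Y x) `^ k) s <= G s - G 0.
  have [||t [t1 t2 e]] := @mvt _ (fun x => G x - prm (fun x => Pbar m Y x * Y x * (d * al * Y x) `^ k) x)
     (fun x => B * (1 + x) `^ (sg - 1) - Pbar m Y x * Y x * (d * al * Y x) `^ k) 0 s (ltW s0).
  - by move=> x x0 _; exact: (dvB (dG x x0) (prm_dv x cw)).
  - apply/derivable_within_continuous => x; rewrite in_itv/= => /andP[x0 _].
    have x1 := pos1 x x0.
    have h := dv_comp (is_derive1_powR sg x1) (dvD (dvC x 1) (dvI x)).
    by case: (dvB (dvZ (B / sg) h) (prm_dv x cw)).
  - have : 0 <= B * (1 + t) `^ (sg - 1) - Pbar m Y t * Y t * (d * al * Y t) `^ k.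
      (* The mean value point may be the endpoint [0], which [bnd] excludes; there [Y = 1] and the
         comparison is direct. *)
      move: t1; rewrite le_eqVlt => /predU1P[<-|t1]; last by rewrite subr_ge0; exact: bnd.
      rewrite (Y_0 hY) addr0 powR1 mulr1 Pbar_powR (Y_0 hY) powR1 !mul1r mulr1 subr_ge0.
      rewrite /B -[leLHS]mul1r; apply: ler_wpM2r; first exact: powR_ge0.
      rewrite /A -[leLHS](powRr0 u); apply: ler_powR => //.
    move=> h; have := mulr_ge0 h (ltW s0); rewrite subr0 in e; rewrite -e prm0; lra.
apply: (le_trans main).
have -> : G s - G 0 = B / sg * ((1 + s) `^ sg - 1) by rewrite /G addr0 powR1; ring.
have Cal0 : 0 <= C_al m by rewrite /C_al divr_ge0// mulr_ge0 ?ltW// a_lo_gt0.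
have Ble : B <= A * (C_al m `^ k * d `^ k).
  rewrite /B; apply: ler_wpM2l => //; rewrite -powRM ?(ltW d0)//.
  apply: ge0_ler_powR; [exact: ltW| | |exact: (dal_hi hS)]; rewrite nnegrE.
    exact: ltW.
  by rewrite mulr_ge0// ltW.
exact: (weight_arith s1 d0 A0 B0 (powR_ge0 _ _) (a_hi_gt0 m1) mk Ble (sc_hi hS)).
Qed.

End tame.

Section apriori.
Context {R : realType}.
Implicit Types (f g Y U V q p w : R -> R) (m k d al s x a b c eps : R).
Local Notation mu := (@lebesgue_measure R).

Lemma lipschitz_of_dv U U1 L : (forall x, is_derive x 1 U (U1 x)) ->
  (forall x, `|U1 x| <= L) -> forall x y, `|U x - U y| <= L * `|x - y|.
Proof.
move=> dU UL.
have key a b : a <= b -> `|U b - U a| <= L * (b - a).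
  move=> ab; have cL : continuous (fun x : R => L * x) by exact: (dv_continuous (fun x => dvZ L (dvI x))).
  have UL' x : a < x -> x < b -> `|U1 x| <= L * 1 by move=> _ _; rewrite mulr1.
  rewrite mulrBr; exact: (dv_norm_le ab (dv_continuous dU) cL (fun x _ _ => dU x)
    (fun x _ _ => dvZ L (dvI x)) UL').
move=> x y; have [xy|/ltW yx] := leP x y.
  by rewrite distrC (distrC x) (ger0_norm (_ : 0 <= y - x)) ?subr_ge0//; exact: key.
by rewrite (ger0_norm (_ : 0 <= x - y)) ?subr_ge0//; exact: key.
Qed.

Lemma C_var_ge0 m : 1 < m -> 0 <= C_var m.
Proof. by move=> m1; rewrite /C_var; lra. Qed.

Lemma C_origin_ge0 m : 1 < m -> 0 <= C_origin m.
Proof.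
move=> m1; have s0 := slope_gt0 m1; have a0 := C_var_ge0 m1; rewrite /C_origin.
have w0 : 0 <= 2 / (m + 1) by apply: divr_ge0 => //; lra.
have i0 : 0 <= 2 / slope m by apply: divr_ge0 => //; exact: ltW.
apply: divr_ge0 => //; apply: addr_ge0 => //; apply: divr_ge0.
  apply: addr_ge0; first exact: mulr_ge0.
  apply: mulr_ge0; [exact: mulr_ge0|exact: addr_ge0].
by apply: divr_ge0 => //; apply: mulr_ge0; [lra|exact: ltW].
Qed.

Lemma C_growth_ge0 m : 1 < m -> 0 <= C_growth m.
Proof.
move=> m1; have a0 := C_var_ge0 m1; have c0 := C_origin_ge0 m1; rewrite /C_growth.
apply: addr_ge0; last by apply: mulr_ge0 => //; lra.
by apply: divr_ge0; [exact: mulr_ge0|apply: divr_ge0 => //; lra].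
Qed.

Definition C_L1 m : R := 1 + 2 * (C_growth m * (2 / slope m) * (m + 1)).

Lemma C_L1_ge0 m : 1 < m -> 0 <= C_L1 m.
Proof.
move=> m1; have h := C_growth_ge0 m1; rewrite /C_L1; apply: addr_ge0 => //; apply: mulr_ge0 => //.
apply: mulr_ge0; last lra.
by apply: mulr_ge0 => //; apply: divr_ge0 => //; exact/ltW/slope_gt0.
Qed.

(** One summand for each of the four terms of the star norm; [C_L1] passes from the L1 norm of the
    given source to that of the full source, which includes [Pbar * U]. *)
Definition C_apriori m : R := C_origin m + 4 * C_L1 m + 4 * a_hi m ^+ 2 * C_L1 m + 2 * a_hi m * C_L1 m.

Lemma chi_measurable_mul s f : measurable_fun setT f ->
  measurable_fun setT (fun x => chi s x * f x).
Proof. by move=> mf; apply: measurable_funM => //; exact: chi_measurable. Qed.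

Lemma L1_le_chi s f w c : 0 <= s -> continuous w -> (forall x, w (- x) = w x) ->
  measurable_fun setT f -> (forall x, - s <= x -> x <= s -> `|f x| <= w x) ->
  2 * prm w s <= c -> L1_le (fun x => chi s x * f x) c.
Proof.
move=> s0 cw ew mf fw wc; apply: (L1_le_trans wc); apply: (L1_le_cut s0 cw ew).
- exact: chi_measurable_mul.
- by move=> x x1 x2; rewrite chi_in// mul1r; exact: fw.
- by move=> x sx; rewrite chi_out// mul0r.
Qed.

Lemma sum4_le (A B C D : R) : 0 <= A -> 0 <= B -> 0 <= C -> 0 <= D ->
  [/\ A <= A + 4 * B + C + D, 2 * B <= A + 4 * B + C + D,
      C <= A + 4 * B + C + D & D <= A + 4 * B + C + D].
Proof. by move=> *; split; lra. Qed.

Section data.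
Variables (m : R) (Y : R -> R) (d al s : R) (q p U : R -> R) (c : R).
Hypotheses (hS : scaled m Y d al s) (cq : continuous q) (cp : continuous p)
  (cU : continuous U) (eq : forall x, q (- x) = q x) (ep : forall x, p (- x) = p x)
  (eU : forall x, U (- x) = U x) (fc : L1_le (cutsum s q p) c)
  (hU : forall x, U x = tent s (cutsum s q (fun x => p x + Pbar m Y x * U x)) x).

Let hY := sc_prof hS.
Let m1 := sc_m1 hS.
Let s0 := sc_s0 hS.
Let p' x := p x + Pbar m Y x * U x.
Let cPU : continuous (fun x => Pbar m Y x * U x).
Proof. by move=> x; apply: cvgM; [exact: (Pbar_continuous hY)|exact: cU]. Qed.
Let cp' : continuous p'.
Proof. by move=> x; apply: cvgD; [exact: cp|exact: cPU]. Qed.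

(** Feeds the growth bound back into the equation: [1 + |x|] is at most a multiple of [Y], so
    [Pbar * U] is dominated by the uniformly integrable weight [Pbar * Y]. *)
Lemma apriori_L1 : L1_le (cutsum s q p') (C_L1 m * c).
Proof.
have c0 := L1_le_ge0 fc.
have [_ hin] := apriori_inner hY (sc_large hS) cq cp cU eq ep eU fc hU.
have -> : cutsum s q p' = fun x => cutsum s q p x + chi s x * (Pbar m Y x * U x).
  by apply/funext => x; rewrite /cutsum /p'; ring.
have -> : C_L1 m * c = c + 2 * (C_growth m * c * (2 / slope m) * (m + 1)) by rewrite /C_L1; ring.
apply: L1_leD => //.
pose K := C_growth m * c * (2 / slope m).
have sl0 := slope_gt0 m1.
have C1c : 0 <= C_growth m * c by apply: mulr_ge0 => //; exact: C_growth_ge0.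
have K0 : 0 <= K by apply: mulr_ge0 => //; apply: divr_ge0 => //; exact: ltW.
have cPY : continuous (fun x => Pbar m Y x * Y x).
  by move=> x; apply: cvgM; [exact: (Pbar_continuous hY)|exact: (Y_continuous hY)].
apply: (@L1_le_chi s _ (fun x => K * (Pbar m Y x * Y x))).
- exact: ltW.
- by apply: continuous_scale.
- by move=> x; rewrite (Pbar_even x hY) (Y_even x hY).
- exact: continuous_measurable.
- move=> x x1 x2; rewrite normrM (gtr0_norm (Pbar_gt0 x hY)) mulrCA.
  apply: ler_wpM2l; first exact/ltW/Pbar_gt0.
  apply: le_trans (hin x x1 x2) _.
  have -> : K * Y x = C_growth m * c * (2 / slope m * Y x) by rewrite /K; ring.
  apply: ler_wpM2l => //.
  have := Y_ge x hY; rewrite -ler_pdivlMl ?divr_gt0// invf_div => h.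
  exact: h.
- rewrite prmZ//; have := ler_wpM2l K0 (weight_integral hS).
  by rewrite /K; lra.
Qed.

Let ftot := cutsum s q p'.
Let UE : U = tent s ftot.
Proof. by apply/funext => x; exact: hU. Qed.

(** The factors [2 * s] and [4 * s ^ 2] lost in the supremum and L1 bounds are absorbed by [d] and
    [d ^ 2], since [d * s <= a_hi m]. *)
Lemma apriori : tame d (C_apriori m * c) U /\ (star_norm d U <= (C_apriori m * c)%:E)%E.
Proof.
have c0 := L1_le_ge0 fc; have fL := apriori_L1; rewrite -/ftot in fL.
have s0' := ltW s0; have d0 := sc_d0 hS; have dhi := sc_hi hS.
have ah0 := a_hi_gt0 m1.
have [hU0 _] := apriori_inner hY (sc_large hS) cq cp cU eq ep eU fc hU.
have C2c : 0 <= C_L1 m * c by apply: mulr_ge0 => //; exact: C_L1_ge0.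
pose F := cutsum1 s q p'.
have dU x : is_derive x 1 U (diff2 s F x) by rewrite UE; exact: tent_dv.
have C0c : 0 <= C_origin m * c by apply: mulr_ge0 => //; exact: C_origin_ge0.
have t2 : 0 <= 4 * a_hi m ^+ 2 * (C_L1 m * c).
  by apply: mulr_ge0 => //; apply: mulr_ge0 => //; exact: exprn_ge0 (ltW ah0).
have t3 : 0 <= 2 * a_hi m * (C_L1 m * c).
  by apply: mulr_ge0 => //; apply: mulr_ge0 => //; exact: ltW.
have C3E : C_apriori m * c = C_origin m * c + 4 * (C_L1 m * c) + 4 * a_hi m ^+ 2 * (C_L1 m * c)
    + 2 * a_hi m * (C_L1 m * c) by rewrite /C_apriori; ring.
have [k1 k2 k3 k4] := sum4_le C0c C2c t2 t3.
rewrite -C3E in k1 k2 k3 k4.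
have sup x : d * `|U x| <= 2 * a_hi m * (C_L1 m * c).
  have := tent_le s0' cq cp' fL x; rewrite -/ftot -UE => h.
  apply: (@le_trans _ _ (2 * (d * s) * (C_L1 m * c))).
    have -> : 2 * (d * s) * (C_L1 m * c) = d * (2 * s * (C_L1 m * c)) by ring.
    by apply: ler_wpM2l => //; exact: ltW.
  by apply: ler_wpM2r => //; apply: ler_wpM2l.
have d2 : 0 <= d ^+ 2 by exact: exprn_ge0 (ltW d0).
have ds2 : d ^+ 2 * (4 * s ^+ 2 * (C_L1 m * c)) <= 4 * a_hi m ^+ 2 * (C_L1 m * c).
  have -> : d ^+ 2 * (4 * s ^+ 2 * (C_L1 m * c)) = 4 * (d * s) ^+ 2 * (C_L1 m * c) by ring.
  apply: ler_wpM2r => //; apply: ler_wpM2l => //.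
  by apply: lerXn2r; rewrite ?nnegrE ?(ltW ah0)//; apply: mulr_ge0 => //; exact: ltW.
have UL1 : L1_le U (4 * s ^+ 2 * (C_L1 m * c)).
  by have := L1_le_tent s0' cq cp' fL; rewrite -/ftot -UE.
split.
  split.
  - exact: eU.
  - exact: le_trans hU0 k1.
  - apply: (lipschitz_of_dv dU) => x.
    exact: le_trans (diff2_cutsum1_le s0' cq cp' fL x) k2.
  - by move=> x; exact: le_trans (sup x) k4.
  - apply: L1_le_trans UL1; rewrite ler_pdivlMr ?exprn_gt0// mulrC.
    exact: le_trans ds2 k3.
pose V := diff2 s ftot.
have VL : L1_le V (4 * (C_L1 m * c)) by exact: (L1_le_diff2 fL).
have D1 : derive1 U = diff2 s F.
  by apply/funext => x; rewrite derive1E; exact: (@derive_val _ _ _ _ _ _ _ (dU x)).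
have wsd : weak_second_derivative U V.
  split; first by move=> x; case: (dU x).
  move=> a b ab; rewrite D1; have [i e] := diff2_primitive s0' cq cp' ab.
  by split.
apply: (@le_trans _ _ ((`|U 0|%R)%:E + Lp_norm 1 V + (d ^+ 2)%R%:E * Lp_norm 1 U + d%:E * Lp_norm +oo U)%E).
  by apply: ereal_inf_lbound; exists V.
rewrite C3E !EFinD; apply: leeD; [apply: leeD; [apply: leeD|]|].
- by rewrite lee_fin.
- exact: Lp_norm1_le VL.
- apply: le_trans (lee_wpmul2l _ (Lp_norm1_le UL1)) _; first by rewrite lee_fin.
  by rewrite -EFinM lee_fin.
- have h x : `|U x| <= 2 * a_hi m * (C_L1 m * c) / d.
    by rewrite ler_pdivlMr// mulrC; exact: sup.
  apply: le_trans (lee_wpmul2l _ (Lp_normoo_le h)) _; first by rewrite lee_fin ltW.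
  by rewrite -EFinM lee_fin mulrC divfK// gt_eqF.
Qed.

End data.

Lemma integrable_measurable V : (forall a b, a <= b -> mu.-integrable `[a, b] (EFin \o V)) ->
  measurable_fun setT V.
Proof.
move=> iV.
have e : [set: R] = \bigcup_n [set` `[- n%:R, n%:R]].
  apply/seteqP; split => // x _.
  have [n xn] : exists n : nat, `|x| <= n%:R.
    by exists (Num.truncn `|x|).+1; rewrite ltW// truncnS_gt.
  by exists n => //=; rewrite in_itv/= -ler_norml.
rewrite e; apply/measurable_fun_bigcup => // n.
have nn : - n%:R <= n%:R :> R by apply: (@le_trans _ _ 0); rewrite ?oppr_le0.
by have /integrableP[/measurable_EFinP] := iV _ _ nn.
Qed.

(** The star norm is an infimum, so a witness is only available below some [b > a]. Evenness gives
    [U' 0 = 0], and then the L1 norm of the weak second derivative bounds [U'] everywhere. *)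
Lemma tame_of_star d a b U : 0 < d -> a < b -> (forall x, U (- x) = U x) ->
  (star_norm d U <= a%:E)%E -> tame d b U.
Proof.
move=> d0 ab eU Ua.
have : (star_norm d U < b%:E)%E by apply: le_lt_trans Ua _; rewrite lte_fin.
move=> /ereal_inf_lt[_ [V [dU pV] ->] Nb].
have n1 := Lp_norm1_ge0 V; have n2 := Lp_norm1_ge0 U; have n3 := Lp_normoo_ge0 U.
have n2' : (0 <= (d ^+ 2)%R%:E * Lp_norm 1 U)%E by apply: mule_ge0 => //; rewrite lee_fin exprn_ge0// ltW.
have n3' : (0 <= d%:E * Lp_norm +oo U)%E by apply: mule_ge0 => //; rewrite lee_fin ltW.
have n0 : (0 <= (`|U 0|%R)%:E)%E by rewrite lee_fin.
have b1 : ((`|U 0|%R)%:E <= b%:E)%E.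
  apply: le_trans (ltW Nb); rewrite -!addeA leeDl// !adde_ge0//.
have b2 : (Lp_norm 1 V <= b%:E)%E.
  apply: le_trans (ltW Nb); rewrite -addeA -addeA addeCA leeDl// !adde_ge0//.
have b3 : ((d ^+ 2)%R%:E * Lp_norm 1 U <= b%:E)%E.
  apply: le_trans (ltW Nb); rewrite -addeA addeCA leeDl// !adde_ge0//.
have b4 : (d%:E * Lp_norm +oo U <= b%:E)%E.
  by apply: le_trans (ltW Nb); rewrite leeDr// !adde_ge0.
have dU1 x : is_derive x 1 U (derive1 U x).
  by apply: DeriveDef; [exact: dU|rewrite derive1E].
have cU := dv_continuous dU1.
have mV : measurable_fun setT V by apply: integrable_measurable => u v uv; case: (pV u v uv).
have VL : L1_le V b by split => //; rewrite -Lp_norm1.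
have U10 : derive1 U 0 = 0.
  have h : is_derive (0:R) 1 U (- derive1 U (- 0)).
    have := dv_refl (dU1 (- 0)); congr is_derive.
    by apply/funext => y; exact: eU.
  have [_ e1] := h; have [_ e2] := dU1 0; rewrite oppr0 in e1.
  by move: e1; rewrite e2; lra.
have U1b x : `|derive1 U x| <= b.
  rewrite -[derive1 U x]subr0 -U10.
  have [x0|/ltW x0] := leP 0 x.
  + by have [_ ->] := pV _ _ x0; exact: L1_le_Rint.
  + by rewrite distrC; have [_ ->] := pV _ _ x0; exact: L1_le_Rint.
split => //.
- exact: (lipschitz_of_dv dU1).
- move=> x; rewrite mulrC -ler_pdivlMr//; apply: Lp_normoo_continuous cU _ x.
  by rewrite EFinM muleC lee_pdivlMl.
- split; first exact: continuous_measurable.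
  rewrite -Lp_norm1 EFinM muleC lee_pdivlMl//.
  exact: exprn_gt0.
Qed.

End apriori.

(** * The nonlinear residual *)

Section nonlinear.
Context {R : realType}.
Implicit Types (f g Y U V q p w : R -> R) (m k d al s x y r t a b c eps th CP : R).

Lemma L1_split s f w h c : 0 <= s -> continuous w -> (forall x, w (- x) = w x) ->
  measurable_fun setT f -> (forall x, - s <= x -> x <= s -> `|f x| <= w x) ->
  (forall x, s < `|x| -> `|f x| <= `|h x|) -> L1_le h c ->
  L1_le f (2 * prm w s + c).
Proof.
move=> s0 cw ew mf fw fh hc.
have -> : f = fun x => chi s x * f x + (f x - chi s x * f x).
  by apply/funext => x; ring.
have mcf := chi_measurable_mul s mf.
apply: L1_leD; first exact: (L1_le_chi s0 cw ew mf fw).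
apply: L1_le_mono hc _; first exact: measurable_funB.
move=> x; have [xs|xs] := leP `|x| s.
  by move: xs; rewrite ler_norml => /andP[x1 x2]; rewrite chi_in// mul1r subrr normr0.
by rewrite chi_out// mul0r subr0; exact: fh.
Qed.

(* Phi' is only meaningful on domPhi; extending it by Phi' 0 = 0 lets the
   iteration run before its values are known to be nonpositive. *)
Definition gphi (Phi : R -> R) r := dPhi 1 Phi (Num.min r 0).

Definition phi_bounds m k (Phi : R -> R) CP := 1 <= CP /\
  forall r, -1 < r -> r <= 0 ->
  `|1 + (m + 1) * dPhi 1 Phi r * (1 + r) `^ (m + 1)| <= CP * (1 + r) `^ k /\
  `|dPhi 2 Phi r * (1 + r) `^ (m + 2) - 1| <= CP * (1 + r) `^ k.

Definition lip_const m CP c := (1 + CP) * c `^ (- (m + 2)).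

Lemma lip_const_ge0 m CP c : 1 <= CP -> 0 <= lip_const m CP c.
Proof. by move=> h; apply: mulr_ge0; [lra|exact: powR_ge0]. Qed.

Lemma dPhi2_le m k Phi CP c r : admissible_potential m k Phi -> phi_bounds m k Phi CP ->
  0 < c -> -1 + c <= r -> r <= 0 -> `|dPhi 2 Phi r| <= lip_const m CP c.
Proof.
move=> hP [CP1 hB] c0 cr r0; have m0 := m_gt0 hP; have k0 := k_gt0 hP.
have r1 : 0 < 1 + r by lra.
have r1' : -1 < r by lra.
have [_ h] := hB r r1' r0.
have pk : (1 + r) `^ k <= 1.
  have := @ge0_ler_powR R k (ltW k0) (1 + r) 1; rewrite powR1; apply; rewrite ?nnegrE//; lra.
have h1 : `|dPhi 2 Phi r * (1 + r) `^ (m + 2)| <= 1 + CP.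
  rewrite -[X in `|X|](subrK 1) addrC; apply: le_trans (ler_normD _ _) _.
  rewrite normr1 lerD2l; apply: (le_trans h); rewrite -[leRHS]mulr1.
  by apply: ler_wpM2l => //; lra.
have p0 : 0 < (1 + r) `^ (m + 2) by exact: powR_gt0.
rewrite normrM (gtr0_norm p0) -ler_pdivlMr// in h1.
apply: (le_trans h1); apply: ler_wpM2l; first lra.
rewrite -powRN powRN powRN lef_pV2 ?posrE ?powR_gt0//.
by apply: ge0_ler_powR; rewrite ?nnegrE; lra.
Qed.

Lemma gphi_lip m k Phi CP c r1 r2 : admissible_potential m k Phi ->
  phi_bounds m k Phi CP -> 0 < c -> c <= 1 -> -1 + c <= r1 -> -1 + c <= r2 ->
  `|gphi Phi r1 - gphi Phi r2| <= lip_const m CP c * `|r1 - r2|.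
Proof.
move=> hP hB c0 c1.
have L0 := lip_const_ge0 m c hB.1.
wlog r12 : r1 r2 / r2 <= r1.
  move=> h h1 h2; have [/h|/ltW /h] := leP r2 r1; first exact.
  by rewrite distrC (distrC r1); exact.
move=> h1 h2; rewrite /gphi.
set u := Num.min r2 0; set v := Num.min r1 0.
have u1 : -1 + c <= u by rewrite le_min h2/=; lra.
have uv : u <= v by rewrite /u /v le_min ge_min r12/= ge_min lexx orbT.
have v0 : v <= 0 by rewrite ge_min lexx orbT.
have u1' : -1 < u by lra.
have [z [z1 z2 ->]] := potential_mvt hP u1' uv v0.
rewrite normrM; apply: ler_pM => //.
  by apply: dPhi2_le hP hB c0 _ _; lra.
rewrite !ger0_norm ?subr_ge0//.
by rewrite /u /v; case: (leP r1 0) => ?; case: (leP r2 0) => ?; lra.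
Qed.

Lemma gphi_continuous m k Phi CP c f : admissible_potential m k Phi ->
  phi_bounds m k Phi CP -> 0 < c -> c <= 1 -> continuous f ->
  (forall x, -1 + c <= f x) -> continuous (fun x => gphi Phi (f x)).
Proof.
move=> hP hB c0 c1 cf fc x; apply/cvgrPdist_lt => e e0.
have L0 := lip_const_ge0 m c hB.1; set L := lip_const m CP c in L0.
have L1 : 0 < L + 1 by lra.
have /cvgrPdist_lt /(_ _ (divr_gt0 e0 L1)) := cf x.
apply: filterS => y h.
apply: le_lt_trans (gphi_lip hP hB c0 c1 (fc x) (fc y)) _.
apply: (@le_lt_trans _ _ ((L + 1) * `|f x - f y|)); first by apply: ler_wpM2r => //; rewrite lerDl.
by rewrite mulrC -ltr_pdivlMr.
Qed.

Lemma gphi_le0 m k Phi r : admissible_potential m k Phi -> -1 < r -> gphi Phi r <= 0.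
Proof.
move=> hP r1; apply: (potential_le0 hP); first by rewrite lt_min r1/=; lra.
by rewrite ge_min lexx orbT.
Qed.

Lemma gphi0 m k Phi : admissible_potential m k Phi -> gphi Phi 0 = 0.
Proof. by move=> hP; rewrite /gphi minxx (dPhi0 hP). Qed.

Lemma gphi_abs m k Phi CP c r : admissible_potential m k Phi ->
  phi_bounds m k Phi CP -> 0 < c -> c <= 1 -> -1 + c <= r ->
  `|gphi Phi r| <= lip_const m CP c * `|r|.
Proof.
move=> hP hB c0 c1 cr; have c2 : -1 + c <= 0 by lra.
by have := gphi_lip hP hB c0 c1 cr c2; rewrite (gphi0 hP) !subr0.
Qed.

(** The first summand bounds the relative error of the singular law at [1 + r = y * (1 + t)], the
    second the effect of [t] on the negative power. The one constant is large enough for both Phi'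
    and Phi''. *)
Definition C_pot m k CP := CP * 2 `^ (m + 2) * 2 `^ k + (m + 2) * 2 `^ (m + 3).

Lemma C_pot_ge0 m k CP : 1 < m -> 1 <= CP -> 0 <= C_pot m k CP.
Proof.
move=> m1 h; rewrite /C_pot addr_ge0// ?mulr_ge0 ?powR_ge0//; lra.
Qed.

Lemma near1_pow (a t : R) : 0 < a -> `|t| <= 1 / 4 ->
  (1 + t) `^ (- a) <= 2 `^ a /\ `|(1 + t) `^ (- a) - 1| <= a * 2 `^ (a + 1) * `|t|.
Proof.
move=> a0 t4; have [t1 t2] : - (1 / 4) <= t /\ t <= 1 / 4 by move: t4; rewrite ler_norml => /andP.
have a1 : 0 < a + 1 by lra.
split.
  have := @powR_between _ 2 (1 + t) (- a); rewrite normrN (gtr0_norm a0); apply; lra.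
have := @powR_near1 _ (- a) t; rewrite normrN (gtr0_norm a0).
have -> : - a - 1 = - (a + 1) by ring.
by rewrite normrN (gtr0_norm a1); apply; lra.
Qed.

Section inner.
Variables (m k : R) (Phi : R -> R) (CP : R) (Y : R -> R) (d al s x r t th : R).
Hypotheses (hP : admissible_potential m k Phi) (hB : phi_bounds m k Phi CP)
  (hS : scaled m Y d al s) (rE : 1 + r = d * al * Y x * (1 + t)) (tth : `|t| <= th)
  (th4 : th <= 1 / 4) (r0 : r <= 0).

Let t4 : `|t| <= 1 / 4. Proof. exact: le_trans th4. Qed.
Let z0 : 0 < 1 + t.
Proof. by have := t4; rewrite ler_norml => /andP[+ _]; lra. Qed.
Let y0 : 0 < d * al * Y x.
Proof. exact: mulr_gt0 (sc_dal0 hS) (Y_gt0 x (sc_prof hS)). Qed.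
Let r1 : -1 < r.
Proof. by rewrite -subr_gt0 opprK addrC rE; exact: mulr_gt0. Qed.
Let zk : (1 + r) `^ k <= 2 `^ k * (d * al * Y x) `^ k.
Proof.
rewrite rE (powRM _ (ltW y0) (ltW z0)) mulrC; apply: ler_wpM2r; first exact: powR_ge0.
have k0 := k_gt0 hP; have := t4; rewrite ler_norml => /andP[_ ?].
by apply: ge0_ler_powR; rewrite ?nnegrE ?(ltW z0) ?(ltW k0)//; lra.
Qed.
Let m1 := sc_m1 hS.
Let th0 : 0 <= th. Proof. exact: le_trans tth. Qed.

Lemma pow_split (a : R) : (1 + r) `^ a = (d * al) `^ a * Y x `^ a * (1 + t) `^ a.
Proof.
have h1 := ltW (sc_dal0 hS); have h2 := ltW (Y_gt0 x (sc_prof hS)).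
by rewrite rE (powRM _ (ltW y0) (ltW z0)) powRM.
Qed.

(** With [1 + r = d * al * Y * (1 + t)] the scaled force is [Pbar] times [z * X], where [z] is a
    power of [1 + t] and [X] the normalized Phi''. Both are near 1: [z] up to [th], and [X] up to
    the k-th power of [d * al * Y]. *)
Lemma inner_Phi2 : `|(d * al) `^ (m + 2) * dPhi 2 Phi r - Pbar m Y x| <=
  Pbar m Y x * (C_pot m k CP * (th + (d * al * Y x) `^ k)).
Proof.
have Y0 := Y_gt0 x (sc_prof hS); have P0 := Pbar_gt0 x (sc_prof hS).
have [_ h] := hB.2 r r1 r0; have CP1 := hB.1.
set X := dPhi 2 Phi r * (1 + r) `^ (m + 2) in h.
have a0 : 0 < m + 2 by have := m1; lra.
have [n1 n2] := near1_pow a0 t4.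
set z := (1 + t) `^ (- (m + 2)) in n1 n2.
have z00 : 0 <= z by exact: powR_ge0.
have -> : (d * al) `^ (m + 2) * dPhi 2 Phi r - Pbar m Y x =
    Pbar m Y x * (z * (X - 1) + (z - 1)).
  rewrite /X pow_split /z Pbar_powR !powRN.
  field; rewrite !gt_eqF ?powR_gt0//.
rewrite normrM (gtr0_norm P0); apply: ler_wpM2l; first exact: ltW.
apply: le_trans (ler_normD _ _) _.
have e1 : `|z * (X - 1)| <= 2 `^ (m + 2) * (CP * (2 `^ k * (d * al * Y x) `^ k)).
  rewrite normrM (ger0_norm z00); apply: ler_pM => //.
  by apply: (le_trans h); apply: ler_wpM2l => //; have := CP1; lra.
have e2 : `|z - 1| <= (m + 2) * 2 `^ (m + 3) * th.
  apply: (le_trans n2); rewrite (_ : m + 2 + 1 = m + 3); last by ring.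
  by apply: ler_wpM2l => //; apply: mulr_ge0; [exact: ltW|exact: powR_ge0].
have k1 : 0 <= CP * 2 `^ (m + 2) * 2 `^ k.
  by apply: mulr_ge0; [apply: mulr_ge0; [have := CP1; lra|]|]; exact: powR_ge0.
have k2 : 0 <= (m + 2) * 2 `^ (m + 3).
  by apply: mulr_ge0; [exact: ltW|exact: powR_ge0].
have yk : 0 <= (d * al * Y x) `^ k by exact: powR_ge0.
have := mulr_ge0 k1 th0; have := mulr_ge0 k2 yk; rewrite /C_pot.
move: e1 e2; move: (`|z * _|) (`|z - 1|) ((d * al * Y x) `^ k) (2 `^ (m + 2)) (2 `^ k) (2 `^ (m + 3)).
by move=> *; lra.
Qed.

Lemma inner_Phi1 : `|(d * al) `^ (m + 1) * dPhi 1 Phi r - Kbar m Y x| <=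
  Pbar m Y x * Y x * (C_pot m k CP * (th + (d * al * Y x) `^ k)).
Proof.
have Y0 := Y_gt0 x (sc_prof hS); have P0 := Pbar_gt0 x (sc_prof hS).
have [h _] := hB.2 r r1 r0; have CP1 := hB.1.
have PY0 : 0 < Pbar m Y x * Y x by exact: mulr_gt0.
set X := 1 + (m + 1) * dPhi 1 Phi r * (1 + r) `^ (m + 1) in h.
have a0 : 0 < m + 1 by have := m1; lra.
have [n1 n2] := near1_pow a0 t4.
set z := (1 + t) `^ (- (m + 1)) in n1 n2.
have z00 : 0 <= z by exact: powR_ge0.
have -> : (d * al) `^ (m + 1) * dPhi 1 Phi r - Kbar m Y x =
    Pbar m Y x * Y x * ((m + 1)^-1 * (z * X - (z - 1))).
  rewrite (Kbar_Pbar x (sc_prof hS)) (Pbar_Y x (sc_prof hS)).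
  rewrite /X pow_split /z !powRN.
  by field; rewrite !gt_eqF ?powR_gt0.
rewrite normrM (gtr0_norm PY0); apply: ler_wpM2l; first exact: ltW.
rewrite normrM gtr0_norm ?invr_gt0//.
have i1 : (m + 1)^-1 <= 1 by rewrite invf_le1//; have := m1; lra.
apply: (@le_trans _ _ (1 * `|z * X - (z - 1)|)); first by apply: ler_wpM2r.
rewrite mul1r; apply: le_trans (ler_normB _ _) _.
have p2 (b c : R) : b <= c -> 2 `^ b <= 2 `^ c :> R.
  by move=> bc; apply: ler_powR => //; lra.
have e1 : `|z * X| <= 2 `^ (m + 2) * (CP * (2 `^ k * (d * al * Y x) `^ k)).
  rewrite normrM (ger0_norm z00); apply: ler_pM => //.
    by apply: (le_trans n1); apply: p2; lra.
  by apply: (le_trans h); apply: ler_wpM2l => //; have := CP1; lra.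
have e2 : `|z - 1| <= (m + 2) * 2 `^ (m + 3) * th.
  apply: (le_trans n2); apply: ler_pM => //.
    by apply: mulr_ge0; [exact: ltW|exact: powR_ge0].
  by apply: ler_pM; [exact: ltW|exact: powR_ge0|lra|apply: p2; lra].
have k1 : 0 <= CP * 2 `^ (m + 2) * 2 `^ k.
  by apply: mulr_ge0; [apply: mulr_ge0; [have := CP1; lra|]|]; exact: powR_ge0.
have k2 : 0 <= (m + 2) * 2 `^ (m + 3).
  by apply: mulr_ge0; [have := m1; lra|exact: powR_ge0].
have yk : 0 <= (d * al * Y x) `^ k by exact: powR_ge0.
have := mulr_ge0 k1 th0; have := mulr_ge0 k2 yk; rewrite /C_pot.
move: e1 e2; move: (`|z * _|) (`|z - 1|) ((d * al * Y x) `^ k) (2 `^ (m + 2)) (2 `^ k) (2 `^ (m + 3)).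
by move=> *; lra.
Qed.

End inner.

(** Chosen so that [eps <= c_small m * d] makes the relative perturbation in the window at most 1/4
    and the absolute one at most [slope m / 40] everywhere. *)
Definition c_small m : R := slope m / (40 * (1 + a_hi m)).
(** [|U| <= eps * (1 + |x|)] is divided by [d * al * Y]: the growth of [Y] gives [2 / slope m], and
    the lower bound on alpha gives [5 * a_hi m]. *)
Definition C_rel m : R := 10 * a_hi m / slope m.

Section perturbation.
Variables (m : R) (Y : R -> R) (d al s eps : R) (U : R -> R).
Hypotheses (hS : scaled m Y d al s) (tU : tame d eps U) (small : eps <= c_small m * d).

Let m1 := sc_m1 hS.
Let d0 := sc_d0 hS.
Let sl0 := slope_gt0 m1.
Let ah0 := a_hi_gt0 m1.

Lemma rel_small : C_rel m * (eps / d) <= 1 / 4.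
Proof.
have e1 : eps / d <= c_small m by rewrite ler_pdivrMr.
have C0 : 0 <= C_rel m.
  by rewrite /C_rel; apply: divr_ge0; [apply: mulr_ge0 => //; exact: ltW|exact: ltW].
apply: le_trans (ler_wpM2l C0 e1) _.
have a1 : 0 < 1 + a_hi m by have := ah0; lra.
have -> : C_rel m * c_small m = a_hi m / (1 + a_hi m) / 4.
  by rewrite /C_rel /c_small; field; rewrite !gt_eqF// mulr_gt0.
have : a_hi m / (1 + a_hi m) <= 1 by rewrite ler_pdivrMr//; have := ah0; lra.
by move: (a_hi m / (1 + a_hi m)) => u; lra.
Qed.

Lemma eps_div_le : eps / d <= slope m / 40.
Proof.
have e1 : eps / d <= c_small m by rewrite ler_pdivrMr.
apply: (le_trans e1); rewrite /c_small; apply: ler_wpM2l; first exact: ltW.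
rewrite lef_pV2 ?posrE//; last by apply: mulr_gt0 => //; have := ah0; lra.
by have := ah0; lra.
Qed.

Lemma U_sup x : `|U x| <= eps / d.
Proof. by case: tU => _ _ _ h _; rewrite ler_pdivlMr// mulrC. Qed.

Lemma perturb_inner x : - s <= x -> x <= s ->
  exists t, [/\ 1 + (Rb m Y d al s x + U x) = d * al * Y x * (1 + t),
    `|t| <= C_rel m * (eps / d) & Rb m Y d al s x + U x <= 0].
Proof.
move=> x1 x2; have hY := sc_prof hS; have Y0 := Y_gt0 x hY; have dal0 := sc_dal0 hS.
have y0 : 0 < d * al * Y x by exact: mulr_gt0.
rewrite (Rb_inner hS x1 x2); exists (U x / (d * al * Y x)); split.
- by field; rewrite !gt_eqF// (sc_al0 hS).
- rewrite normrM normfV (gtr0_norm y0) ler_pdivrMr//.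
  apply: le_trans (tame_grow x tU) _.
  have e0 := tame_ge0 tU.
  have h1 : 1 + `|x| <= 2 / slope m * Y x.
    by have := Y_ge x hY; rewrite -ler_pdivlMl ?divr_gt0// invf_div.
  apply: le_trans (ler_wpM2l e0 h1) _.
  have h2 : 1 <= 5 * a_hi m * (d * al) / d by rewrite ler_pdivlMr// mul1r; exact: dal_lo hS.
  have -> : C_rel m * (eps / d) * (d * al * Y x) =
      (eps * (2 / slope m * Y x)) * (5 * a_hi m * (d * al) / d).
    by rewrite /C_rel; field; rewrite !gt_eqF.
  rewrite -[leLHS]mulr1; apply: ler_wpM2l => //.
  apply: mulr_ge0 => //; apply: mulr_ge0; last exact: ltW.
  by apply: divr_ge0 => //; exact: ltW.
- have h1 := dalY_le hS x1 x2; have h2 := le_trans (ler_norm _) (U_sup x).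
  have h3 := eps_div_le; have h4 := slope_le1 m1.
  by move: h1 h2 h3 h4; move: (d * al * Y x) (U x) (eps / d) (slope m) => *; lra.
Qed.

Lemma perturb_outer x : s <= `|x| -> -1 + slope m / 20 <= Rb m Y d al s x + U x.
Proof.
move=> sx; have [h1 _] := Rb_outer hS sx.
have h2 := U_sup x; rewrite ler_norml in h2; move/andP: h2 => [h2 _].
have h3 := eps_div_le; have h4 := sl0.
by move: h1 h2 h3 h4; move: (Rb _ _ _ _ _ _) (U x) (eps / d) (slope m) => *; lra.
Qed.

(** This distance to the singularity shrinks with [d]. It is used only qualitatively, for continuity
    of the force and for values above -1; the estimates use the relative bound inside and
    [slope m / 20] outside. *)
Definition floor_R := Num.min (d * al / 2) (slope m / 20).

Lemma floor_R_gt0 : 0 < floor_R.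
Proof. by rewrite lt_min !divr_gt0// ?(sc_dal0 hS). Qed.

Lemma floor_R_le1 : floor_R <= 1.
Proof. by rewrite ge_min; apply/orP; right; have := slope_le1 m1; lra. Qed.

Lemma perturb_all x : -1 + floor_R <= Rb m Y d al s x + U x.
Proof.
have [sx|sx] := leP s `|x|.
  by apply: le_trans (perturb_outer sx); rewrite lerD2l ge_min lexx orbT.
have /andP[x1 x2] : - s <= x <= s by rewrite -ler_norml ltW.
have [t [e1 e2 _]] := perturb_inner x1 x2.
apply: (@le_trans _ _ (-1 + d * al / 2)); first by rewrite lerD2l ge_min lexx.
have h1 := le_trans e2 rel_small.
have Y1 := Y_ge1 x (sc_prof hS); have dal0 := sc_dal0 hS.
have h2 : 3 / 4 <= 1 + t by move: h1; rewrite ler_norml => /andP[+ _]; lra.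
have h3 : d * al * 1 <= d * al * Y x by apply: ler_wpM2l => //; exact: ltW.
have y0 : 0 <= d * al * Y x by move: h3 dal0; move: (d * al) (d * al * Y x) => *; lra.
have h4 : d * al * Y x * (3 / 4) <= d * al * Y x * (1 + t) by apply: ler_wpM2l.
rewrite -e1 in h4.
by move: h3 h4 dal0; move: (d * al * Y x) (d * al) (Rb _ _ _ _ _ _) (U x) => *; lra.
Qed.

End perturbation.

End nonlinear.

(** * Size and Lipschitz constant of the residual *)

Section fixed_point.
Context {R : realType}.
Implicit Types (f g Y U V q p w : R -> R) (m k d al s x y r t a b c eps th CP : R).

Definition C_lip m CP : R := lip_const m CP (slope m / 20).

Definition C_contract m k CP : R :=
  4 / slope m * C_pot m k CP * (C_rel m * (m + 1) + C_weight m k)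
  + C_al m `^ (m + 2) * C_lip m CP.

(** The factor [6 * a_hi m] reflects that the approximate wave is bounded by 1 and supported in
    [[- 3 * s, 3 * s]]. *)
Definition C_residual m k CP : R :=
  2 * C_al m * C_pot m k CP * C_weight m k + 6 * a_hi m * C_al m `^ (m + 2) * C_lip m CP.

Lemma C_al_ge0 m : 1 < m -> 0 <= C_al m.
Proof.
move=> m1; apply: divr_ge0 => //; apply: mulr_ge0; [exact: ltW (slope_gt0 m1)|exact: ltW (a_lo_gt0 m)].
Qed.

Lemma C_rel_ge0 m : 1 < m -> 0 <= C_rel m.
Proof.
move=> m1; apply: divr_ge0; last exact: ltW (slope_gt0 m1).
by apply: mulr_ge0 => //; exact: ltW (a_hi_gt0 m1).
Qed.

Lemma C_weight_ge0 m k : 1 < m -> 0 <= C_weight m k.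
Proof.
move=> m1; rewrite /C_weight; apply: mulr_ge0; last by rewrite addr_ge0// mulr_ge0// powR_ge0.
by apply: mulr_ge0; [apply: mulr_ge0|]; rewrite ?powR_ge0 ?invr_ge0.
Qed.

Lemma C_lip_ge0 m CP : 1 <= CP -> 0 <= C_lip m CP.
Proof. exact: lip_const_ge0. Qed.

Lemma C_contract_ge0 m k CP : 1 < m -> 1 <= CP -> 0 <= C_contract m k CP.
Proof.
move=> m1 h; rewrite /C_contract; apply: addr_ge0; last first.
  by apply: mulr_ge0; [exact: powR_ge0|exact: C_lip_ge0].
have sl := ltW (slope_gt0 m1).
apply: mulr_ge0; first by apply: mulr_ge0; [exact: divr_ge0|exact: C_pot_ge0].
apply: addr_ge0; last exact: C_weight_ge0.
by apply: mulr_ge0; [exact: C_rel_ge0|lra].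
Qed.

Lemma C_residual_ge0 m k CP : 1 < m -> 1 <= CP -> 0 <= C_residual m k CP.
Proof.
move=> m1 h; rewrite /C_residual.
have a1 := C_al_ge0 m1; have a2 := C_pot_ge0 k m1 h; have a3 := C_weight_ge0 k m1.
have a4 := ltW (a_hi_gt0 m1); have a5 := C_lip_ge0 m h; have a6 := powR_ge0 (C_al m) (m + 2).
move: a1 a2 a3 a4 a5 a6.
move: (C_al m) (C_pot m k CP) (C_weight m k) (a_hi m) (C_lip m CP) (_ `^ _) => *.
by rewrite addr_ge0// !mulr_ge0.
Qed.

Lemma powR_step (x a : R) : 0 < x -> x `^ (a + 1) = x * x `^ a.
Proof.
move=> x0; rewrite (@powRD _ x a 1); first by rewrite powRr1 ?(ltW x0)// mulrC.
by apply/implyP => _; rewrite gt_eqF.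
Qed.

Section step.
Variables (m k : R) (Phi : R -> R) (CP : R) (Y : R -> R) (d al s : R).
Hypotheses (hP : admissible_potential m k Phi) (hB : phi_bounds m k Phi CP)
  (hS : scaled m Y d al s).

Let kap := Num.min k m.
Let beta := (d * al) `^ (m + 2).
Let m1 := sc_m1 hS.
Let d0 := sc_d0 hS.
Let hY := sc_prof hS.
Let s0 := ltW (sc_s0 hS).
Let cP := Pbar_continuous hY.
Let cY := Y_continuous hY.

Definition residual_q U x := beta * gphi Phi (Rb m Y d al s x + U x).
Definition residual_p U x := - (d * al * Kbar m Y x) - Pbar m Y x * U x.
Definition residual U := cutsum s (residual_q U) (residual_p U).

Lemma beta_le : beta <= C_al m `^ (m + 2) * d `^ (m + 2).
Proof.
rewrite -powRM ?(C_al_ge0 m1) ?(ltW d0)//; apply: ge0_ler_powR; rewrite ?nnegrE.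
- by have := m1; lra.
- exact: ltW (sc_dal0 hS).
- by apply: mulr_ge0; [exact: C_al_ge0|exact: ltW].
- exact: dal_hi hS.
Qed.

Lemma beta_le2 : beta / d ^+ 2 <= C_al m `^ (m + 2) * d `^ m.
Proof.
rewrite ler_pdivrMr ?exprn_gt0//; apply: (le_trans beta_le).
have -> : m + 2 = m + 1 + 1 by ring.
rewrite -mulrA; apply: ler_wpM2l; first exact: powR_ge0.
rewrite !powR_step// expr2.
by rewrite le_eqVlt; apply/orP; left; apply/eqP; ring.
Qed.

Lemma pow_d_le a b : b <= a -> d `^ a <= d `^ b.
Proof. by move=> ab; rewrite ger_powR// d0 (sc_d1 hS). Qed.

Lemma kap_le_m : kap <= m. Proof. by rewrite /kap ge_min lexx orbT. Qed.

Lemma residual_q_continuous eps U : tame d eps U -> eps <= c_small m * d -> continuous (residual_q U).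
Proof.
move=> tU small; apply: continuous_scale.
apply: (gphi_continuous hP hB (floor_R_gt0 hS) (floor_R_le1 hS)).
  by apply: continuous_add; [exact: Rb_continuous|exact: tame_continuous tU].
by move=> x; exact: perturb_all hS tU small x.
Qed.

Lemma residual_p_continuous eps U : tame d eps U -> continuous (residual_p U).
Proof.
move=> tU x; apply: cvgB; last by apply: cvgM; [exact: cP|exact: tame_continuous tU x].
by apply: cvgN; apply: continuous_scale; exact: Kbar_continuous hS.
Qed.

Lemma residual_q_even eps U x : tame d eps U -> residual_q U (- x) = residual_q U x.
Proof. by case=> eU _ _ _ _; rewrite /residual_q (Rb_even hS) eU. Qed.

Lemma residual_p_even eps U x : tame d eps U -> residual_p U (- x) = residual_p U x.
Proof. by case=> eU _ _ _ _; rewrite /residual_p (Kbar_even hS) (Pbar_even x hY) eU. Qed.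

Lemma one_plus_norm_le x : 1 + `|x| <= 2 / slope m * Y x.
Proof.
have sl := slope_gt0 m1; have := Y_ge x hY.
by rewrite -ler_pdivlMl ?divr_gt0// invf_div.
Qed.

Lemma min0_id r : r <= 0 -> Num.min r 0 = r.
Proof. by move=> h; rewrite min_l. Qed.

(** Lets the intermediate point of the mean value theorem inherit the relative bound of the two
    endpoints. *)
Lemma between_factor a u v t1 t2 th : 0 < a -> 1 + u = a * (1 + t1) -> 1 + v = a * (1 + t2) ->
  `|t1| <= th -> `|t2| <= th -> forall r, u <= r -> r <= v ->
  exists2 t, 1 + r = a * (1 + t) & `|t| <= th.
Proof.
move=> a0 e1 e2 h1 h2 r ur rv; exists ((1 + r) / a - 1).
  by field; rewrite gt_eqF.
move: h1 h2; rewrite !ler_norml => /andP[h1 _] /andP[_ h2]; apply/andP; split.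
- apply: (le_trans h1); rewrite -lerBlDr opprK ler_pdivlMr// mulrC addrC -e1; lra.
- apply: le_trans h2; rewrite lerBlDr ler_pdivrMr// mulrC (addrC t2) -e2; lra.
Qed.

Lemma inner_diff eps U1 U2 x : tame d eps U1 -> tame d eps U2 -> eps <= c_small m * d ->
  - s <= x -> x <= s ->
  `|beta * gphi Phi (Rb m Y d al s x + U1 x) - beta * gphi Phi (Rb m Y d al s x + U2 x)
    - Pbar m Y x * (U1 x - U2 x)| <=
  Pbar m Y x * (C_pot m k CP * (C_rel m * (eps / d) + (d * al * Y x) `^ k)) * `|U1 x - U2 x|.
Proof.
move=> + + small x1 x2.
wlog le12 : U1 U2 / U2 x <= U1 x.
  move=> h t1 t2; have [h12|/ltW h12] := leP (U2 x) (U1 x); first exact: h h12 t1 t2.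
  have := h U2 U1 h12 t2 t1; rewrite (distrC (U2 x)); apply: le_trans.
  by rewrite -[leLHS]normrN le_eqVlt; apply/orP; left; apply/eqP; congr `|_|; ring.
move=> tU1 tU2.
have [t1 [e1 h1 n1]] := perturb_inner hS tU1 small x1 x2.
have [t2 [e2 h2 n2]] := perturb_inner hS tU2 small x1 x2.
have th4 := rel_small hS small.
rewrite /gphi (min0_id n1) (min0_id n2).
set r1 := _ + U1 x; set r2 := _ + U2 x.
have r21 : r2 <= r1 by rewrite lerD2l.
have y0 : 0 < d * al * Y x by exact: mulr_gt0 (sc_dal0 hS) (Y_gt0 x hY).
have r2g : -1 < r2.
  rewrite -subr_gt0 opprK addrC e2; apply: mulr_gt0 => //.
  by move: (le_trans h2 th4); rewrite ler_norml => /andP[+ _]; lra.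
have [r [ra rb rE]] := potential_mvt hP r2g r21 n1.
have [t te tt] := between_factor y0 e2 e1 h2 h1 ra rb.
have r0 : r <= 0 by exact: le_trans n1.
have := inner_Phi2 hP hB hS te tt th4 r0.
rewrite -mulrBr rE.
have -> : r1 - r2 = U1 x - U2 x by rewrite /r1 /r2; ring.
have -> : beta * (dPhi 2 Phi r * (U1 x - U2 x)) - Pbar m Y x * (U1 x - U2 x) =
  (beta * dPhi 2 Phi r - Pbar m Y x) * (U1 x - U2 x) by ring.
by rewrite normrM => h; apply: ler_wpM2r.
Qed.

Lemma outer_diff eps U1 U2 x : tame d eps U1 -> tame d eps U2 -> eps <= c_small m * d ->
  s <= `|x| ->
  `|beta * gphi Phi (Rb m Y d al s x + U1 x) - beta * gphi Phi (Rb m Y d al s x + U2 x)| <=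
  beta * C_lip m CP * `|U1 x - U2 x|.
Proof.
move=> tU1 tU2 small sx.
have sl := slope_gt0 m1; have sl1 := slope_le1 m1.
have c0 : 0 < slope m / 20 by exact: divr_gt0.
have c1 : slope m / 20 <= 1 by lra.
rewrite -mulrBr normrM (ger0_norm (powR_ge0 _ _)) -mulrA; apply: ler_wpM2l; first exact: powR_ge0.
apply: le_trans (gphi_lip hP hB c0 c1 (perturb_outer hS tU1 small sx)
  (perturb_outer hS tU2 small sx)) _.
apply: ler_wpM2l; first exact: C_lip_ge0 hB.1.
by rewrite le_eqVlt; apply/orP; left; apply/eqP; congr `|_|; ring.
Qed.

Lemma weight2 a b : 0 <= a -> 0 <= b -> let w := fun x =>
    a * (Pbar m Y x * Y x) + b * (Pbar m Y x * Y x * (d * al * Y x) `^ k) in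
  [/\ continuous w, forall x, w (- x) = w x &
    prm w s <= a * (m + 1) + b * (C_weight m k * d `^ kap)].
Proof.
move=> a0 b0 w.
have c1 : continuous (fun x => Pbar m Y x * Y x) by exact: continuous_mul.
have cYk : continuous (fun x => (d * al * Y x) `^ k).
  have -> : (fun x => (d * al * Y x) `^ k) = fun x => (d * al) `^ k * Y x `^ k.
    apply/funext => x; apply: powRM; first exact: ltW (sc_dal0 hS).
    exact: ltW (Y_gt0 x hY).
  by apply: continuous_scale; exact: Ypow_continuous hY.
have c2 : continuous (fun x => Pbar m Y x * Y x * (d * al * Y x) `^ k).
  exact: continuous_mul.
have d1 := @continuous_scale R a _ c1; have d2 := @continuous_scale R b _ c2.
split.
- exact: continuous_add.
- by move=> x; rewrite /w (Pbar_even x hY) (Y_even x hY).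
rewrite /w (prmD d1 d2) (prmZ a c1) (prmZ b c2); apply: lerD; apply: ler_wpM2l => //.
  exact: weight_integral hS.
exact: weight_integral_k hS (k_gt0 hP) (m_neq_k hP).
Qed.

(** In the window [|U1 - U2|] is at most a multiple of [e' * Y], so the weight [Pbar * Y] appears.
    Outside, the L1 norm of the difference costs [d ^ (- 2)], which the prefactor of order
    [d ^ (m + 2)] reduces to [d ^ m]. *)
Lemma residual_diff eps e' U1 U2 : tame d eps U1 -> tame d eps U2 -> eps <= c_small m * d ->
  tame d e' (fun x => U1 x - U2 x) ->
  L1_le (cutsum s (fun x => residual_q U1 x - residual_q U2 x) (fun x => residual_p U1 x - residual_p U2 x))
    (C_contract m k CP * (eps / d + d `^ kap) * e').
Proof.
move=> tU1 tU2 small tD; have e'0 := tame_ge0 tD; have e0 := tame_ge0 tU1.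
have sl := slope_gt0 m1; have Ci := C_pot_ge0 k m1 hB.1; have Ct := C_rel_ge0 m1.
have CL := C_lip_ge0 m hB.1.
pose u := 2 / slope m * e' * C_pot m k CP.
have u0 : 0 <= u by rewrite mulr_ge0// mulr_ge0// divr_ge0// ltW.
have ed : 0 <= eps / d by rewrite divr_ge0// ltW.
have [cw ew wle] := weight2 (mulr_ge0 u0 (mulr_ge0 Ct ed)) u0.
set w := fun x : R => _ in cw ew wle.
have cq : continuous (fun x => residual_q U1 x - residual_q U2 x).
  by move=> x; apply: cvgB; [exact: residual_q_continuous tU1 small x|exact: residual_q_continuous tU2 small x].
have cp : continuous (fun x => residual_p U1 x - residual_p U2 x).
  by move=> x; apply: cvgB; [exact: residual_p_continuous tU1 x|exact: residual_p_continuous tU2 x].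
have hL : L1_le (fun x => beta * C_lip m CP * (U1 x - U2 x)) (C_al m `^ (m + 2) * C_lip m CP * d `^ kap * e').
  case: (tD) => _ _ _ _ h; apply: L1_le_trans (L1_leZ _ h).
  rewrite ger0_norm; last by apply: mulr_ge0 => //; exact: powR_ge0.
  have -> : beta * C_lip m CP * (e' / d ^+ 2) = beta / d ^+ 2 * (C_lip m CP * e') by ring.
  have -> : C_al m `^ (m + 2) * C_lip m CP * d `^ kap * e' =
    C_al m `^ (m + 2) * d `^ kap * (C_lip m CP * e') by ring.
  apply: ler_wpM2r; first exact: mulr_ge0.
  apply: (le_trans beta_le2); apply: ler_wpM2l; first exact: powR_ge0.
  exact: pow_d_le kap_le_m.
have := L1_split s0 cw ew (cutsum_measurable s cq cp) _ _ hL.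
have h1 x : - s <= x -> x <= s ->
    `|cutsum s (fun x => residual_q U1 x - residual_q U2 x) (fun x => residual_p U1 x - residual_p U2 x) x| <= w x.
  move=> x1 x2; rewrite /cutsum (chi_in x1 x2) mul1r.
  have -> : residual_q U1 x - residual_q U2 x + (residual_p U1 x - residual_p U2 x) =
    beta * gphi Phi (Rb m Y d al s x + U1 x) - beta * gphi Phi (Rb m Y d al s x + U2 x)
    - Pbar m Y x * (U1 x - U2 x) by rewrite /residual_q /residual_p; ring.
  apply: (le_trans (inner_diff tU1 tU2 small x1 x2)).
  have P0 := ltW (Pbar_gt0 x hY); have yk := powR_ge0 (d * al * Y x) k.
  have -> : w x = Pbar m Y x * (C_pot m k CP * (C_rel m * (eps / d) + (d * al * Y x) `^ k)) *
     (e' * (2 / slope m * Y x)) by rewrite /w /u; ring.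
  apply: ler_wpM2l.
    by rewrite mulr_ge0// mulr_ge0// addr_ge0// mulr_ge0.
  apply: le_trans (tame_grow x tD) _; apply: ler_wpM2l => //.
  exact: one_plus_norm_le.
have h2 x : s < `|x| ->
    `|cutsum s (fun x => residual_q U1 x - residual_q U2 x) (fun x => residual_p U1 x - residual_p U2 x) x| <=
    `|beta * C_lip m CP * (U1 x - U2 x)|.
  move=> sx; rewrite /cutsum (chi_out sx) mul0r addr0.
  rewrite [leRHS]normrM (@ger0_norm _ (beta * _)); last by rewrite mulr_ge0// powR_ge0.
  exact: outer_diff tU1 tU2 small (ltW sx).
move=> h; apply: L1_le_trans (h h1 h2).
have dk := powR_ge0 d kap; have := wle.
have := mulr_ge0 (mulr_ge0 u0 (addr_ge0 (mulr_ge0 Ct (addr_ge0 ler01 (ltW (lt_trans ltr01 m1))) ) ler01)) dk => _.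
set W := prm w s => hW.
(* Multiplying out the product form produces the required terms plus nonnegative cross terms. *)
have -> : C_contract m k CP * (eps / d + d `^ kap) * e' =
  2 * (u * (C_rel m * (eps / d)) * (m + 1) + u * (C_weight m k * d `^ kap))
  + C_al m `^ (m + 2) * C_lip m CP * d `^ kap * e'
  + (2 * u * (C_rel m * (m + 1) * d `^ kap + C_weight m k * (eps / d))
     + C_al m `^ (m + 2) * C_lip m CP * (eps / d) * e').
  by rewrite /C_contract /u; field; rewrite !gt_eqF.
have r0 : 0 <= 2 * u * (C_rel m * (m + 1) * d `^ kap + C_weight m k * (eps / d))
     + C_al m `^ (m + 2) * C_lip m CP * (eps / d) * e'.
  have a1 := C_weight_ge0 k m1; have a2 := powR_ge0 (C_al m) (m + 2).
  have a3 : 0 <= m + 1 by have := m1; lra.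
  clearbody u; move: a1 a2 a3 dk u0 Ct ed CL.
  move: (C_weight m k) (C_al m `^ _) (m + 1) (d `^ kap) (C_rel m) (eps / d) (C_lip m CP) => *.
  by rewrite addr_ge0// ?mulr_ge0// addr_ge0// ?mulr_ge0.
rewrite -[leLHS]addr0; apply: lerD => //; apply: lerD => //; exact: ler_wpM2l.
Qed.

Lemma tame0 : tame d 0 (fun=> 0 : R).
Proof.
split => //.
- by rewrite normr0.
- by move=> x y; rewrite subrr normr0 mul0r.
- by move=> x; rewrite normr0 mulr0.
split; first exact: measurable_cst.
by under eq_integral do rewrite normr0; rewrite integral0 mul0r.
Qed.

Lemma c_small_gt0 : 0 < c_small m.
Proof.
apply: divr_gt0; first exact: slope_gt0.
by apply: mulr_gt0 => //; have := a_hi_gt0 m1; lra.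
Qed.

Lemma small0 : 0 <= c_small m * d.
Proof. by rewrite mulr_ge0// ltW// c_small_gt0. Qed.

(** At the unperturbed wave [t = 0], so only the error of the singular law for Phi' remains. Inside,
    the extra power of [d] is the factor [d * al] split off from the prefactor; outside, the support
    of length [6 * s] uses one of the two surplus powers of [d]. *)
Lemma residual_0 : L1_le (residual (fun=> 0)) (C_residual m k CP * d `^ (kap + 1)).
Proof.
have CL := C_lip_ge0 m hB.1; have Ci := C_pot_ge0 k m1 hB.1.
have cq := residual_q_continuous tame0 small0.
have cp := residual_p_continuous tame0.
have dal0 := ltW (sc_dal0 hS).
have [cw ew wle] := weight2 (lexx 0) (mulr_ge0 dal0 Ci).
set w := fun x : R => _ in cw ew wle.
have b0 : 0 <= beta by exact: powR_ge0.
have bL : 0 <= beta * C_lip m CP by exact: mulr_ge0.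
have hL : L1_le (fun x => beta * C_lip m CP * Rb m Y d al s x)
    (6 * s * (beta * C_lip m CP)).
  have s30 : 0 <= 3 * s by rewrite mulr_ge0.
  have cc : continuous (fun _ : R => beta * C_lip m CP) by move=> x; exact: cvg_cst.
  have hh : L1_le (fun x => beta * C_lip m CP * Rb m Y d al s x)
     (2 * prm (fun=> beta * C_lip m CP) (3 * s)).
    apply: L1_le_cut => //.
    - by apply: continuous_measurable; apply: continuous_scale; exact: Rb_continuous.
    - move=> x _ _; rewrite normrM (ger0_norm bL) -[leRHS]mulr1; apply: ler_wpM2l => //.
      exact: Rb_abs.
    - by move=> x sx; rewrite (Rb_support hS (ltW sx)) mulr0.
  apply: L1_le_trans hh.
  have -> : prm (fun=> beta * C_lip m CP) = fun x => beta * C_lip m CP * x.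
    apply: prm_eq => [//|x|]; last by rewrite mulr0.
    by apply: is_derive_val (dvZ _ (dvI x)) _; rewrite mulr1.
  by rewrite le_eqVlt; apply/orP; left; apply/eqP; ring.
have h1 x : - s <= x -> x <= s -> `|residual (fun=> 0) x| <= w x.
  move=> x1 x2.
  have [t [e1 t2 n1]] := perturb_inner hS tame0 small0 x1 x2.
  rewrite /residual /cutsum (chi_in x1 x2) mul1r /residual_q /residual_p /gphi.
  rewrite addr0 in e1 n1; rewrite addr0 (min0_id n1) mulr0 subr0.
  have th0 : 0 <= 1 / 4 :> R by lra.
  have tn : `|t| <= 0 by move: t2; rewrite mul0r mulr0.
  have := inner_Phi1 hP hB hS e1 tn th0 n1.
  have -> : beta = d * al * (d * al) `^ (m + 1).
    rewrite /beta (_ : m + 2 = (m + 1) + 1); last by ring.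
    exact: powR_step (sc_dal0 hS).
  set u := dPhi 1 Phi _; set v := Kbar _ _ _; set c := _ `^ (m + 1).
  have -> : d * al * c * u - d * al * v = d * al * (c * u - v) by ring.
  rewrite normrM (ger0_norm dal0) add0r => h.
  apply: (le_trans (ler_wpM2l dal0 h)).
  by rewrite le_eqVlt; apply/orP; left; apply/eqP; rewrite /w; ring.
have h2 x : s < `|x| -> `|residual (fun=> 0) x| <= `|beta * C_lip m CP * Rb m Y d al s x|.
  move=> sx; rewrite /residual /cutsum (chi_out sx) mul0r addr0 /residual_q addr0.
  rewrite [leRHS]normrM (ger0_norm bL) normrM (ger0_norm b0) -mulrA.
  apply: ler_wpM2l => //.
  have sl := slope_gt0 m1; have sl1 := slope_le1 m1.
  have c0 : 0 < slope m / 20 by exact: divr_gt0.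
  have c1 : slope m / 20 <= 1 by lra.
  by have := perturb_outer hS tame0 small0 (ltW sx); rewrite addr0 => /(gphi_abs hP hB c0 c1).
have := L1_split s0 cw ew (cutsum_measurable s cq cp) h1 h2 hL.
apply: L1_le_trans.
have dk : d `^ (kap + 1) = d * d `^ kap.
  exact: powR_step.
have Cw := C_weight_ge0 k m1; have dk0 := powR_ge0 d kap.
have t1 : 2 * prm w s <= 2 * C_al m * C_pot m k CP * C_weight m k * d `^ (kap + 1).
  have -> : 2 * C_al m * C_pot m k CP * C_weight m k * d `^ (kap + 1) =
    2 * ((C_al m * d) * (C_pot m k CP * (C_weight m k * d `^ kap))) by rewrite dk; ring.
  apply: ler_wpM2l => //; apply: (le_trans wle); rewrite mul0r add0r -[leLHS]mulrA.
  by apply: ler_wpM2r; [exact: mulr_ge0 Ci (mulr_ge0 Cw dk0)|exact: dal_hi hS].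
have t2 : 6 * s * (beta * C_lip m CP) <= 6 * a_hi m * C_al m `^ (m + 2) * C_lip m CP * d `^ (kap + 1).
  have -> : 6 * s * (beta * C_lip m CP) = 6 * (C_lip m CP * (d * s * (beta / d ^+ 2 * d))).
    by field; rewrite gt_eqF.
  have -> : 6 * a_hi m * C_al m `^ (m + 2) * C_lip m CP * d `^ (kap + 1) =
    6 * (C_lip m CP * (a_hi m * (C_al m `^ (m + 2) * d `^ kap * d))) by rewrite dk; ring.
  apply: ler_wpM2l => //; apply: ler_wpM2l => //; apply: ler_pM.
  - by rewrite mulr_ge0// ltW.
  - by rewrite !mulr_ge0// ?invr_ge0 ?exprn_ge0// ltW.
  - exact: sc_hi hS.
  apply: ler_wpM2r; first exact: ltW.
  apply: (le_trans beta_le2); apply: ler_wpM2l; first exact: powR_ge0.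
  exact: pow_d_le kap_le_m.
by rewrite /C_residual [leRHS]mulrDl; exact: lerD.
Qed.

End step.
End fixed_point.

(** * The fixed point *)

Section fixed_point.
Context {R : realType}.
Implicit Types (f g Y U V q p w : R -> R) (m k d al s x y r t a b c eps th CP : R).

Lemma tame_sym d a U V : 0 < d -> tame d a (fun x => U x - V x) ->
  tame d a (fun x => V x - U x).
Proof.
move=> d0 h; have := tameB d0 (@tame0 R d) h; rewrite add0r.
by congr tame; apply/funext => x; rewrite sub0r opprB.
Qed.

Lemma tame_trans d a b U V W : 0 < d -> tame d a (fun x => U x - V x) ->
  tame d b (fun x => V x - W x) -> tame d (a + b) (fun x => U x - W x).
Proof.
move=> d0 h1 h2; have := tameB d0 h1 (tame_sym d0 h2).
by congr tame; apply/funext => x; ring.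
Qed.

Lemma half_pow_cvg (a : R) : a * (2^-1) ^+ n @[n --> \oo] --> (0 : R).
Proof.
rewrite -[X in _ --> X](mulr0 a); apply: cvgM; first exact: cvg_cst.
by apply: cvg_expr; rewrite gtr0_norm// invf_lt1//; lra.
Qed.

Lemma le0_of_half_pow (u a : R) : (forall n, u <= a * (2^-1) ^+ n) -> u <= 0.
Proof.
move=> h; rewrite -(cvg_lim (@Rhausdorff R) (half_pow_cvg a)).
apply: limr_ge; first by apply/cvg_ex; exists 0; exact: half_pow_cvg.
exact: nearW.
Qed.

(** Half of the radius pays for the residual at [0], the contraction for the rest; the summand 1
    makes it positive. *)
Definition C_radius m k CP : R := 2 * (C_apriori m * C_residual m k CP) + 1.

Lemma C_apriori_ge0 m : 1 < m -> 0 <= C_apriori m.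
Proof.
move=> m1; have a1 := C_origin_ge0 m1; have a2 := C_L1_ge0 m1; have a3 := ltW (a_hi_gt0 m1).
rewrite /C_apriori; move: a1 a2 a3; move: (C_origin m) (C_L1 m) (a_hi m) => *.
by rewrite !addr_ge0// !mulr_ge0// exprn_ge0.
Qed.

Section step.
Variables (m k : R) (Phi : R -> R) (CP : R) (Y : R -> R) (d al s : R).
Hypotheses (hP : admissible_potential m k Phi) (hB : phi_bounds m k Phi CP)
  (hS : scaled m Y d al s).

Let m1 := sc_m1 hS.
Let d0 := sc_d0 hS.
Let hY := sc_prof hS.
Let s0 := ltW (sc_s0 hS).
Let cP := Pbar_continuous hY.
Local Notation kap := (Num.min k m).
Local Notation rq := (residual_q m Phi Y d al s).
Local Notation rp := (residual_p m Y d al).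
Local Notation Q := (Rb m Y d al s).

(** The Picard map as a relation: freeze the residual at [U] and solve the linear equation for [V].
    Existence comes from [step_exists], and differences are controlled without first choosing a
    map. *)
Definition is_step U V := [/\ continuous V, forall x, V (- x) = V x &
  forall x, V x = tent s (cutsum s (rq U) (fun x => rp U x + Pbar m Y x * V x)) x].

Lemma step_exists eps U : tame d eps U -> eps <= c_small m * d -> exists V, is_step U V.
Proof.
move=> tU small.
have cq := residual_q_continuous hP hB hS tU small.
have cp := residual_p_continuous hS tU.
have eq x := @residual_q_even R m Phi Y d al s hS eps U x tU.
have ep x := @residual_p_even R m Y d al s hS eps U x tU.
pose e := tent s (cutsum s (rq U) (rp U)).
have ce : continuous e by exact: tent_continuous.
have ee x : e (- x) = e x by exact: tent_even.
have [Z [cZ eZ hZ]] := linear_solvable hY (sc_large hS) ce ee.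
exists (fun x => Z x + e x); split.
- exact: continuous_add.
- by move=> x; rewrite eZ ee.
- have c1 : continuous (fun x => Pbar m Y x * (Z x + e x)).
    by apply: continuous_mul => //; exact: continuous_add.
  move=> x; rewrite {1}hZ {2}/e (tentD x s0 (@zero_fun_continuous R) c1 cq cp).
  congr (tent s _ x); apply: cutsum_eq => y; first by rewrite /zero_fun add0r.
  by move=> _ _; rewrite addrC.
Qed.

Lemma step_tame eps U V c : tame d eps U -> eps <= c_small m * d -> is_step U V ->
  L1_le (cutsum s (rq U) (rp U)) c ->
  tame d (C_apriori m * c) V /\ (star_norm d V <= (C_apriori m * c)%:E)%E.
Proof.
move=> tU small [cV eV hV] hc.
have eq x := @residual_q_even R m Phi Y d al s hS eps U x tU.
have ep x := @residual_p_even R m Y d al s hS eps U x tU.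
exact: (apriori hS (residual_q_continuous hP hB hS tU small) (residual_p_continuous hS tU) cV eq ep eV hc hV).
Qed.

Lemma step_diff eps e' U1 U2 V1 V2 : tame d eps U1 -> tame d eps U2 ->
  eps <= c_small m * d -> tame d e' (fun x => U1 x - U2 x) -> is_step U1 V1 -> is_step U2 V2 ->
  tame d (C_apriori m * (C_contract m k CP * (eps / d + d `^ kap) * e')) (fun x => V1 x - V2 x).
Proof.
move=> t1 t2 small tD [cV1 eV1 hV1] [cV2 eV2 hV2].
have cq1 := residual_q_continuous hP hB hS t1 small.
have cq2 := residual_q_continuous hP hB hS t2 small.
have cp1 := residual_p_continuous hS t1; have cp2 := residual_p_continuous hS t2.
have hD := residual_diff hP hB hS t1 t2 small tD.
have cPV1 : continuous (fun x => rp U1 x + Pbar m Y x * V1 x).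
  by apply: continuous_add => //; exact: continuous_mul.
have cPV2 : continuous (fun x => rp U2 x + Pbar m Y x * V2 x).
  by apply: continuous_add => //; exact: continuous_mul.
have cq : continuous (fun x => rq U1 x - rq U2 x).
  by move=> x; apply: cvgB; [exact: cq1|exact: cq2].
have cp : continuous (fun x => rp U1 x - rp U2 x).
  by move=> x; apply: cvgB; [exact: cp1|exact: cp2].
have cV : continuous (fun x => V1 x - V2 x).
  by move=> x; apply: cvgB; [exact: cV1|exact: cV2].
have eq x : rq U1 (- x) - rq U2 (- x) = rq U1 x - rq U2 x.
  by congr (_ - _); [exact: (@residual_q_even R m Phi Y d al s hS eps U1)|
    exact: (@residual_q_even R m Phi Y d al s hS eps U2)].
have ep x : rp U1 (- x) - rp U2 (- x) = rp U1 x - rp U2 x.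
  by congr (_ - _); [exact: (@residual_p_even R m Y d al s hS eps U1)|
    exact: (@residual_p_even R m Y d al s hS eps U2)].
have eV x : V1 (- x) - V2 (- x) = V1 x - V2 x by rewrite eV1 eV2.
have [|//] := apriori hS cq cp cV eq ep eV hD.
move=> x; rewrite {1}hV1 {1}hV2 (tentB x s0 cq1 cPV1 cq2 cPV2).
by congr (tent s _ x); apply: cutsum_eq => [//|y _ _]; ring.
Qed.

(** The approximate wave is itself the convolution of [d * al * Kbar] cut to the window, so adding
    it undoes both subtractions in [residual_p]. *)
Lemma fixed_iff eps U : tame d eps U -> eps <= c_small m * d ->
  is_step U U <-> forall x, Q x + U x = tent s (rq U) x.
Proof.
move=> tU small.
have cq := residual_q_continuous hP hB hS tU small.
have cp := residual_p_continuous hS tU.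
have cU := tame_continuous tU.
have cK : continuous (fun x => d * al * Kbar m Y x).
  by apply: continuous_scale; exact: Kbar_continuous hS.
have cPU : continuous (fun x => Pbar m Y x * U x) by exact: continuous_mul.
have cz := @zero_fun_continuous R.
have E0 : rq U = cutsum s (rq U) zero_fun.
  by apply/funext => x; rewrite /cutsum /zero_fun mulr0 addr0.
have cs : continuous (fun x => rp U x + Pbar m Y x * U x) by exact: continuous_add.
split.
- case=> _ _ h x; rewrite E0 {1}h /Rb (tentD x s0 cz cK cq cs).
  congr (tent s _ x); apply: cutsum_eq => y; first by rewrite /zero_fun add0r.
  by move=> _ _; rewrite /zero_fun /residual_p; ring.
- move=> h; split; [exact: cU|by case: tU|].
  move=> x; have -> : U x = (Q x + U x) - Q x by ring.
  rewrite {1}h {1}E0 /Rb (tentB x s0 cq cz cz cK).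
  congr (tent s _ x); apply: cutsum_eq => y; first by rewrite /zero_fun subr0.
  by move=> _ _; rewrite /zero_fun /residual_p; ring.
Qed.

Hypotheses (hsm : 2 * C_radius m k CP * d `^ kap <= c_small m)
  (hq : C_apriori m * C_contract m k CP * ((2 * C_radius m k CP + 1) * d `^ kap) <= 1 / 4).

Definition rho := d `^ (kap + 1) * C_radius m k CP.

Lemma C_radius_gt0 : 0 < C_radius m k CP.
Proof.
have := mulr_ge0 (C_apriori_ge0 m1) (C_residual_ge0 k m1 hB.1); rewrite /C_radius; lra.
Qed.

Lemma rho_gt0 : 0 < rho.
Proof. by apply: mulr_gt0; [exact: powR_gt0|exact: C_radius_gt0]. Qed.

Lemma rho_eq : rho = d * (C_radius m k CP * d `^ kap).
Proof. by rewrite /rho powR_step//; ring. Qed.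

Lemma rho_small : 2 * rho <= c_small m * d.
Proof.
rewrite rho_eq (_ : 2 * _ = 2 * C_radius m k CP * d `^ kap * d); last by ring.
by apply: ler_wpM2r => //; exact: ltW.
Qed.

(** On the doubled ball the relative size is [2 * rho / d + d ^ kap = (2 * C_radius + 1) * d ^ kap],
    which explains the form of [hq]. The doubling is needed for uniqueness, where competitors are
    tame only with a radius above [rho]. *)
Lemma step_contract e' U1 U2 V1 V2 : tame d (2 * rho) U1 -> tame d (2 * rho) U2 ->
  tame d e' (fun x => U1 x - U2 x) -> is_step U1 V1 -> is_step U2 V2 ->
  tame d (e' / 2) (fun x => V1 x - V2 x).
Proof.
move=> t1 t2 tD s1 s2; have e0 := tame_ge0 tD.
apply: (tame_le d0 _ (step_diff t1 t2 rho_small tD s1 s2)).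
have -> : C_apriori m * (C_contract m k CP * (2 * rho / d + d `^ kap) * e') =
  C_apriori m * C_contract m k CP * ((2 * C_radius m k CP + 1) * d `^ kap) * e'.
  by rewrite rho_eq; field; rewrite gt_eqF.
apply: le_trans (ler_wpM2r e0 hq) _; lra.
Qed.

Lemma step_invariant U V : tame d rho U -> is_step U V ->
  tame d rho V /\ (star_norm d V <= rho%:E)%E.
Proof.
move=> tU sV; have r0 := rho_gt0.
have r2 : rho <= 2 * rho by lra.
have sm := rho_small.
have sm' : rho <= c_small m * d by exact: le_trans sm.
have tU2 := tame_le d0 r2 tU.
have z2 : tame d (2 * rho) (fun=> 0 : R) by apply: (tame_le d0 _ (tame0 d)); lra.
have tD : tame d rho (fun x => U x - 0).
  by move: tU; congr tame; apply/funext => x; rewrite subr0.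
(* The residual at [U] is the residual at [0] plus a difference governed by the Lipschitz bound. *)
have h := L1_leD (residual_0 hP hB hS) (residual_diff hP hB hS tU2 z2 sm tD).
have hc : L1_le (cutsum s (rq U) (rp U)) (C_residual m k CP * d `^ (kap + 1) +
    C_contract m k CP * (2 * rho / d + d `^ kap) * rho).
  move: h; congr L1_le; apply/funext => x; rewrite /residual /cutsum; ring.
have [h1 h2] := step_tame tU sm' sV hc.
suff le : C_apriori m * (C_residual m k CP * d `^ (kap + 1) + C_contract m k CP * (2 * rho / d + d `^ kap) * rho)
    <= rho.
  split; first exact: tame_le d0 le h1.
  by apply: (le_trans h2); rewrite lee_fin.
have -> : C_apriori m * (C_residual m k CP * d `^ (kap + 1) + C_contract m k CP * (2 * rho / d + d `^ kap) * rho)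
  = C_apriori m * C_residual m k CP * d `^ (kap + 1) +
    C_apriori m * C_contract m k CP * ((2 * C_radius m k CP + 1) * d `^ kap) * rho.
  by rewrite {1}rho_eq; field; rewrite gt_eqF.
have a1 := ler_wpM2r (ltW r0) hq.
have a2 : 2 * (C_apriori m * C_residual m k CP * d `^ (kap + 1)) <= rho.
  rewrite /rho /C_radius; have := powR_ge0 d (kap + 1); move: (_ `^ _) (C_apriori _ * _) => *; lra.
lra.
Qed.

Lemma fixed_exists : exists U, [/\ tame d rho U, (star_norm d U <= rho%:E)%E & is_step U U].
Proof.
have r0 := rho_gt0.
have r2 : rho <= 2 * rho by lra.
have sm' : rho <= c_small m * d by exact: le_trans rho_small.
(* Off the ball the choice is arbitrary; the iterates never leave it. *)
have /choice [F hF] U : exists V, tame d rho U -> is_step U V.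
  have [tU|nU] := pselect (tame d rho U); last by exists U.
  by have [V hV] := step_exists tU sm'; exists V.
pose W n := iter n F (fun=> 0 : R).
have tW n : tame d rho (W n).
  elim: n => [|n ih]; first by apply: (tame_le d0 _ (tame0 d)); exact: ltW.
  by have [] := step_invariant ih (hF _ ih).
have sW n : is_step (W n) (W n.+1) by exact: hF.
have tW2 n : tame d (2 * rho) (W n) by exact: tame_le d0 r2 (tW n).
have hhalf n : (2^-1 : R) ^+ n.+1 = 2^-1 ^+ n / 2 by rewrite exprSr.
have p0 n : 0 < (2^-1 : R) ^+ n by rewrite exprn_gt0.
have dW n : tame d (rho * 2^-1 ^+ n) (fun x => W n.+1 x - W n x).
  elim: n => [|n ih].
    by rewrite expr0 mulr1; have := tW 1%N; congr tame; apply/funext => x; rewrite subr0.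
  by rewrite hhalf mulrA; exact: step_contract ih (sW _) (sW _).
have dWk j n : tame d (2 * rho * 2^-1 ^+ n) (fun x => W (n + j)%N x - W n x).
  elim: j n => [n|j ih n].
    rewrite addn0; apply: (tame_le d0 _).
      by apply: mulr_ge0; [lra|exact: ltW].
    by have := tame0 d; congr tame; apply/funext => x; rewrite subrr.
  have := tame_trans d0 (ih n.+1) (dW n); rewrite addSnnS.
  by congr tame; rewrite hhalf; field.
have cW (x : R) : exists l : R, (fun n => W n x) @ \oo --> l.
  pose M := 2 * rho * (1 + `|x|).
  have M0 : 0 <= M by apply: mulr_ge0; [lra|exact: addr_ge0].
  have gr n : `|W n.+1 x - W n x| <= M / 2 * 2^-1 ^+ n.
    apply: (le_trans (tame_grow x (dW n))); rewrite /M.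
    by rewrite le_eqVlt; apply/orP; left; apply/eqP; field.
  (* Subtracting [M * 2^-1 ^+ n] makes the sequence nondecreasing, because consecutive iterates
     differ by at most half of that; convergence then follows by monotonicity. *)
  pose v n := W n x - M * 2^-1 ^+ n.
  have vc : cvg (v @ \oo).
    apply: nondecreasing_is_cvgn.
      apply/nondecreasing_seqP => n; rewrite /v hhalf.
      have := gr n; rewrite ler_norml => /andP[+ _]; have := p0 n; lra.
    exists M => _ [n _ <-]; rewrite /v.
    have := le_trans (ler_norm _) (tame_grow x (tW2 n)); rewrite -/M.
    have := mulr_ge0 M0 (ltW (p0 n)); lra.
  have /cvg_ex [/= l hl] := vc; exists l.
  have -> : (fun n => W n x) = (fun n => v n + M * 2^-1 ^+ n).
    by apply/funext => n; rewrite /v subrK.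
  by rewrite -[l]addr0; apply: cvgD => //; exact: half_pow_cvg.
have [U hU] := choice cW.
have tU : tame d rho U by exact: tame_lim d0 (ltW r0) tW hU.
have dU n : tame d (2 * rho * 2^-1 ^+ n) (fun x => U x - W n x).
  apply: (tame_lim (Un := fun j x => W (n + j)%N x - W n x)) => //.
    by apply: mulr_ge0; [lra|exact: ltW].
  move=> x; apply: cvgB; last exact: cvg_cst.
  have -> : (fun j => W (n + j)%N x) = (fun j => W (j + n)%N x).
    by apply/funext => j; rewrite addnC.
  by rewrite (cvg_shiftn n (fun j => W j x)); exact: hU.
have sU := hF _ tU.
have tU2 := tame_le d0 r2 tU.
(* Both [F U] and [U] are within a multiple of [2^-1 ^+ n] of the iterate [W n.+1], for every
   [n]. *)
have FU : F U = U.
  apply/funext => x; apply/eqP; rewrite -subr_eq0 -normr_le0.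
  apply: (@le0_of_half_pow _ (2 * rho * (1 + `|x|))) => n.
  have t1 := step_contract tU2 (tW2 n) (dU n) sU (sW n).
  have t2 := tame_trans d0 t1 (tame_sym d0 (dU n.+1)).
  apply: (le_trans (tame_grow x t2)); rewrite hhalf.
  by rewrite le_eqVlt; apply/orP; left; apply/eqP; field.
(* The limit has a star bound because it is a step of itself, not because star bounds pass to the
   limit. *)
have [_ h] := step_invariant tU sU.
by exists U; rewrite FU in h sU; split; [exact: tU|exact: h|exact: sU].
Qed.

Lemma fixed_unique U V : tame d (2 * rho) U -> tame d (2 * rho) V ->
  is_step U U -> is_step V V -> U = V.
Proof.
move=> tU tV sU sV.
have h n : tame d ((2 * rho + 2 * rho) * 2^-1 ^+ n) (fun x => U x - V x).
  elim: n => [|n ih]; first by rewrite expr0 mulr1; exact: tameB.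
  by rewrite exprSr mulrA; exact: step_contract ih sU sV.
apply/funext => x; apply/eqP; rewrite -subr_eq0 -normr_le0.
apply: (@le0_of_half_pow _ ((2 * rho + 2 * rho) * (1 + `|x|))) => n.
by rewrite mulrAC; exact: tame_grow (h n).
Qed.

End step.
End fixed_point.

(** * Estimates at the solution *)

Section estimates.
Context {R : realType}.
Implicit Types (f g Y U V q p w : R -> R) (m k d al s x y r t a b c eps th CP : R).

Lemma derivable_in_comp f g : derivable_in domPhi f -> continuous g ->
  (forall x, domPhi (g x)) -> continuous (fun x => f (g x)).
Proof.
move=> hf cg gd x; apply/cvgrPdist_lt => e e0.
have [dl dl0 h] := derive_in_lip hf (gd x).
set L := `|_| + 1 in h; have L0 : 0 < L by rewrite ltr_wpDl.
have /cvgrPdist_lt /(_ _ dl0) n1 := cg x.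
have /cvgrPdist_lt /(_ _ (divr_gt0 e0 L0)) n2 := cg x.
near=> y.
have y1 : `|g x - g y| < dl by near: y.
have y2 : `|g x - g y| < e / L by near: y.
rewrite distrC in y1; rewrite distrC; apply: (le_lt_trans (h _ (gd y) y1)).
by rewrite distrC mulrC -ltr_pdivlMr.
Unshelve. all: by end_near.
Qed.

Lemma continuous_sub f g : continuous f -> continuous g -> continuous (fun x => f x - g x).
Proof. by move=> cf cg x; apply: cvgB; [exact: cf|exact: cg]. Qed.

Definition C_inner m k CP : R :=
  2 * (C_pot m k CP * (C_rel m * C_radius m k CP * (m + 1) + C_weight m k)).

(** The last factor bounds [d] times the L1 norm of the wave: [6 * s] from the approximate wave and
    [eps / d ^ 2] from the perturbation. *)
Definition C_outerK m CP : R := C_al m `^ (m + 1) * C_lip m CP * (6 * a_hi m + c_small m).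

Definition C_outerP m CP : R := C_al m `^ (m + 2) * C_lip m CP.

Section near_profile.
Variables (m k : R) (Phi : R -> R) (CP : R) (Y : R -> R) (d al s eps : R) (U : R -> R).
Hypotheses (hP : admissible_potential m k Phi) (hB : phi_bounds m k Phi CP)
  (hS : scaled m Y d al s) (tU : tame d eps U) (small : eps <= c_small m * d).
Local Notation kap := (Num.min k m).
Local Notation Q := (fun x => Rb m Y d al s x + U x).
Hypotheses (epsd : eps / d <= C_radius m k CP * d `^ kap)
  (Qdom : forall x, domPhi (Q x)).

Let m1 := sc_m1 hS.
Let d0 := sc_d0 hS.
Let hY := sc_prof hS.
Let s0 := ltW (sc_s0 hS).

Let cQ : continuous Q.
Proof. by apply: continuous_add; [exact: Rb_continuous|exact: tame_continuous tU]. Qed.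

Lemma dal_pow_le a : 0 <= a -> (d * al) `^ a <= C_al m `^ a * d `^ a.
Proof.
move=> a0; rewrite -powRM ?(C_al_ge0 m1) ?(ltW d0)//; apply: ge0_ler_powR; rewrite ?nnegrE//.
- exact: ltW (sc_dal0 hS).
- by apply: mulr_ge0; [exact: C_al_ge0|exact: ltW].
- exact: dal_hi hS.
Qed.

(** Common to both inner estimates: the force error comes with the weight [Pbar * Y], and the factor
    [Y] in the estimate of Phi'' brings that error to the same weight. *)
Lemma inner_L1 f : measurable_fun setT f -> (forall x, s < `|x| -> f x = 0) ->
  (forall x t, - s <= x -> x <= s -> 1 + Q x = d * al * Y x * (1 + t) ->
    `|t| <= C_rel m * (eps / d) -> Q x <= 0 ->
    `|f x| <= Pbar m Y x * Y x *
      (C_pot m k CP * (C_rel m * (eps / d) + (d * al * Y x) `^ k))) ->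
  L1_le f (C_inner m k CP * d `^ kap).
Proof.
move=> mf f0 hf; have e0 := tame_ge0 tU.
have Ci := C_pot_ge0 k m1 hB.1; have Ct := C_rel_ge0 m1.
have ed : 0 <= eps / d by exact: divr_ge0 e0 (ltW d0).
have [cw ew wle] := weight2 hP hS (mulr_ge0 Ci (mulr_ge0 Ct ed)) Ci.
set w := fun x : R => _ in cw ew wle.
have := L1_le_cut s0 cw ew mf _ f0.
have fw x : - s <= x -> x <= s -> `|f x| <= w x.
  move=> x1 x2; have [t [e1 t1 q0]] := perturb_inner hS tU small x1 x2.
  apply: (le_trans (hf x t x1 x2 e1 t1 q0)).
  by rewrite le_eqVlt; apply/orP; left; apply/eqP; rewrite /w; ring.
move=> h; apply: L1_le_trans (h fw).
have a1 := ler_wpM2l (mulr_ge0 Ci Ct) epsd.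
have m0 : 0 <= m + 1 by have := m1; lra.
have a2 := ler_wpM2r m0 a1.
have -> : C_inner m k CP * d `^ kap = 2 * (C_pot m k CP * C_rel m * (C_radius m k CP * d `^ kap) * (m + 1) +
   C_pot m k CP * (C_weight m k * d `^ kap)) by rewrite /C_inner; ring.
apply: ler_wpM2l => //; apply: (le_trans wle); apply: lerD => //.
by rewrite mulrA.
Qed.

Lemma gphi_Q x : gphi Phi (Q x) = dPhi 1 Phi (Q x).
Proof. by have /domPhiE [_ h] := Qdom x; rewrite /gphi min0_id. Qed.

Lemma Phi1_continuous : continuous (fun x => dPhi 1 Phi (Q x)).
Proof.
case: (Phi_C3 hP) => _ h _ _.
exact: (@derivable_in_comp (dPhi 1 Phi) _ h cQ Qdom).
Qed.

Lemma Phi2_continuous : continuous (fun x => dPhi 2 Phi (Q x)).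
Proof.
case: (Phi_C3 hP) => _ _ h _.
exact: (@derivable_in_comp (dPhi 2 Phi) _ h cQ Qdom).
Qed.

Let th4 := rel_small hS small.

Lemma inner_K : L1_le (fun x => chi s x * ((d * al) `^ (m + 1) * dPhi 1 Phi (Q x) - Kbar m Y x))
  (C_inner m k CP * d `^ kap).
Proof.
apply: inner_L1.
- apply: chi_measurable_mul; apply: continuous_measurable.
  by apply: continuous_sub; [apply: continuous_scale; exact: Phi1_continuous|exact: Kbar_continuous hS].
- by move=> x sx; rewrite chi_out// mul0r.
- move=> x t x1 x2 e1 t1 q0; rewrite (chi_in x1 x2) mul1r.
  exact: inner_Phi1 hP hB hS e1 t1 th4 q0.
Qed.

Lemma inner_P : L1_le
  (fun x => chi s x * ((d * al) `^ (m + 2) * dPhi 2 Phi (Q x) - Pbar m Y x) * Y x)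
  (C_inner m k CP * d `^ kap).
Proof.
apply: inner_L1.
- have -> : (fun x => chi s x * ((d * al) `^ (m + 2) * dPhi 2 Phi (Q x) - Pbar m Y x) * Y x) =
    fun x => chi s x * (((d * al) `^ (m + 2) * dPhi 2 Phi (Q x) - Pbar m Y x) * Y x).
    by apply/funext => x; rewrite mulrA.
  apply: chi_measurable_mul; apply: continuous_measurable.
  apply: continuous_mul; last exact: Y_continuous hY.
  by apply: continuous_sub; [apply: continuous_scale; exact: Phi2_continuous|exact: Pbar_continuous hY].
- by move=> x sx; rewrite chi_out// !mul0r.
- move=> x t x1 x2 e1 t1 q0; rewrite (chi_in x1 x2) mul1r.
  have Y0 := ltW (Y_gt0 x hY).
  rewrite normrM (ger0_norm Y0) [leRHS]mulrAC; apply: ler_wpM2r => //.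
  exact: inner_Phi2 hP hB hS e1 t1 th4 q0.
Qed.

Let c0 : 0 < slope m / 20.
Proof. by apply: divr_gt0 => //; exact: slope_gt0. Qed.
Let c1 : slope m / 20 <= 1.
Proof. by have := slope_le1 m1; lra. Qed.

Lemma Rb_L1 : L1_le (Rb m Y d al s) (6 * s).
Proof.
have s30 : 0 <= 3 * s by exact: mulr_ge0.
have cc : continuous (fun _ : R => 1 : R) by move=> x; exact: cvg_cst.
have h : L1_le (Rb m Y d al s) (2 * prm (fun=> 1) (3 * s)).
  apply: L1_le_cut => //.
  - by apply: continuous_measurable; exact: Rb_continuous.
  - by move=> x _ _; exact: Rb_abs.
  - by move=> x /ltW sx; rewrite (Rb_support hS sx).
apply: L1_le_trans h.
have -> : prm (fun=> 1) = fun x : R => x.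
  by apply: prm_eq => //; exact: dvI.
by rewrite le_eqVlt; apply/orP; left; apply/eqP; ring.
Qed.

(** Away from the singularity [|Phi' r|] is at most a multiple of [|r|]. The L1 norm of the wave is
    of order [1 / d] and uses up one of the [m + 1] powers of [d] in the prefactor. *)
Lemma outer_K : L1_le (fun x => (1 - chi s x) * ((d * al) `^ (m + 1) * dPhi 1 Phi (Q x)))
  (C_outerK m CP * d `^ m).
Proof.
have CL := C_lip_ge0 m hB.1; have b0 := powR_ge0 (d * al) (m + 1).
have bL : 0 <= (d * al) `^ (m + 1) * C_lip m CP by exact: mulr_ge0.
have tU1 : L1_le U (eps / d ^+ 2) by case: tU.
have hL := L1_leZ ((d * al) `^ (m + 1) * C_lip m CP)
  (L1_leD (L1_le_norm Rb_L1) (L1_le_norm tU1)).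
rewrite (ger0_norm bL) in hL.
have mf : measurable_fun setT (fun x => (1 - chi s x) * ((d * al) `^ (m + 1) * dPhi 1 Phi (Q x))).
  apply: measurable_funM.
    apply: measurable_funB; [exact: measurable_cst|exact: chi_measurable].
  by apply: continuous_measurable; apply: continuous_scale; exact: Phi1_continuous.
have h := L1_le_mono mf hL.
have le x : `|(1 - chi s x) * ((d * al) `^ (m + 1) * dPhi 1 Phi (Q x))| <=
  `|(d * al) `^ (m + 1) * C_lip m CP * (`|Rb m Y d al s x| + `|U x|)|.
  have [xs|xs] := leP `|x| s.
    have /andP[x1 x2] : - s <= x <= s by rewrite -ler_norml.
    by rewrite (chi_in x1 x2) subrr mul0r normr0.
  rewrite (chi_out xs) subr0 mul1r normrM (ger0_norm b0).
  rewrite [leRHS]ger0_norm; last by apply: mulr_ge0 => //; exact: addr_ge0.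
  rewrite -mulrA; apply: ler_wpM2l => //; rewrite -gphi_Q.
  apply: le_trans (gphi_abs hP hB c0 c1 (perturb_outer hS tU small (ltW xs))) _.
  by apply: ler_wpM2l => //; exact: ler_normD.
apply: L1_le_trans (h le).
have h1 : (d * al) `^ (m + 1) <= C_al m `^ (m + 1) * (d * d `^ m).
  rewrite -(powR_step m d0); apply: dal_pow_le; have := m1; lra.
have h2 : d * (6 * s + eps / d ^+ 2) <= 6 * a_hi m + c_small m.
  have -> : d * (6 * s + eps / d ^+ 2) = 6 * (d * s) + eps / d by field; rewrite gt_eqF.
  apply: lerD; first by apply: ler_wpM2l => //; exact: sc_hi hS.
  by rewrite ler_pdivrMr.
have e0 := tame_ge0 tU.
have z0 : 0 <= 6 * s + eps / d ^+ 2.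
  by apply: addr_ge0; [exact: mulr_ge0|apply: divr_ge0 => //; exact: exprn_ge0 (ltW d0)].
apply: (@le_trans _ _ (C_al m `^ (m + 1) * (d * d `^ m) * C_lip m CP * (6 * s + eps / d ^+ 2))).
  by apply: ler_wpM2r => //; exact: ler_wpM2r.
have -> : C_al m `^ (m + 1) * (d * d `^ m) * C_lip m CP * (6 * s + eps / d ^+ 2) =
  C_al m `^ (m + 1) * C_lip m CP * d `^ m * (d * (6 * s + eps / d ^+ 2)) by ring.
have -> : C_outerK m CP * d `^ m = C_al m `^ (m + 1) * C_lip m CP * d `^ m * (6 * a_hi m + c_small m).
  by rewrite /C_outerK; ring.
apply: ler_wpM2l => //; apply: mulr_ge0; last exact: powR_ge0.
by apply: mulr_ge0 => //; exact: powR_ge0.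
Qed.

Lemma outer_P x : `|(1 - chi s x) * ((d * al) `^ (m + 2) * dPhi 2 Phi (Q x))| <=
  C_outerP m CP * d `^ (m + 2).
Proof.
have CL := C_lip_ge0 m hB.1; have b0 := powR_ge0 (d * al) (m + 2).
have p1 := powR_ge0 (C_al m) (m + 2); have p2 := powR_ge0 d (m + 2).
have [xs|xs] := leP `|x| s.
  have /andP[x1 x2] : - s <= x <= s by rewrite -ler_norml.
  rewrite (chi_in x1 x2) subrr mul0r normr0 /C_outerP.
  by apply: mulr_ge0 => //; exact: mulr_ge0.
rewrite (chi_out xs) subr0 mul1r normrM (ger0_norm b0).
have -> : C_outerP m CP * d `^ (m + 2) = C_al m `^ (m + 2) * d `^ (m + 2) * C_lip m CP.
  by rewrite /C_outerP; ring.
apply: ler_pM => //.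
  by apply: dal_pow_le; have := m1; lra.
have /domPhiE [_ q0] := Qdom x.
exact: dPhi2_le hP hB c0 (perturb_outer hS tU small (ltW xs)) q0.
Qed.

End near_profile.

Lemma delta_of_near m c : 0 < m -> 0 < c ->
  \forall omega \near (+oo : set_system R), 0 < omega /\ delta_of m omega <= c.
Proof.
move=> m0 c0; pose u := c^-1 `^ (m / 2).
have u0 : 0 < u by rewrite powR_gt0// invr_gt0.
exists u; split; first exact: gtr0_real.
move=> x ux; have x0 : 0 < x by exact: lt_trans ux.
split => //; rewrite /delta_of powRN -[leRHS]invrK.
have uE : u `^ (2 / m) = c^-1.
  rewrite -powRrM (_ : m / 2 * (2 / m) = 1); last by field; rewrite gt_eqF.
  by rewrite powRr1// invr_ge0 ltW.
rewrite -uE; clearbody u; rewrite lef_pV2 ?posrE ?powR_gt0//.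
apply: (@ge0_ler_powR R (2 / m)).
- exact: divr_ge0 (ltW m0).
- by rewrite nnegrE ltW.
- by rewrite nnegrE ltW.
- exact: ltW.
Qed.

(** Since [min k m > 1] and [d <= 1], the power of [d] is at most [d], so thresholds linear in [d]
    suffice. *)
Lemma small_delta m k CP : 1 < m -> 1 < Num.min k m -> 1 <= CP -> exists2 c : R, 0 < c &
  forall d, 0 < d -> d <= c ->
  [/\ d <= 1, d <= a_lo m / (2 / (m * slope m) + 1 / slope m),
    2 * C_radius m k CP * d `^ Num.min k m <= c_small m &
    C_apriori m * C_contract m k CP * ((2 * C_radius m k CP + 1) * d `^ Num.min k m) <= 1 / 4].
Proof.
move=> m1 k1 CP1.
have sl := slope_gt0 m1; have m0 : 0 < m by lra.
have T0 : 0 < a_lo m / (2 / (m * slope m) + 1 / slope m).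
  apply: divr_gt0; first exact: a_lo_gt0.
  by apply: addr_gt0; apply: divr_gt0 => //; exact: mulr_gt0.
have D0 : 0 <= C_radius m k CP.
  by have := mulr_ge0 (C_apriori_ge0 m1) (C_residual_ge0 k m1 CP1); rewrite /C_radius; lra.
have A0 := mulr_ge0 (C_apriori_ge0 m1) (C_contract_ge0 k m1 CP1).
set A := C_apriori m * C_contract m k CP in A0 *.
have e0 : 0 < c_small m.
  apply: divr_gt0 => //; apply: mulr_gt0 => //; have := a_hi_gt0 m1; lra.
set T := a_lo m / _ in T0 *.
set B := C_radius m k CP in D0 *.
pose c1 := c_small m / (2 * B + 1); pose c2 := 1 / 4 / (A * (2 * B + 1) + 1).
have B1 : 0 < 2 * B + 1 by lra.
have AB : 0 <= A * (2 * B + 1) by exact: mulr_ge0 A0 (ltW B1).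
have AB1 : 0 < A * (2 * B + 1) + 1 by lra.
exists (Num.min 1 (Num.min T (Num.min c1 c2))).
  by rewrite !lt_min T0 ltr01/=; apply/andP; split; apply: divr_gt0 => //; apply: divr_gt0.
move=> d d0; rewrite !le_min => /and4P[d1 dT dc1 dc2].
have dk : d `^ Num.min k m <= d.
  rewrite -[leRHS](powRr1 (ltW d0)); apply: ger_powR; last exact: ltW.
  by rewrite d0 d1.
have p0 := powR_ge0 d (Num.min k m).
split => //.
- rewrite /c1 ler_pdivlMr// in dc1; apply: le_trans dc1; rewrite mulrC.
  by apply: ler_pM => //; lra.
- rewrite mulrA; rewrite /c2 ler_pdivlMr// in dc2; apply: le_trans dc2; rewrite mulrC.
  by apply: ler_pM => //; lra.
Qed.

End estimates.

(** * Existence and uniqueness for the original equation *)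

Section solution.
Context {R : realType}.
Implicit Types (Y U : R -> R) (m k CP d : R).

Lemma solution_exists m k (Phi : R -> R) CP Y omega xi :
  admissible_potential m k Phi -> phi_bounds m k Phi CP -> 0 < omega ->
  let d := delta_of m omega in let al := alpha_of m omega xi in
  scaled m Y d al xi -> 2 * C_radius m k CP * d `^ Num.min k m <= c_small m ->
  C_apriori m * C_contract m k CP * ((2 * C_radius m k CP + 1) * d `^ Num.min k m) <= 1 / 4 ->
  let r := rho m k CP d in
  exists U, [/\ tame d r U, (star_norm d U <= r%:E)%E,
    solves_TW m Phi omega xi (fun x => Rb m Y d al xi x + U x) &
    forall Rt, solves_TW m Phi omega xi Rt -> (forall x, Rt (- x) = Rt x) ->
      (star_norm d (fun x => (Rt x - Rb m Y d al xi x)%R) <= r%:E)%E ->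
      Rt = fun x => Rb m Y d al xi x + U x].
Proof.
move=> hP hB om0 d al hS hsm hq r.
have d0 := sc_d0 hS; have al0 := sc_al0 hS; have s0 := ltW (sc_s0 hS).
have r0 : 0 < r := rho_gt0 hB hS.
have sm2 : 2 * r <= c_small m * d := rho_small hS hsm.
have r12 : r < 2 * r by lra.
have r2 := ltW r12.
have sm : r <= c_small m * d by exact: le_trans sm2.
have betaE : d `^ (m + 2) * al `^ (m + 2) = (d * al) `^ (m + 2).
  by rewrite powRM// ltW.
have [U [tU nU sU]] := fixed_exists hP hB hS hsm hq.
have rqE V : (forall x, domPhi (Rb m Y d al xi x + V x)) ->
   (fun y => d `^ (m + 2) * al `^ (m + 2) * dPhi 1 Phi (Rb m Y d al xi y + V y)) =
   residual_q m Phi Y d al xi V.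
  move=> hV; apply/funext => x; rewrite betaE /residual_q /gphi.
  by have /domPhiE [_ h] := hV x; rewrite min0_id.
exists U; split => //.
  have h := (fixed_iff hP hB hS tU sm).1 sU.
  have fl x : -1 < Rb m Y d al xi x + U x.
    by apply: lt_le_trans (perturb_all hS tU sm x); rewrite ltrDl; exact: floor_R_gt0 hS.
  have dom x : domPhi (Rb m Y d al xi x + U x).
    apply/domPhiE; split; first exact: fl.
    (* The wave is the double convolution of the extended force, which is nonpositive wherever the
       wave exceeds -1; hence the wave is nonpositive and the extension was never active. *)
    rewrite h; have -> : residual_q m Phi Y d al xi U = cutsum xi (residual_q m Phi Y d al xi U) (fun=> 0).
      by apply/funext => y; rewrite /cutsum mulr0 addr0.
    have cq := residual_q_continuous hP hB hS tU sm.
    apply: (tent_le0 s0 cq) => y.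
    by apply: mulr_ge0_le0; [exact: powR_ge0|exact: gphi_le0 hP (fl y)].
  by split=> [//|x]; rewrite h (rqE _ dom).
move=> Rt [dom hRt] eRt nRt.
pose V x := Rt x - Rb m Y d al xi x.
have RtE : Rt = fun x => Rb m Y d al xi x + V x by apply/funext => x; rewrite /V addrC subrK.
have eV x : V (- x) = V x by rewrite /V eRt (Rb_even hS).
(* The strict gap between [r] and [2 * r] is what the passage from the infimum to [tame]
   requires. *)
have tV := tame_of_star d0 r12 eV nRt.
have sV : is_step m Phi Y d al xi V V.
  apply/(fixed_iff hP hB hS tV sm2) => x.
  rewrite RtE in dom hRt; rewrite hRt -(rqE _ dom) //.
rewrite RtE (fixed_unique hP hB hS hsm hq tV (tame_le d0 r2 tU) sV sU)//.
Qed.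

End solution.

Unset Implicit Arguments.
Set Strict Implicit.

Theorem theorem7 (R : realType) (m k : R) (Phi : R -> R)
    (hPhi : admissible_potential m k Phi) :
  exists D C : R, forall Y : R -> R, is_Ybar m Y ->
  \forall omega \near (+oo : set_system R), forall xi : R,
  is_xi m Y omega xi ->
  let delta := delta_of m omega in
  let sol (Rt : R -> R) :=
    [/\ solves_TW m Phi omega xi Rt,
        (forall x, Rt (- x) = Rt x) &
        (star_norm delta (fun x => Rt x - Rbreve m Y omega xi x)%R
          <= (delta `^ (Num.min k m + 1) * D)%:E)%E] in
  exists Rt : R -> R,
    [/\ sol Rt,
        (forall Rt' : R -> R, sol Rt' -> Rt' = Rt) &
        (forall x, -1 < Rt x /\ Rt x <= 0)] /\
    let P := Ptilde m Phi omega xi Rt in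
    let K := Ktilde m Phi omega xi Rt in
    [/\ (Lp_norm 1 (fun x => chi xi x * (K x - Kbar m Y x))%R
           <= (C * delta `^ Num.min k m)%:E)%E,
        (Lp_norm 1 (fun x => (1 - chi xi x) * K x)%R
           <= (C * delta `^ m)%:E)%E,
        (Lp_norm 1 (fun x => chi xi x * (P x - Pbar m Y x) * Y x)%R
           <= (C * delta `^ Num.min k m)%:E)%E &
        (Lp_norm +oo (fun x => (1 - chi xi x) * P x)%R
           <= (C * delta `^ (m + 2))%:E)%E].
Proof.
have k1 := min_gt1 hPhi.
have m1 : 1 < m by move: k1; rewrite lt_min => /andP[].
have m0 := m_gt0 hPhi.
have [CP CP1 bnd] := potential_bounds hPhi.
have hB : phi_bounds m k Phi CP by split.
have [c c0 small] := small_delta m1 k1 CP1.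
pose C := Num.max (C_inner m k CP) (Num.max (C_outerK m CP) (C_outerP m CP)).
have CF : C_inner m k CP <= C by rewrite le_max lexx.
have CG : C_outerK m CP <= C by rewrite !le_max lexx orbT.
have CH : C_outerP m CP <= C by rewrite !le_max lexx !orbT.
(* Both constants are built from [m], [k] and the bound [CP] on the potential, so they are fixed
   before the profile and the frequency. *)
exists (C_radius m k CP), C => Y hY.
have hprof : profile m Y by split.
have near_c := delta_of_near m0 c0.
apply: filterS near_c => omega [om0 dc] xi hxi.
set delta := delta_of m omega in dc *.
have d0 : 0 < delta by exact: powR_gt0.
have [d1 dT hsm hq] := small delta d0 dc.
have hS := scaled_of_xi hprof om0 d1 dT hxi.
have [U [tU nU sU uU]] := solution_exists hPhi hB om0 hS hsm hq.
have RbE : Rbreve m Y omega xi = Rb m Y delta (alpha_of m omega xi) xi.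
  by rewrite /Rb /tent /cutsum; under eq_fun do rewrite /zero_fun add0r.
set al := alpha_of m omega xi in hS tU nU sU uU RbE.
rewrite -/delta in hS tU nU uU.
have al0 := sc_al0 hS.
have sm : rho m k CP delta <= c_small m * delta.
  have := rho_small hS hsm; have := rho_gt0 hB hS; lra.
have epsd : rho m k CP delta / delta <= C_radius m k CP * delta `^ Num.min k m.
  by rewrite (rho_eq k CP hS) mulrC (mulKf (negbT (gt_eqF d0))).
have dom := sU.1.
pose Rt x := Rb m Y delta al xi x + U x.
exists Rt; split.
  split.
  - split; first exact: sU.
      by case: tU => eU _ _ _ _ x; rewrite /Rt (Rb_even hS) eU.
    rewrite RbE; have -> : (fun x => Rt x - Rb m Y delta al xi x) = U.
      by apply/funext => x; rewrite /Rt addrC addKr.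
    exact: nU.
  - by rewrite RbE => Rt' [h1 h2 h3]; exact: (uU Rt' h1 h2 h3).
  - by move=> x; apply/domPhiE; exact: dom.
set K := Ktilde _ _ _ _ _; set P := Ptilde _ _ _ _ _.
have KE : K = fun x => (delta * al) `^ (m + 1) * dPhi 1 Phi (Rb m Y delta al xi x + U x).
  by apply/funext => x; rewrite /K /Ktilde powRM ?ltW.
have PE : P = fun x => (delta * al) `^ (m + 2) * dPhi 2 Phi (Rb m Y delta al xi x + U x).
  by apply/funext => x; rewrite /P /Ptilde powRM ?ltW.
have le a b (t : R) : a <= b -> a * delta `^ t <= b * delta `^ t.
  by move=> ab; exact: (ler_wpM2r (powR_ge0 delta t) ab).
rewrite KE PE; split.
- apply: Lp_norm1_le; apply: (L1_le_trans (le _ _ _ CF)).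
  exact: inner_K hPhi hB hS tU sm epsd dom.
- apply: Lp_norm1_le; apply: (L1_le_trans (le _ _ _ CG)).
  exact: outer_K hPhi hB hS tU sm dom.
- apply: Lp_norm1_le; apply: (L1_le_trans (le _ _ _ CF)).
  exact: inner_P hPhi hB hS tU sm epsd dom.
- apply: Lp_normoo_le => x; apply: (le_trans _ (le _ _ _ CH)).
  exact: outer_P hPhi hB hS tU sm dom x.
Qed.
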